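(* Let $\Omega=\mathbb{T}\times[a,b]$ be a periodic channel, let $v\in C^1([a,b])$ satisfy $\inf_{\Omega}|v|>0$, and let $\bar u=(v(y),0)$ be the corresponding non-stagnant shear flow. Let $p>2$. Then there exists $\varepsilon>0$, depending only on $\inf_\Omega|v|$, $\|v\|_{C^1}$, $\Omega$ and $p$, such that every stationary solution $u$ of the Euler equations in $\Omega$ satisfying $\|u-\bar u\|_{W^{1,p}(\Omega)}<\varepsilon$ is a shear flow.
   Context: A stationary solution of the Euler equations on $\Omega$ is a velocity field $u$ such that, for some pressure $q$, $u\cdot\nabla u=-\nabla q$ and $\nabla\cdot u=0$ in $\Omega$, and $u\cdot\hat n=0$ on $\partial\Omega$. A shear flow is a field of the form $(\tilde v(y),0)$. $W^{1,p}$ is the usual Sobolev space. *)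

(* Defs.v *)
From HB Require Import structures.
From mathcomp Require Import all_boot all_order all_algebra.
From mathcomp Require Import all_classical all_reals all_analysis.

Set Implicit Arguments.
Unset Strict Implicit.
Unset Printing Implicit Defensive.

Import Order.TTheory GRing.Theory Num.Theory.
Import numFieldNormedType.Exports.

Local Open Scope classical_set_scope.
Local Open Scope ring_scope.

(* The circle T is R/LZ for a period L > 0.  A (class of) function(s) on
   T x [a, b] is represented by its values on the fundamental domain
   [0, L[ x ]a, b[; the boundary y = a, y = b is null and only matters for
   the boundary condition (zero_trace below).  Continuous and smooth functions
   on the channel are represented by functions that are L-periodic in x; since
   test functions are of that kind, weak derivatives see the gluing of x = 0
   with x = L. *)
Definition channel (R : realType) (L a b : R) : set (R * R) :=
  `[0, L[ `*` `]a, b[.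

Definition leb2 (R : realType) :
    {measure set (measurableTypeR R * measurableTypeR R) -> \bar R} :=
  (@lebesgue_measure R \x @lebesgue_measure R)%E.

Definition ex (R : realType) : R * R := (1, 0).
Definition ey (R : realType) : R * R := (0, 1).
Arguments ex {R}.
Arguments ey {R}.

Definition xperiodic (R : realType) (L : R) (f : R * R -> R) : Prop :=
  forall x y, f (x + L, y) = f (x, y).

Fixpoint Ck (R : realType) (k : nat) (f : R * R -> R) : Prop :=
  if k is k'.+1 then
    [/\ continuous f,
        forall z, derivable f z ex, forall z, derivable f z ey,
        Ck k' ('D_ex f) & Ck k' ('D_ey f)]
  else continuous f.

Definition smooth (R : realType) (f : R * R -> R) : Prop :=
  forall k, Ck k f.

(* C^oo functions with compact support in T x ]a, b[ *)
Definition test_function (R : realType) (L a b : R) (phi : R * R -> R) : Prop :=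
  [/\ smooth phi, xperiodic L phi &
      exists c d, [/\ a < c, d < b &
        forall x y, ~~ (c <= y <= d) -> phi (x, y) = 0]].

(* L^1_loc (T x ]a, b[) *)
Definition loc_integrable (R : realType) (L a b : R) (f : R * R -> R) : Prop :=
  forall c d, a < c -> d < b ->
    (leb2 R).-integrable (`[0, L[ `*` `[c, d]) (EFin \o f).

Definition is_weak_deriv (R : realType) (L a b : R) (e : R * R)
    (f g : R * R -> R) : Prop :=
  [/\ loc_integrable L a b f, loc_integrable L a b g &
      forall phi, test_function L a b phi ->
        (\int[leb2 R]_(z in channel L a b) (f z * 'D_e phi z) =
         - \int[leb2 R]_(z in channel L a b) (g z * phi z))%R].

Definition weakly_derivable (R : realType) (L a b : R) (e : R * R)
    (f : R * R -> R) : Prop :=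
  exists g, is_weak_deriv L a b e f g.

(* a representative of the weak derivative (0 if there is none) *)
Definition weak_deriv (R : realType) (L a b : R) (e : R * R)
    (f : R * R -> R) : R * R -> R :=
  xget (cst 0) [set g | is_weak_deriv L a b e f g].

Definition in_Lp (R : realType) (L a b p : R) (f : R * R -> R) : Prop :=
  f \_ (channel L a b) \in Lfun (leb2 R) p%:E.

Definition Lp_norm (R : realType) (L a b p : R) (f : R * R -> R) : \bar R :=
  Lnorm (leb2 R) p%:E (EFin \o f \_ (channel L a b)).

Definition in_W1p (R : realType) (L a b p : R) (f : R * R -> R) : Prop :=
  [/\ in_Lp L a b p f,
      weakly_derivable L a b ex f, weakly_derivable L a b ey f,
      in_Lp L a b p (weak_deriv L a b ex f) &
      in_Lp L a b p (weak_deriv L a b ey f)].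

Definition W1p_norm (R : realType) (L a b p : R) (f : R * R -> R) : \bar R :=
  (Lp_norm L a b p f + Lp_norm L a b p (weak_deriv L a b ex f)
   + Lp_norm L a b p (weak_deriv L a b ey f))%E.

Definition in_W1p_field (R : realType) (L a b p : R)
    (u : R * R -> R * R) : Prop :=
  in_W1p L a b p (fst \o u) /\ in_W1p L a b p (snd \o u).

Definition W1p_norm_field (R : realType) (L a b p : R)
    (u : R * R -> R * R) : \bar R :=
  (W1p_norm L a b p (fst \o u) + W1p_norm L a b p (snd \o u))%E.

(* f has a representative that is continuous on the closed channel, and that
   representative vanishes on the boundary y = a, y = b.  For p > 2 every
   W^{1,p} function on the channel has such a continuous representative. *)
Definition zero_trace (R : realType) (L a b : R) (f : R * R -> R) : Prop :=
  exists g : R * R -> R,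
    [/\ {within [set: R] `*` `[a, b], continuous g},
        xperiodic L g,
        {ae leb2 R, forall z, channel L a b z -> f z = g z} &
        forall x, g (x, a) = 0 /\ g (x, b) = 0].

(* u . grad f *)
Definition advect (R : realType) (L a b : R) (u : R * R -> R * R)
    (f : R * R -> R) : R * R -> R :=
  fun z => (u z).1 * weak_deriv L a b ex f z + (u z).2 * weak_deriv L a b ey f z.

(* The unit normal is (0, 1) or (0, -1) on the boundary, so u . n = 0 is the
   vanishing of the trace of the second component.  The pressure is an
   arbitrary L^1_loc function whose weak gradient is - u . grad u. *)
Definition stationary_euler (R : realType) (L a b : R)
    (u : R * R -> R * R) : Prop :=
  [/\ [/\ weakly_derivable L a b ex (fst \o u),
          weakly_derivable L a b ey (fst \o u),
          weakly_derivable L a b ex (snd \o u) &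
          weakly_derivable L a b ey (snd \o u)],
      exists q : R * R -> R,
        is_weak_deriv L a b ex q (fun z => - advect L a b u (fst \o u) z) /\
        is_weak_deriv L a b ey q (fun z => - advect L a b u (snd \o u) z),
      {ae leb2 R, forall z, channel L a b z ->
        weak_deriv L a b ex (fst \o u) z + weak_deriv L a b ey (snd \o u) z = 0} &
      zero_trace L a b (snd \o u)].

Definition shear (R : realType) (w : R -> R) : R * R -> R * R :=
  fun z => (w z.2, 0).

Definition is_shear_flow (R : realType) (L a b : R)
    (u : R * R -> R * R) : Prop :=
  exists w : R -> R,
    {ae leb2 R, forall z, channel L a b z -> u z = shear w z}.

(* v in C^1([a, b]): v' on ]a, b[ extends continuously to [a, b] *)
Definition C1_itv (R : realType) (a b : R) (v : R -> R) : Prop :=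
  [/\ {within `[a, b], continuous v},
      forall y, y \in `]a, b[ -> derivable v y 1 &
      exists2 dv : R -> R, {within `[a, b], continuous dv} &
        forall y, y \in `]a, b[ -> v^`()%classic y = dv y].

Definition C1_norm (R : realType) (a b : R) (v : R -> R) : R :=
  sup [set `|v y| | y in `[a, b]] + sup [set `|v^`()%classic y| | y in `]a, b[].

(* Main.v *)
(* Write u = (u1, u2) and F = u . grad u = - grad q. Since p > 2, Morrey's
   inequality makes u1 - v uniformly small, so that u1 stays away from 0, and
   phi = u2 / u1 is defined. Incompressibility gives
   F = u1^2 (- d_y phi, d_x phi). For a nondecreasing T vanishing near 0 the
   function T(phi) has compact support in the open channel, because u2 vanishes
   on the walls, and integrating the curl-free field F against the rotated
   gradient of T(phi) gives \int T'(phi) |F|^2 / u1^2 = 0. Hence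
   d_y T(phi) = 0, so T(phi) = 0; taking for T functions that vanish only on
   smaller and smaller intervals gives u2 = 0, and then d_x u1 = - d_y u2 = 0.

   Nothing is mollified. A weak derivative is only used through the identity
   f(z + h e) - f(z) = \int_0^h g(z + s e) ds for almost every z, and derivatives
   are replaced by difference quotients, for which the integration by parts above
   is an exact identity (discrete_jacobian); the limit h -> 0 is taken with
   Fatou's lemma, the squares of the averaged derivatives being the dominating
   sequence. Functions on the channel are extended periodically in x, and by 0
   outside the open channel (pext). *)
Require Import Defs.
From HB Require Import structures.
From mathcomp Require Import all_boot all_order all_algebra.
From mathcomp Require Import all_classical all_reals all_analysis.
From mathcomp Require Import measurable_realfun real_interval.
From mathcomp Require Import ring lra.

Set Implicit Arguments.
Unset Strict Implicit.
Unset Printing Implicit Defensive.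

Import Order.TTheory GRing.Theory Num.Theory.
Import numFieldNormedType.Exports.

Local Open Scope classical_set_scope.
Local Open Scope ring_scope.

(** * Translations and functions periodic in x *)

(** The pressure is only locally integrable, with no control at the walls, so it can only be paired
    with a function vanishing near them: hence T must be flat near 0. The pairing yields a square
    because F is U1^2 times the rotated gradient of phi; afterwards only one of its components is
    exploited, namely T'(phi) d_y phi = 0. To go from this to T(phi) = 0 without mollifying, the
    integral of |T(phi)| is bounded by a multiple, independent of the step, of the integral of the
    modulus of its vertical difference quotient (walk down the column until T(phi) vanishes). The
    quotients tend to 0 almost everywhere, and a second use of Fatou's lemma transfers this to the
    integral.

    The condition p > 2 makes the dyadic errors in Morrey's estimate summable; the energy argument
    itself runs on bounded velocities and square-integrable derivatives. The number eps is chosen so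
    that Morrey's bound on u1 - v is at most half of the infimum of |v|. *)

Section translation.
Context {R : realType}.
Notation lam := (@lebesgue_measure R).
Notation mu := (leb2 R).

Lemma measurable_addr (s : R) : measurable_fun setT (fun x : R => x + s).
Proof. by apply: measurable_funD => //; exact: measurable_cst. Qed.

(** Lebesgue measure is determined by its values on half-open intervals, and translation preserves
    their lengths. *)
Lemma lebesgue_measure_shift (s : R) (A : set (measurableTypeR R)) : measurable A ->
  pushforward lam (fun x : measurableTypeR R => (x + s : measurableTypeR R)) A = lam A.
Proof.
pose f : {mfun measurableTypeR R >-> measurableTypeR R} := @mfun_Sub _ _ (measurableTypeR R) (measurableTypeR R) _ (mem_set (measurable_addr s)).
move=> mA; apply/esym.
apply: (@lebesgue_measure_unique R (pushforward lam f)) => // X [[x y] _ <-] /=.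
rewrite /pushforward (_ : _ @^-1` _ = `]x - s, y - s]%classic); last first.
  by apply/seteqP; split => z /=; rewrite !in_itv/= ltrBlDr lerBrDr.
rewrite !lebesgue_measure_itv/= !lte_fin ltrD2r.
by case: ifP => // _; rewrite -!EFinD; congr EFin; ring.
Qed.

Lemma ge0_integral_lebesgue_shift (s : R) (D : set R) (f : R -> \bar R) : measurable D ->
  measurable_fun setT f -> (forall x, 0 <= f x)%E ->
  (\int[lam]_(x in (fun x : R => (x + s)%R) @^-1` D) f (x + s)%R = \int[lam]_(x in D) f x)%E.
Proof.
move=> mD mf f0.
have := @ge0_integral_pushforward _ _ (measurableTypeR R) (measurableTypeR R) R
  _ (measurable_addr s) lam D f mD (measurable_funTS mf) (fun y _ => f0 y).
move=> /= <-.
by apply: eq_measure_integral => [|? A mA _]; [exact: measurable_addr|exact: lebesgue_measure_shift].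
Qed.

Lemma measurable_shift2 (w : R * R) : measurable_fun setT (fun z : R * R => z + w).
Proof.
by apply/measurable_fun_pairP; split; apply: measurable_funD.
Qed.

Lemma leb2_shift (w : R * R) (A : set (measurableTypeR R * measurableTypeR R)) : measurable A ->
  pushforward mu (fun z : measurableTypeR R * measurableTypeR R =>
    ((z : R * R) + w : measurableTypeR R * measurableTypeR R)) A = mu A.
Proof.
pose f : {mfun (measurableTypeR R * measurableTypeR R)%type >-> (measurableTypeR R * measurableTypeR R)%type} :=
  @mfun_Sub _ _ (measurableTypeR R * measurableTypeR R)%type (measurableTypeR R * measurableTypeR R)%type _ (mem_set (measurable_shift2 w)).
move=> mA; apply/esym.
apply: (@product_measure_unique _ _ _ _ _ lam lam (pushforward mu f)) => // B C mB mC.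
transitivity (mu (
  ((fun x : measurableTypeR R => (x + w.1 : measurableTypeR R)) @^-1` B) `*`
  ((fun x : measurableTypeR R => (x + w.2 : measurableTypeR R)) @^-1` C))).
  by congr (mu _); apply/seteqP; split => z.
rewrite [LHS]product_measure1E.
- by congr (_ * _)%E; exact: lebesgue_measure_shift.
- by rewrite -[_ @^-1` _]setTI; exact: measurable_addr.
- by rewrite -[_ @^-1` _]setTI; exact: measurable_addr.
Qed.

Lemma ge0_integral_leb2_shift (w : R * R) (D : set (R * R)) (f : R * R -> \bar R) : measurable D ->
  measurable_fun setT f -> (forall x, 0 <= f x)%E ->
  (\int[mu]_(z in (fun z : R * R => (z + w)%R) @^-1` D) f (z + w)%R = \int[mu]_(z in D) f z)%E.
Proof.
move=> mD mf f0.
have := @ge0_integral_pushforward _ _ (measurableTypeR R * measurableTypeR R)%type (measurableTypeR R * measurableTypeR R)%type R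
  _ (measurable_shift2 w) mu D f mD (measurable_funTS mf) (fun y _ => f0 y).
move=> /= <-.
by apply: eq_measure_integral => [|? A mA _]; [exact: measurable_shift2|exact: leb2_shift].
Qed.

Lemma ae_leb2_shift (w : R * R) (P : R * R -> Prop) :
  {ae mu, forall z, P z} -> {ae mu, forall z : R * R, P (z + w)}.
Proof.
move=> [N [mN N0 PN]]; exists ((fun z => z + w) @^-1` N); split.
- by rewrite -[_ @^-1` _]setTI; exact: measurable_shift2.
- by rewrite -[RHS]N0 -[RHS](leb2_shift w mN).
- by move=> z /= nP; apply: PN.
Qed.

#[global] Instance leb2_ae_filter : Filter (nbhs (almost_everywhere mu)).
Proof. exact: ae_filter_ringOfSetsType. Qed.

#[global] Instance lebesgue_ae_filter : Filter (nbhs (almost_everywhere lam)).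
Proof. exact: ae_filter_ringOfSetsType. Qed.

End translation.

Section cylinder.
Context {R : realType} (L : R).
Notation lam := (@lebesgue_measure R).
Notation mu := (leb2 R).
Hypothesis L_gt0 : 0 < L.

(** The codomain is arbitrary so that the notion also covers extended-real functions and predicates,
    as [ae_xper] requires. *)
Definition xper {T} (f : R * R -> T) := forall z : R * R, f (z + (L, 0)) = f z.

Lemma xperN T (f : R * R -> T) n : xper f -> forall z : R * R, f (z - (n%:R * L, 0)) = f z.
Proof.
move=> pf; elim: n => [|n IH] z.
  by rewrite mul0r; congr f; case: z => x y; congr pair => /=; rewrite subr0.
rewrite -[in RHS](IH z) -[LHS]pf; congr f.
by case: z => x y; congr pair => /=; ring.
Qed.

Lemma xperZ T (f : R * R -> T) (n : int) : xper f ->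
  forall z : R * R, f (z + (n%:~R * L, 0)) = f z.
Proof.
move=> pf z; case: n => n.
  rewrite -[LHS](xperN n pf); congr f.
  by case: z => x y; congr pair => /=; rewrite ?pmulrn; ring.
rewrite -[RHS](xperN n.+1 pf) NegzE; congr f.
by case: z => x y; congr pair => /=; rewrite ?pmulrn ?mulrNz; ring.
Qed.

Definition cyl : set (R * R) := `[0, L[ `*` [set: R].

Lemma measurable_cyl : measurable cyl.
Proof. by apply: measurableX => //; exact: measurable_itv. Qed.

Let slab a b : set (R * R) := `[a, b[ `*` [set: R].
Let mslab a b : measurable (slab a b).
Proof. by apply: measurableX => //; exact: measurable_itv. Qed.

(** Write s = r + n L with 0 <= r < L. Periodicity removes n L; the slab over [r, r + L[ is then cut
    at L, and its second piece is moved back by one period to [0, r[. *)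
Lemma integral_cyl_slab (f : R * R -> \bar R) s : measurable_fun setT f ->
  (forall x, 0 <= f x)%E -> xper f ->
  (\int[mu]_(z in slab s (s + L)%R) f z = \int[mu]_(z in cyl) f z)%E.
Proof.
move=> mf f0 pf.
have slabD a b c : a <= b -> b <= c ->
    (\int[mu]_(z in slab a c) f z = \int[mu]_(z in slab a b) f z + \int[mu]_(z in slab b c) f z)%E.
  move=> ab bc; rewrite -ge0_integral_setU//; last 4 first.
  - exact: mslab.
  - exact: mslab.
  - exact: measurable_funTS.
  - apply/disj_setPS => -[x y]; rewrite /slab /= !in_itv/= => -[[/andP[_ xb] _] [/andP[+ _] _]].
    by rewrite leNgt xb.
  congr (integral _ _ _); apply/seteqP; split => -[x y]; rewrite /slab /= !in_itv/=.
    by move=> [/andP[ax xc] _]; case: (ltP x b) => xb; [left|right]; rewrite ?ax ?xc ?xb.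
  move=> [|] [/andP[h1 h2] _]; split => //; apply/andP; split => //.
    exact: lt_le_trans h2 bc.
  exact: le_trans ab h1.
have slabS a b (n : int) :
    (\int[mu]_(z in slab (a + n%:~R * L)%R (b + n%:~R * L)%R) f z = \int[mu]_(z in slab a b) f z)%E.
  rewrite -(ge0_integral_leb2_shift (n%:~R * L, 0) (mslab _ _) mf f0).
  under eq_integral do rewrite xperZ//.
  congr (integral _ _ _); apply/seteqP.
  by split => -[x y]; rewrite /slab /= !in_itv/= lerD2r ltrD2r.
pose n := Num.floor (s / L).
pose r := s - n%:~R * L.
have sE : s = r + n%:~R * L by rewrite /r subrK.
have r0 : 0 <= r.
  by rewrite subr_ge0 -ler_pdivlMr// floor_le_tmp.
have rL : r < L.
  have := @floorD1_gt _ (s / L).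
  by rewrite ltr_pdivrMr// -/n intrD mulrDl mul1r -ltrBlDl.
have -> : s + L = (r + L) + n%:~R * L by rewrite /r; ring.
rewrite {1}sE slabS (slabD r L (r + L)) ?lerDr ?(ltW rL)//.
have := slabS 0 r 1; rewrite mul1r add0r => ->.
by rewrite addeC -slabD// (ltW rL).
Qed.

Lemma ge0_integral_cyl_shift (f : R * R -> \bar R) w : measurable_fun setT f ->
  (forall x, 0 <= f x)%E -> xper f ->
  (\int[mu]_(z in cyl) f (z + w)%R = \int[mu]_(z in cyl) f z)%E.
Proof.
move=> mf f0 pf; rewrite -(integral_cyl_slab w.1 mf f0 pf).
rewrite -(ge0_integral_leb2_shift w (mslab _ _) mf f0).
congr (integral _ _ _); apply/seteqP.
by split => -[x y]; rewrite /slab /cyl /= !in_itv/= lerDr [in _ + L]addrC ltrD2r.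
Qed.

Lemma integral_cyl_shift (f : R * R -> \bar R) w : measurable_fun setT f -> xper f ->
  (\int[mu]_(z in cyl) f (z + w)%R = \int[mu]_(z in cyl) f z)%E.
Proof.
move=> mf pf; rewrite [LHS]integralE [RHS]integralE; congr (_ - _)%E.
- have mfp := measurable_funepos mf; rewrite -[RHS](ge0_integral_cyl_shift w mfp)//.
    by apply: eq_integral => z _; rewrite !funeposE.
  by move=> z; rewrite !funeposE pf.
- have mfn := measurable_funeneg mf; rewrite -[RHS](ge0_integral_cyl_shift w mfn)//.
    by apply: eq_integral => z _; rewrite !funenegE.
  by move=> z; rewrite !funenegE pf.
Qed.

(** Every point is carried into the fundamental domain by an integer multiple of the period, so
    countably many translates of one null set contain all exceptions. *)
Lemma ae_xper (P : R * R -> Prop) : xper P ->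
  {ae mu, forall z, cyl z -> P z} -> {ae mu, forall z, P z}.
Proof.
move=> pP aP.
have {}aP (n : int) : {ae mu, forall z, cyl (z + (n%:~R * L, 0)) -> P z}.
  have := ae_leb2_shift (n%:~R * L, 0) aP.
  by apply: filterS => z /=; rewrite (xperZ n pP).
(* [ae_foralln] ranges over natural numbers, so an integer is coded by a natural number and a
   sign. *)
have {aP} : {ae mu, forall z, forall n : nat, forall b : bool,
    cyl (z + ((if b then n%:Z else - n%:Z)%:~R * L, 0)) -> P z}.
  by apply/ae_foralln => n; have := aP n; have := aP (- n%:Z); apply: filterS2 => z h1 h2 [].
apply: filterS => -[x y] /= h.
have [n [b nb]] : exists n : nat, exists b : bool, - Num.floor (x / L) = if b then n%:Z else - n%:Z.
  by case: (- _) => n; [exists n; exists true|exists n.+1; exists false].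
apply: (h n b); rewrite -nb; split => //=; rewrite in_itv/= rmorphN/= mulNr.
rewrite subr_ge0 ltrBlDr -ler_pdivlMr// floor_le_tmp/=.
by rewrite -[X in X + _]mul1r -mulrDl -ltr_pdivrMr// addrC -intrD1 floorD1_gt.
Qed.

Definition wrap x := x - (Num.floor (x / L))%:~R * L.

Lemma wrap_in x : wrap x \in `[0, L[.
Proof.
rewrite in_itv/= subr_ge0 ltrBlDr -ler_pdivlMr// floor_le_tmp/=.
by rewrite -[X in X + _]mul1r -mulrDl -ltr_pdivrMr// addrC -intrD1 floorD1_gt.
Qed.

Lemma wrap_id x : x \in `[0, L[ -> wrap x = x.
Proof.
rewrite in_itv/= => /andP[x0 xL]; rewrite /wrap (_ : Num.floor _ = 0) ?mul0r ?subr0//.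
apply/floor_def/andP; split; first by rewrite divr_ge0// ltW.
by rewrite add0r ltr_pdivrMr// mul1r.
Qed.

Lemma wrapD x : wrap (x + L) = wrap x.
Proof.
rewrite /wrap mulrDl divff ?gt_eqF// floorDrz ?rpred1//=.
by rewrite Num.Theory.floor1 intrD; ring.
Qed.

Lemma measurable_wrap : measurable_fun setT wrap.
Proof.
apply: measurable_funB => //; apply: measurable_funM => //.
apply: nondecreasing_measurable => // x y xy.
by rewrite ler_int le_floor// ler_pM2r// invr_gt0.
Qed.

(** The strip ]c, d[ is a parameter because an L^1_loc function is integrable only on strips
    strictly inside the channel. *)
Definition pext c d (f : R * R -> R) (z : R * R) :=
  (f \_ (channel L c d)) (wrap z.1, z.2).

Lemma measurable_channel c d : measurable (channel L c d).
Proof. by apply: measurableX => //; exact: measurable_itv. Qed.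

Lemma pextE c d f z : pext c d f z = if c < z.2 < d then f (wrap z.1, z.2) else 0.
Proof.
rewrite /pext /patch; case: ifPn; rewrite (inE, notin_setE) /channel /=.
  by move=> [_]; rewrite in_itv/= => ->.
by case: ifP => // h []; split; [exact: wrap_in|rewrite /= in_itv].
Qed.

Lemma xper_pext c d f : xper (pext c d f).
Proof. by move=> z; rewrite /pext /= wrapD addr0. Qed.

Lemma measurable_pext c d f : measurable_fun (channel L c d) f ->
  measurable_fun setT (pext c d f).
Proof.
move=> mf.
have mg : measurable_fun setT (f \_ (channel L c d)).
  by apply/(measurable_restrictT _ _).1 => //; exact: measurable_channel.
apply: (measurableT_comp mg) => /=.
apply/measurable_fun_pairP; split; last exact: measurable_snd.
exact: (measurableT_comp measurable_wrap measurable_fst).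
Qed.

Lemma pext_channel c d f z : channel L c d z -> pext c d f z = f z.
Proof.
case: z => x y [/= hx hy]; rewrite pextE/= wrap_id//.
by move: hy; rewrite in_itv/= => ->.
Qed.

End cylinder.

(** * Integrals along lines *)

Lemma ge0_fubini_in d1 d2 (T1 : measurableType d1) (T2 : measurableType d2) (R : realType)
    (m1 : {sigma_finite_measure set T1 -> \bar R}) (m2 : {sigma_finite_measure set T2 -> \bar R})
    (D1 : set T1) (D2 : set T2) (f : T1 * T2 -> \bar R) :
  measurable D1 -> measurable D2 -> measurable_fun setT f -> (forall z, 0 <= f z)%E ->
  (\int[m1]_(x in D1) \int[m2]_(y in D2) f (x, y) =
   \int[m2]_(y in D2) \int[m1]_(x in D1) f (x, y))%E.
Proof.
move=> mD1 mD2 mf f0.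
have mg : measurable_fun setT (f \_ (D1 `*` D2)).
  by apply/(measurable_restrictT _ _).1; [exact: measurableX|exact: measurable_funTS].
have g0 z : (0 <= (f \_ (D1 `*` D2)) z)%E by rewrite patchE; case: ifP.
have := fubini_tonelli (m1 := m1) (m2 := m2) _ mg g0.
rewrite /fubini_F /fubini_G => h; rewrite [LHS]integral_mkcond [in RHS]integral_mkcond.
transitivity (\int[m1]_x \int[m2]_y (f \_ (D1 `*` D2)) (x, y))%E.
  apply: eq_integral => x _; rewrite patchE; case: ifPn => xD1.
    rewrite integral_mkcond; apply: eq_integral => y _; rewrite !patchE.
    by rewrite in_setX xD1.
  rewrite integral0_eq// => y _; rewrite patchE in_setX (negbTE xD1)//.
rewrite h; apply: eq_integral => y _; rewrite patchE; case: ifPn => yD2.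
  rewrite [RHS]integral_mkcond; apply: eq_integral => x _; rewrite !patchE.
  by rewrite in_setX yD2 andbT.
by rewrite integral0_eq// => x _; rewrite patchE in_setX (negbTE yD2) andbF.
Qed.

Lemma leb2_sigma_finite_setT (R : realType) : sigma_finite setT (leb2 R).
Proof.
have /sigma_finiteP[F [TF ndF Foo]] := sigma_finiteT (@lebesgue_measure R).
exists (fun n => F n `*` F n).
  rewrite -setXTT TF predeqE => -[x y]; split.
    move=> [/= [n _ Fnx] [k _ Gky]]; exists (maxn n k) => //; split.
    - by move: x Fnx; exact/subsetPset/ndF/leq_maxl.
    - by move: y Gky; exact/subsetPset/ndF/leq_maxr.
  by move=> [n _ []/= ? ?]; split; exists n.
move=> k; have [? ?] := Foo k; split; first exact: measurableX.
by rewrite [X in (X < _)%E]product_measure1E// lte_mul_pinfty// ge0_fin_numE.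
Qed.

(* [leb2] only carries a measure structure, while Fubini needs a sigma-finite one. *)
Definition leb2_fun (R : realType) (A : set (measurableTypeR R * measurableTypeR R)) : \bar R := leb2 R A.
HB.instance Definition _ (R : realType) := Measure.copy (@leb2_fun R) (@lebesgue_measure R \x @lebesgue_measure R)%E.
HB.instance Definition _ (R : realType) := Measure_isSigmaFinite.Build _ _ _ (@leb2_fun R) (@leb2_sigma_finite_setT R).
Definition leb2_sigma_finite (R : realType) : {sigma_finite_measure set (measurableTypeR R * measurableTypeR R)%type -> \bar R} := @leb2_fun R.

Section lines.
Context {R : realType}.
Notation lam := (@lebesgue_measure R).
Notation mu := (leb2 R).

Lemma measurable_shift_line (e : R * R) :
  measurable_fun setT (fun zs : (R * R) * R => zs.1 + zs.2 *: e).
Proof.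
apply/measurable_fun_pairP; split => /=.
  apply: measurable_funD => //=; first exact: (measurableT_comp measurable_fst measurable_fst).
  exact: measurable_funM.
apply: measurable_funD => //=; first exact: (measurableT_comp measurable_snd measurable_fst).
exact: measurable_funM.
Qed.

Lemma measurable_line (e z : R * R) : measurable_fun setT (fun s : R => z + s *: e).
Proof.
apply/measurable_fun_pairP; split => /=.
  by apply: measurable_funD => //=; exact: measurable_funM.
by apply: measurable_funD => //=; exact: measurable_funM.
Qed.

(** The direction is arbitrary so that [lint (- e)] is the integral over the backward segment. Being
    a real integral, it takes a default value when the integral is not finite, so integrability is
    tracked separately. *)
Definition lint (e : R * R) h (f : R * R -> R) (z : R * R) : R :=
  \int[lam]_(s in `[0, h]) f (z + s *: e).

Lemma measurable_ge0_lint (e : R * R) h (f : R * R -> \bar R) :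
  measurable_fun setT f -> (forall z, 0 <= f z)%E ->
  measurable_fun setT (fun z : R * R => \int[lam]_(s in `[0%R, h]) f (z + s *: e)%R)%E.
Proof.
move=> mf f0.
have mg : measurable_fun setT ((fun zs : (R * R) * R => f (zs.1 + zs.2 *: e)) \_ (setT `*` `[0, h])).
  apply/(measurable_restrictT _ _).1; first exact: measurableX.
  by apply: measurable_funTS; apply: (measurableT_comp mf); exact: measurable_shift_line.
have := @measurable_fun_fubini_tonelli_F _ _ (measurableTypeR R * measurableTypeR R)%type (measurableTypeR R) R lam _ mg.
have g0 z : (0 <= ((fun zs : (R * R) * R => f (zs.1 + zs.2 *: e)%R) \_ (setT `*` `[0%R, h])) z)%E.
  by rewrite patchE; case: ifP.
move=> /(_ g0).
apply: eq_measurable_fun => z _; rewrite /fubini_F [RHS]integral_mkcond.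
by apply: eq_integral => s _; rewrite !patchE in_setX in_setT.
Qed.

Lemma measurable_lint (e : R * R) h (f : R * R -> R) :
  measurable_fun setT f -> measurable_fun setT (lint e h f).
Proof.
move=> mf.
rewrite /lint /Rintegral; apply: measurableT_comp; first exact: fine_measurable.
under eq_fun do rewrite integralE.
apply: emeasurable_funB.
  have mF : measurable_fun setT ((EFin \o f)^\+)%E.
    by apply: measurable_funepos; exact/measurable_EFinP.
  have := measurable_ge0_lint e h mF (fun=> funepos_ge0 _ _).
  by apply: eq_measurable_fun => z _; apply: eq_integral => s _; rewrite !funeposE.
have mF : measurable_fun setT ((EFin \o f)^\-)%E.
  by apply: measurable_funeneg; exact/measurable_EFinP.
have := measurable_ge0_lint e h mF (fun=> funeneg_ge0 _ _).
by apply: eq_measurable_fun => z _; apply: eq_integral => s _; rewrite !funenegE.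
Qed.

(** Cauchy-Schwarz against the constant 1, obtained by expanding the nonnegative integral of (f -
    c)^2 where c is the mean of f. *)
Lemma sqr_Rintegral_le (h : R) (f : R -> R) : 0 < h -> measurable_fun setT f ->
  (((\int[lam]_(s in `[0, h]) f s) ^+ 2)%:E <= h%:E * \int[lam]_(s in `[0%R, h]) ((f s) ^+ 2)%:E)%E.
Proof.
move=> h0 mf.
have mf2 : measurable_fun setT (fun s => (f s) ^+ 2) by exact: measurable_funX.
(* An infinite right-hand side is trivial; otherwise f is integrable because |f| <= 1 + f^2. *)
have [oo|/negP foo] := boolP (\int[lam]_(s in `[0%R, h]) ((f s) ^+ 2)%:E == +oo)%E.
  by rewrite (eqP oo) gt0_muley ?lte_fin// leey.
have lh : (lam `[0%R, h] = h%:E)%E by rewrite lebesgue_measure_itv/= lte_fin h0 sube0.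
have i2 : lam.-integrable `[0, h] (EFin \o (fun s => f s ^+ 2)).
  apply/integrableP; split; first exact/measurable_EFinP/measurable_funTS.
  under eq_integral do rewrite /= ger0_norm ?sqr_ge0//.
  by rewrite ltey; exact/negP.
have ic c : lam.-integrable `[0, h] (EFin \o (cst c : R -> R)).
  by apply: continuous_compact_integrable; [exact: segment_compact|move=> x; exact: cvg_cst].
have i1 : lam.-integrable `[0, h] (EFin \o f).
  apply: (@le_integrable _ _ _ lam `[0, h]%classic _ _ (EFin \o (fun s => 1 + f s ^+ 2))) => //.
  - exact/measurable_EFinP/measurable_funTS.
  - move=> s _ /=; rewrite lee_fin ler_normr; apply/orP; left.
    by rewrite ler_norml; apply/andP; split; nra.
  - have : lam.-integrable `[0, h] ((EFin \o cst 1%R) \+ (EFin \o (fun s => (f s ^+ 2)%R)))%E.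
      exact: integrableD.
    by apply: eq_integrable.
set I := \int[lam]_(s in _) f s.
pose c := h^-1 * I.
have Ih : I = h * c by rewrite /c mulrA divff ?mul1r// gt_eqF.
have : 0 <= \int[lam]_(s in `[0, h]) ((f s ^+ 2 - (2 * c) * f s) + c ^+ 2).
  apply: Rintegral_ge0 => s _.
  by rewrite (_ : _ + _ = (f s - c) ^+ 2) ?sqr_ge0//; ring.
have i3 : lam.-integrable `[0, h] (EFin \o (fun s => (2 * c) * f s)).
  have : lam.-integrable `[0, h] (fun s => (2 * c)%:E * (EFin \o f) s)%E by exact: integrableZl.
  by apply: eq_integrable.
have i4 : lam.-integrable `[0, h] (EFin \o (fun s => f s ^+ 2 - 2 * c * f s)).
  have : lam.-integrable `[0, h] ((EFin \o (fun s => (f s ^+ 2)%R)) \- (EFin \o (fun s => (2 * c * f s)%R)))%E.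
    exact: integrableB.
  by apply: eq_integrable.
rewrite RintegralD//; last exact: (ic (c ^+ 2)).
rewrite RintegralB// RintegralZl// Rintegral_cst// -/I.
rewrite [fine _](_ : _ = h); last by rewrite [X in fine X]lh.
move=> H.
have -> : (\int[lam]_(s in `[0%R, h]) (f s ^+ 2)%:E = (\int[lam]_(s in `[0, h]) (f s ^+ 2))%:E)%E.
  by rewrite fineK// integrable_fin_num.
by rewrite -EFinM lee_fin; rewrite Ih in H *; nra.
Qed.

End lines.

Section cyl_lines.
Context {R : realType} (L : R).
Notation lam := (@lebesgue_measure R).
Notation mu := (leb2 R).
Hypothesis L_gt0 : 0 < L.

(** Tonelli exchanges the integrals, and by translation invariance the inner one no longer depends
    on s. *)
Lemma integral_cyl_lint (e : R * R) h (k : R * R -> \bar R) : 0 <= h ->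
  measurable_fun setT k -> (forall z, 0 <= k z)%E -> xper L k ->
  (\int[mu]_(z in cyl L) \int[lam]_(s in `[0%R, h]) k (z + s *: e)%R =
   h%:E * \int[mu]_(z in cyl L) k z)%E.
Proof.
move=> h0 mk k0 pk.
have mg : measurable_fun setT (fun zs : (R * R) * R => k (zs.1 + zs.2 *: e)).
  by apply: (measurableT_comp mk); exact: measurable_shift_line.
rewrite (@ge0_fubini_in _ _ (measurableTypeR R * measurableTypeR R)%type (measurableTypeR R) R (leb2_sigma_finite R) lam (cyl L) `[0%R, h]%classic _ (measurable_cyl L) _ mg)//.
under eq_integral do rewrite /= ge0_integral_cyl_shift//.
set C := (\int[mu]_(z in cyl L) k z)%E.
rewrite (_ : (\int[lam]_(_ in _) C = C * lam `[0%R, h])%E); last exact: integral_cst.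
rewrite lebesgue_measure_itv/= lte_fin muleC; case: ltP => h0'.
  by rewrite sube0.
by rewrite (_ : h = 0) ?mul0e//; apply/eqP; rewrite eq_le h0 h0'.
Qed.

(** Averaging over segments contracts the L^2 norm. This is why squares of averages can serve as a
    dominating sequence in [fatou_energy]. *)
Lemma integral_sqr_lint_le (e : R * R) h (f : R * R -> R) : 0 < h ->
  measurable_fun setT f -> xper L f ->
  (\int[mu]_(z in cyl L) ((h^-1 * lint e h f z) ^+ 2)%:E <= \int[mu]_(z in cyl L) (f z ^+ 2)%:E)%E.
Proof.
move=> h0 mf pf.
have mf2 : measurable_fun setT (fun z => (f z ^+ 2)%:E).
  by apply/measurable_EFinP; exact: measurable_funX.
have -> : (\int[mu]_(z in cyl L) (f z ^+ 2)%:E = h^-1%:E * (h%:E * \int[mu]_(z in cyl L) (f z ^+ 2)%:E))%E.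
  by rewrite muleA -EFinM mulVf ?gt_eqF// mul1e.
rewrite -(@integral_cyl_lint e h)//; last 3 first.
- exact: ltW.
- by move=> z; rewrite lee_fin sqr_ge0.
- by move=> z; rewrite pf.
rewrite -ge0_integralZl//; last 4 first.
- exact: measurable_cyl.
- apply: measurable_funTS; apply: (@measurable_ge0_lint _ _ _ (fun z => (f z ^+ 2)%:E)) => // z.
  by rewrite lee_fin sqr_ge0.
- by move=> z _; apply: integral_ge0 => s _; rewrite lee_fin sqr_ge0.
- by rewrite lee_fin invr_ge0 ltW.
apply: ge0_le_integral => //.
- exact: measurable_cyl.
- by move=> z _; rewrite lee_fin sqr_ge0.
- apply: measurable_funTS; apply/measurable_EFinP; apply: measurable_funX.
  by apply: measurable_funM => //; exact: measurable_lint.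
- apply: measurable_funTS; apply: emeasurable_funM => //.
  apply: (@measurable_ge0_lint _ _ _ (fun z => (f z ^+ 2)%:E)) => // z.
  by rewrite lee_fin sqr_ge0.
- move=> z _.
  have mfz : measurable_fun setT (fun s : R => f (z + s *: e)).
    apply: (measurableT_comp mf).
    exact: measurable_line.
  have := sqr_Rintegral_le h0 mfz.
  rewrite exprMn EFinM => H.
  have : ((h^-1 ^+ 2)%:E * (lint e h f z ^+ 2)%:E <= (h^-1 ^+ 2)%:E * (h%:E * \int[lam]_(s in `[0%R, h]) (f (z + s *: e) ^+ 2)%:E))%E.
    by rewrite lee_pmul2l// lte_fin exprn_gt0// invr_gt0.
  move/le_trans; apply; rewrite muleA -EFinM.
  by rewrite expr2 -mulrA mulVf ?gt_eqF// mulr1.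
Qed.

End cyl_lines.

Lemma near_harmonic_lt (R : realType) (e : R) : 0 < e -> \forall n \near \oo, n.+1%:R^-1 < e.
Proof. by move=> e0; apply: (cvgr_lt (0 : R)) => //; exact: cvg_harmonic. Qed.

(** * Lebesgue differentiation along coordinate lines *)

Section differentiation.
Context {R : realType}.
Notation lam := (@lebesgue_measure R).
Notation mu := (leb2 R).

Lemma measurable_refl (x : R) : measurable_fun setT (fun s : R => x - s).
Proof. by apply: measurable_funB => //; exact: measurable_cst. Qed.

Lemma lebesgue_measure_refl (x : R) (A : set (measurableTypeR R)) : measurable A ->
  pushforward lam (fun s : measurableTypeR R => (x - s : measurableTypeR R)) A = lam A.
Proof.
move=> mA; rewrite -[RHS](lebesgue_measure_shift x mA).
rewrite -[RHS]lebesgue_measureN; last first.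
  by rewrite -[_ @^-1` _]setTI; exact: measurable_addr.
by congr (lam _); apply/seteqP; split => s /=; rewrite addrC.
Qed.

Lemma ge0_integral_lebesgue_refl (x : R) (D : set R) (f : R -> \bar R) : measurable D ->
  measurable_fun setT f -> (forall x, 0 <= f x)%E ->
  (\int[lam]_(s in (fun s : R => (x - s)%R) @^-1` D) f (x - s)%R = \int[lam]_(s in D) f s)%E.
Proof.
move=> mD mf f0.
have := @ge0_integral_pushforward _ _ (measurableTypeR R) (measurableTypeR R) R
  _ (measurable_refl x) lam D f mD (measurable_funTS mf) (fun y _ => f0 y).
move=> /= <-.
by apply: eq_measure_integral => [|? A mA _]; [exact: measurable_refl|exact: lebesgue_measure_refl].
Qed.

Lemma Rintegral_shift (x h : R) (k : R -> R) : measurable_fun setT k ->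
  \int[lam]_(s in `[0, h]) k (x + s) = \int[lam]_(t in `[x, x + h]) k t.
Proof.
move=> mk; rewrite /Rintegral; congr fine.
have mE : measurable_fun setT (EFin \o k) by exact/measurable_EFinP.
have sE : (fun s : R => s + x) @^-1` `[x, x + h] = `[0, h]%classic.
  by apply/seteqP; split => s /=; rewrite !in_itv/= lerDr (addrC x h) lerD2r.
rewrite [LHS]integralE [RHS]integralE; congr (_ - _)%E.
- rewrite -(ge0_integral_lebesgue_shift x _ (measurable_funepos mE))// sE.
  by apply: eq_integral => s _; rewrite !funeposE /= addrC.
- rewrite -(ge0_integral_lebesgue_shift x _ (measurable_funeneg mE))// sE.
  by apply: eq_integral => s _; rewrite !funenegE /= addrC.
Qed.

Lemma Rintegral_refl (x h : R) (k : R -> R) : measurable_fun setT k ->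
  \int[lam]_(s in `[0, h]) k (x - s) = \int[lam]_(t in `[x - h, x]) k t.
Proof.
move=> mk; rewrite /Rintegral; congr fine.
have mE : measurable_fun setT (EFin \o k) by exact/measurable_EFinP.
have sE : (fun s : R => x - s) @^-1` `[x - h, x] = `[0, h]%classic.
  apply/seteqP; split => s /=; rewrite !in_itv/= lerD2l lerN2 gerBl => /andP[-> ->]//.
rewrite [LHS]integralE [RHS]integralE; congr (_ - _)%E.
- rewrite -(ge0_integral_lebesgue_refl x _ (measurable_funepos mE))// sE.
  by apply: eq_integral => s _; rewrite !funeposE.
- rewrite -(ge0_integral_lebesgue_refl x _ (measurable_funeneg mE))// sE.
  by apply: eq_integral => s _; rewrite !funenegE.
Qed.

(** Both sequences are difference quotients, with steps 1/(n+1) and -1/(n+1), of the primitive of k,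
    which is differentiable with derivative k almost everywhere. *)
Lemma ae_cvg_average (k : R -> R) : lam.-integrable setT (EFin \o k) ->
  {ae lam, forall x : R,
    ((fun n => n.+1%:R * \int[lam]_(s in `[0, n.+1%:R^-1]) k (x + s)) @ \oo --> k x) /\
    ((fun n => n.+1%:R * \int[lam]_(s in `[0, n.+1%:R^-1]) k (x - s)) @ \oo --> k x)}.
Proof.
move=> ik.
have mk : measurable_fun setT k by apply/measurable_EFinP; exact: measurable_int ik.
have iS (D : set (measurableTypeR R)) : measurable D -> lam.-integrable D (EFin \o k).
  by move=> mD; apply: integrableS ik.
have := @FTC1Ny R k (fun y => iS _ (measurable_itv _)) (open_integrable_locally openT ik).
apply: filterS => x [dF F'x].
pose F y := \int[lam]_(t in `]-oo, y]) k t.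
have FB y z : y <= z -> \int[lam]_(t in `[y, z]) k t = F z - F y.
  move=> yz; rewrite /F Rintegral_itvB//; last exact: iS.
  by rewrite Rintegral_itv_obnd_cbnd//; exact: iS.
have cF : h^-1 *: (F (h *: (1 : R) + x) - F x) @[h --> (0 : R)^'] --> k x.
  by rewrite -F'x derive1E; exact: dF.
have inv0 : (fun n : nat => n.+1%:R^-1 : R) @ \oo --> (0 : R) by exact: cvg_harmonic.
have inv1 : (fun n : nat => n.+1%:R^-1 : R) @ \oo --> (0 : R)^'.
  move=> A /= A0.
  have H : \forall n \near \oo, (n.+1%:R^-1 : R) != 0 -> A n.+1%:R^-1 := inv0 _ A0.
  apply: filterS H => n; apply.
  by rewrite invr_eq0 pnatr_eq0.
split.
- have := cvg_comp _ _ inv1 cF; apply: cvg_trans; apply: near_eq_cvg; apply: nearW => n /=.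
  by rewrite invrK Rintegral_shift// FB ?lerDl ?invr_ge0// /GRing.scale/= mulr1 (addrC x).
have inv2 : (fun n : nat => - n.+1%:R^-1 : R) @ \oo --> (0 : R)^'.
  have inv0' : (fun n : nat => - n.+1%:R^-1 : R) @ \oo --> (0 : R) by rewrite -oppr0; exact: cvgN.
  move=> A /= A0.
  have H : \forall n \near \oo, (- n.+1%:R^-1 : R) != 0 -> A (- n.+1%:R^-1) := inv0' _ A0.
  apply: filterS H => n; apply.
  by rewrite oppr_eq0 invr_eq0 pnatr_eq0.
have := cvg_comp _ _ inv2 cF; apply: cvg_trans; apply: near_eq_cvg; apply: nearW => n /=.
rewrite invrN invrK Rintegral_refl// FB ?gerBl ?invr_ge0// /GRing.scale/= mulr1 (addrC _ x).
by rewrite mulNr -mulrN opprB.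
Qed.

(** Tonelli makes the integral of E zero. The exceptional set is presented through a measurable
    function because a set all of whose slices are null is known to be null only if it is
    measurable. *)
Lemma ae_fubini_x (E : R * R -> \bar R) : measurable_fun setT E -> (forall z, 0 <= E z)%E ->
  {ae lam, forall y, {ae lam, forall x, E (x, y) = 0%E}} -> {ae mu, forall z, E z = 0%E}.
Proof.
move=> mE E0 H.
have : (\int[mu]_z E z = 0)%E.
  have := @fubini_tonelli2 _ _ (measurableTypeR R) (measurableTypeR R) R lam lam E mE E0.
  move=> ->; rewrite -[RHS](@integral0 _ (measurableTypeR R) R lam setT).
  apply: ge0_ae_eq_integral => //.
  - exact: (@measurable_fun_fubini_tonelli_G _ _ (measurableTypeR R) (measurableTypeR R) R lam E mE E0).
  - by move=> y _; apply: integral_ge0.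
  - apply: filterS H => y Hy _; rewrite /fubini_G.
    rewrite -[RHS](@integral0 _ (measurableTypeR R) R lam setT).
    apply: ge0_ae_eq_integral => //.
    + by apply: (measurableT_comp mE); exact: pair2_measurable.
    + by apply: filterS Hy => x Hx _.
move=> h.
have : (\int[mu]_(z in setT) `|E z| = 0)%E.
  by rewrite -[RHS]h; apply: eq_integral => z _; rewrite gee0_abs.
move/(ae_eq_integral_abs mu measurableT mE); apply: filterS => z; exact.
Qed.

Lemma ae_fubini_y (E : R * R -> \bar R) : measurable_fun setT E -> (forall z, 0 <= E z)%E ->
  {ae lam, forall x, {ae lam, forall y, E (x, y) = 0%E}} -> {ae mu, forall z, E z = 0%E}.
Proof.
move=> mE E0 H.
have : (\int[mu]_z E z = 0)%E.
  have := @fubini_tonelli1 _ _ (measurableTypeR R) (measurableTypeR R) R lam lam E mE E0.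
  move=> ->; rewrite -[RHS](@integral0 _ (measurableTypeR R) R lam setT).
  apply: ge0_ae_eq_integral => //.
  - exact: (@measurable_fun_fubini_tonelli_F _ _ (measurableTypeR R) (measurableTypeR R) R lam E mE E0).
  - by move=> y _; apply: integral_ge0.
  - apply: filterS H => y Hy _; rewrite /fubini_F.
    rewrite -[RHS](@integral0 _ (measurableTypeR R) R lam setT).
    apply: ge0_ae_eq_integral => //.
    + by apply: (measurableT_comp mE); exact: pair1_measurable.
    + by apply: filterS Hy => x Hx _.
move=> h.
have : (\int[mu]_(z in setT) `|E z| = 0)%E.
  by rewrite -[RHS]h; apply: eq_integral => z _; rewrite gee0_abs.
move/(ae_eq_integral_abs mu measurableT mE); apply: filterS => z; exact.
Qed.

(** Convergence is recast as the vanishing of a limsup, which depends measurably on a parameter;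
    [ae_fubini_x] and [ae_fubini_y] can then be applied to a convergence statement. *)
Lemma cvg_esup_dist (u : nat -> R) (l : R) :
  u @ \oo --> l <-> limn_esup (fun n => `|u n - l|%:E) = 0%E.
Proof.
split=> [ul|h].
  have : (fun n => `|u n - l|%:E) @ \oo --> 0%E.
    have : (fun n => `|u n - l|) @ \oo --> `|l - l|.
      by apply: cvg_norm; apply: cvgB => //; exact: cvg_cst.
    by rewrite subrr normr0 => h; apply: cvg_EFin; [exact: nearW|exact: h].
  move=> c; rewrite is_cvg_limn_esupE; first exact/cvg_lim.
  by apply/cvg_ex; exists 0%E.
have : (fun n => `|u n - l|%:E) @ \oo --> 0%E.
  by apply: limn_esup_le_cvg => [|n]; [rewrite h|rewrite lee_fin].
move/fine_cvgP => [_ c].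
apply/cvgrPdist_le => e e0.
move/cvgrPdist_le : c => /(_ e e0); apply: filterS => n /=.
by rewrite sub0r normrN /= normr_id distrC.
Qed.

(** Almost every line parallel to e carries an integrable restriction of G, to which
    [ae_cvg_average] applies; the measurable defect E then lifts the conclusion from lines to the
    plane. *)
Lemma ae_cvg_lint_plane (e : R * R) (G : R * R -> R) : e = ex \/ e = ey ->
  mu.-integrable setT (EFin \o G) ->
  {ae mu, forall z : R * R,
    ((fun n => n.+1%:R * lint e n.+1%:R^-1 G z) @ \oo --> G z) /\
    ((fun n => n.+1%:R * lint (- e) n.+1%:R^-1 G z) @ \oo --> G z)}.
Proof.
move=> he iG.
have mG : measurable_fun setT G by apply/measurable_EFinP; exact: measurable_int iG.
pose E e' (z : R * R) := limn_esup (fun n => `|n.+1%:R * lint e' n.+1%:R^-1 G z - G z|%:E).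
have mE e' : measurable_fun setT (E e').
  apply: measurable_fun_limn_esup => n; apply/measurable_EFinP.
  apply: measurableT_comp => //; apply: measurable_funB => //.
  by apply: measurable_funM => //; exact: measurable_lint.
have E0 e' z : (0 <= E e' z)%E.
  rewrite /E limn_esup_lim; apply: lime_ge; first exact: is_cvg_esups.
  by apply: nearW => n; apply: (@le_trans _ _ (`|n.+1%:R * lint e' n.+1%:R^-1 G z - G z|%:E)%E);
    [rewrite lee_fin|apply: ereal_sup_ubound; exists n => //=].
suff H : {ae mu, forall z, E e z = 0%E /\ E (- e) z = 0%E}.
  by apply: filterS H => z [h1 h2]; split; [exact/cvg_esup_dist/h1|exact/cvg_esup_dist/h2].
pose EE z := (E e z + E (- e)%R z)%E.
suff H : {ae mu, forall z, EE z = 0%E}.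
  apply: filterS H => z /eqP; rewrite padde_eq0 ?E0//.
  by move=> /andP[/eqP -> /eqP ->].
have mEE : measurable_fun setT EE by apply: emeasurable_funD.
have EE0 z : (0 <= EE z)%E by apply: adde_ge0.
have lE e' z : lint e' = fun h f z => \int[lam]_(s in `[0, h]) f (z + s *: e') by [].
case: he => he; subst e.
- apply: ae_fubini_x => //.
  have := @ae_integrable2 _ _ (measurableTypeR R) (measurableTypeR R) R lam lam (EFin \o G) iG.
  apply: filterS => y iy.
  have := ae_cvg_average iy; apply: filterS => x [h1 h2].
  rewrite /EE /E; suff -> : limn_esup (fun n => `|n.+1%:R * lint ex n.+1%:R^-1 G (x, y) - G (x, y)|%:E) = 0%E.
    suff -> : limn_esup (fun n => `|n.+1%:R * lint (- ex) n.+1%:R^-1 G (x, y) - G (x, y)|%:E) = 0%E by rewrite adde0.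
    apply/cvg_esup_dist; apply: cvg_trans h2; apply: near_eq_cvg; apply: nearW => n /=.
    congr (_ * _); apply: eq_Rintegral => s _; congr G.
    by rewrite /ex; congr pair => /=; rewrite /GRing.scale/=; ring.
  apply/cvg_esup_dist; apply: cvg_trans h1; apply: near_eq_cvg; apply: nearW => n /=.
  congr (_ * _); apply: eq_Rintegral => s _; congr G.
  by rewrite /ex; congr pair => /=; rewrite /GRing.scale/=; ring.
- apply: ae_fubini_y => //.
  have := @ae_integrable1 _ _ (measurableTypeR R) (measurableTypeR R) R lam lam (EFin \o G) iG.
  apply: filterS => x ix.
  have := ae_cvg_average ix; apply: filterS => y [h1 h2].
  rewrite /EE /E; suff -> : limn_esup (fun n => `|n.+1%:R * lint ey n.+1%:R^-1 G (x, y) - G (x, y)|%:E) = 0%E.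
    suff -> : limn_esup (fun n => `|n.+1%:R * lint (- ey) n.+1%:R^-1 G (x, y) - G (x, y)|%:E) = 0%E by rewrite adde0.
    apply/cvg_esup_dist; apply: cvg_trans h2; apply: near_eq_cvg; apply: nearW => n /=.
    congr (_ * _); apply: eq_Rintegral => s _; congr G.
    by rewrite /ey; congr pair => /=; rewrite /GRing.scale/=; ring.
  apply/cvg_esup_dist; apply: cvg_trans h1; apply: near_eq_cvg; apply: nearW => n /=.
  congr (_ * _); apply: eq_Rintegral => s _; congr G.
  by rewrite /ey; congr pair => /=; rewrite /GRing.scale/=; ring.
Qed.

End differentiation.

Section differentiation_cyl.
Context {R : realType} (L : R).
Notation lam := (@lebesgue_measure R).
Notation mu := (leb2 R).
Hypothesis L_gt0 : 0 < L.

(** A periodic function is not integrable on the plane, so it is cut off to three consecutive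
    periods. Segments of length less than L starting in the middle period do not see the cut. *)
Lemma ae_cvg_lint (e : R * R) (g : R * R -> R) : e = ex \/ e = ey ->
  measurable_fun setT g -> xper L g -> (\int[mu]_(z in cyl L) `|g z|%:E < +oo)%E ->
  {ae mu, forall z : R * R,
    ((fun n => n.+1%:R * lint e n.+1%:R^-1 g z) @ \oo --> g z) /\
    ((fun n => n.+1%:R * lint (- e) n.+1%:R^-1 g z) @ \oo --> g z)}.
Proof.
move=> he mg pg ig.
apply: (ae_xper L_gt0).
  move=> z; apply/propeqP; rewrite pg.
  have lE e' n : lint e' n.+1%:R^-1 g (z + (L, 0)) = lint e' n.+1%:R^-1 g z.
    by apply: eq_Rintegral => s _; rewrite addrAC pg.
  by under eq_fun do rewrite lE; under [X in _ /\ X @ _ --> _]eq_fun do rewrite lE.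
pose D : set (R * R) := `[- L, 2 * L[ `*` [set: R].
have mD : measurable D by apply: measurableX => //; exact: measurable_itv.
pose G := g \_ D.
have mG : measurable_fun setT G.
  by apply/(measurable_restrictT _ _).1 => //; exact: measurable_funTS.
have iG : mu.-integrable setT (EFin \o G).
  apply/integrableP; split; first exact/measurable_EFinP.
  have mabs : measurable_fun setT (fun z => `|g z|%:E).
    by apply/measurable_EFinP; exact: measurableT_comp.
  have pabs : xper L (fun z => `|g z|%:E) by move=> z; rewrite pg.
  have mS a b : measurable (`[a, b[ `*` [set: R] : set (R * R)).
    by apply: measurableX => //; exact: measurable_itv.
  have -> : (\int[mu]_(z in setT) `|(EFin \o G) z| = \int[mu]_(z in D) `|g z|%:E)%E.
    rewrite [RHS]integral_mkcond; apply: eq_integral => z _.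
    by rewrite /= /G !patchE; case: ifP => //; rewrite normr0.
  have -> : D = (`[- L, 0[ `*` [set: R]) `|` ((`[0, L[ `*` [set: R]) `|` (`[L, 2 * L[ `*` [set: R])).
    apply/seteqP; split => -[x y]; rewrite /D /= !in_itv/=.
      move=> [/andP[h1 h2] _]; case: (ltP x 0) => h3; first by left; rewrite h1.
      by right; case: (ltP x L) => h4; [left|right]; rewrite ?h3 ?h4.
    by move=> [|[|]] [/andP[h1 h2] _]; split => //; apply/andP; split; lra.
  have pieces s : (\int[mu]_(z in (`[s, (s + L)%R[ `*` [set: R])) `|g z|%:E < +oo)%E.
    by rewrite (integral_cyl_slab L_gt0).
  rewrite ge0_integral_setU//; last 4 first.
  - exact: mS.
  - by apply: measurableU; exact: mS.
  - exact: measurable_funTS.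
  - apply/disj_setPS => -[x y] /= []; rewrite !in_itv/= => -[/andP[_ h1] _].
    by move=> [|] [/andP[h2 _] _];
      [move: (lt_le_trans h1 h2)|move: (lt_le_trans h1 (le_trans (ltW L_gt0) h2))]; rewrite ltxx.
  rewrite ge0_integral_setU//; last 4 first.
  - exact: mS.
  - exact: mS.
  - exact: measurable_funTS.
  - apply/disj_setPS => -[x y] /= []; rewrite !in_itv/= => -[/andP[_ h1] _].
    by move=> [/andP[h2 _] _]; move: (lt_le_trans h1 h2); rewrite ltxx.
  have := pieces (- L); have := pieces 0; have := pieces L.
  rewrite add0r addNr (_ : L + L = 2 * L); last by ring.
  by move=> h1 h2 h3; apply: lte_add_pinfty => //; exact: lte_add_pinfty.
have := ae_cvg_lint_plane he iG; apply: filterS => z [h1 h2] cz.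
have GE w : - L <= w.1 < 2 * L -> G w = g w.
  by move=> hw; rewrite /G patchE mem_set//= in_itv/=.
have z1 : 0 <= z.1 < L by case: z cz {h1 h2} => x y [] /=; rewrite in_itv.
have nL : \forall n \near \oo, n.+1%:R^-1 < L.
  exact: near_harmonic_lt.
have lE e' : e' = e \/ e' = - e ->
    \forall n \near \oo, n.+1%:R * lint e' n.+1%:R^-1 G z = n.+1%:R * lint e' n.+1%:R^-1 g z.
  move=> he'; apply: filterS nL => n nL; congr (_ * _); apply: eq_Rintegral => s.
  rewrite inE/= in_itv/= => /andP[s0 sn]; apply: GE => /=.
  have key (r : R) : 0 <= r -> r < L ->
      [/\ - L <= z.1 + r < 2 * L, - L <= z.1 - r < 2 * L & - L <= z.1 < 2 * L].
    by move/andP: z1 => [z10 z11] r0 rL; split; apply/andP; split; lra.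
  have [k1 k2 k3] := key _ s0 (le_lt_trans sn nL).
  case: he' => ->; case: he => -> /=;
    by rewrite /GRing.scale/= ?mulr1 ?mulrN1 ?oppr0 ?mulr0 ?addr0.
rewrite -(GE z); last by (move/andP: z1 => [z10 z11]; apply/andP; split; lra).
split.
- by apply: cvg_trans h1; apply: near_eq_cvg; apply: lE; left.
- by apply: cvg_trans h2; apply: near_eq_cvg; apply: lE; right.
Qed.

End differentiation_cyl.

(** * Test functions *)

Section smooth1.
Context {R : realType}.
Implicit Types f g : R -> R.

(** Class C^k with the derivatives given by witnesses rather than by the operator ['D_1]: closure
    under sums, products and composition is then an induction on k that exhibits the derivative. *)
Fixpoint D1 (k : nat) f : Prop :=
  if k is k'.+1 then exists2 g, (forall x : R, is_derive x (1 : R) f (g x)) & D1 k' g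
  else continuous f.

Definition smooth1 f := forall k, D1 k f.

Lemma D1_continuous k f : D1 k f -> continuous f.
Proof.
case: k => // k [g fg _] x; have := fg x => /@ex_derive /derivable1_diffP.
exact: differentiable_continuous.
Qed.

Lemma D1W k f : D1 k.+1 f -> D1 k f.
Proof.
elim: k f => [|k IH] f; first exact: (@D1_continuous 1).
by move=> [g fg Dg]; exists g => //; exact: IH.
Qed.

Lemma D1_ext k f g : f =1 g -> D1 k f -> D1 k g.
Proof. by move=> /funext ->. Qed.

Lemma D1_cst k (c : R) : D1 k (fun=> c).
Proof.
elim: k c => [|k IH] c; first by move=> x; exact: cvg_cst.
by exists (fun=> 0) => // x; exact: is_derive_cst.
Qed.

Lemma D1_id k : D1 k (fun x : R => x).
Proof.
case: k => [|k]; first by move=> x; exact: cvg_id.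
by exists (fun=> 1); [move=> x; exact: is_derive_id|exact: D1_cst].
Qed.

Lemma D1D k f g : D1 k f -> D1 k g -> D1 k (fun x => f x + g x).
Proof.
elim: k f g => [|k IH] f g; first by move=> cf cg x; apply: cvgD; [exact: cf|exact: cg].
move=> [f' ff' Df'] [g' gg' Dg']; exists (fun x => f' x + g' x); last exact: IH.
by move=> x; have := ff' x; have := gg' x => ? ?; exact: is_deriveD.
Qed.

Lemma D1M k f g : D1 k f -> D1 k g -> D1 k (fun x => f x * g x).
Proof.
elim: k f g => [|k IH] f g; first by move=> cf cg x; apply: cvgM; [exact: cf|exact: cg].
move=> Df Dg; have [Df0 Dg0] := (D1W Df, D1W Dg).
case: Df => f' ff' Df'; case: Dg => g' gg' Dg'.
exists (fun x => f x * g' x + g x * f' x); last by apply: D1D; exact: IH.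
by move=> x; have := ff' x; have := gg' x => ? ?; exact: is_deriveM.
Qed.

Lemma D1_comp k f g : D1 k f -> D1 k g -> D1 k (fun x => f (g x)).
Proof.
elim: k f g => [|k IH] f g; first by move=> cf cg x; apply: continuous_comp; [exact: cg|exact: cf].
move=> Df Dg; have [Df0 Dg0] := (D1W Df, D1W Dg).
case: Df => f' ff' Df'; case: Dg => g' gg' Dg'.
exists (fun x => f' (g x) * g' x); last by apply: D1M => //; exact: IH.
by move=> x; apply: (@is_derive1_comp _ f g).
Qed.

Lemma D1_sincos k : D1 k (@sin R) /\ D1 k (@cos R).
Proof.
elim: k => [|k [IHs IHc]]; first by split; [exact: continuous_sin|exact: continuous_cos].
split; first by exists cos => // x; exact: is_derive_sin.
exists (fun x => (-1) * sin x); last by apply: D1M => //; exact: D1_cst.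
by move=> x; rewrite mulN1r; exact: is_derive_cos.
Qed.

Lemma smooth1_derive f : smooth1 f ->
  (forall x : R, is_derive x (1 : R) f ('D_1 f x)) /\ smooth1 ('D_1 f).
Proof.
move=> sf; split.
  by have [g fg _] := sf 1%N => x; apply: DeriveDef => //; have := fg x => /@ex_derive.
move=> k; have [g fg Dg] := sf k.+1; apply: D1_ext Dg => x.
by have := fg x => H; rewrite derive_val.
Qed.

(** The functions x^(-k) exp(-1/x), extended by 0, span a space stable under differentiation
    ([is_derive_flatk]), so the smoothness of exp(-1/x) follows by one induction. *)
Definition flatk (k : nat) (x : R) : R := if 0 < x then x^-1 ^+ k * expR (- x^-1) else 0.

Lemma flatk_ge0 k x : 0 <= flatk k x.
Proof. by rewrite /flatk; case: ifP => // x0; rewrite mulr_ge0 ?expR_ge0// exprn_ge0// invr_ge0 ltW. Qed.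

(** With t = 1/x this is exp(t) >= t^(k+1) / (k+1)!, one term of the exponential series. *)
Lemma flatk_le k x : flatk k x <= (k.+1)`!%:R * `|x|.
Proof.
rewrite /flatk; case: ifP => x0; last by rewrite mulr_ge0.
rewrite (gtr0_norm x0) expRN -ler_pdivlMr ?invr_gt0 ?expR_gt0// invrK.
have t0 : 0 <= x^-1 by rewrite invr_ge0 ltW.
have H : x^-1 ^+ k.+1 / (k.+1)`!%:R <= expR x^-1.
  by apply: le_trans (expR_ge1Dxn k t0); rewrite lerDr.
have F0 : (0 : R) < (k.+1)`!%:R by rewrite ltr0n fact_gt0.
move: H; rewrite ler_pdivrMr// exprS => H.
rewrite -(ler_pM2l (x := x^-1)) ?invr_gt0//; apply: (le_trans H).
by rewrite le_eqVlt; apply/orP; left; apply/eqP; field; rewrite gt_eqF.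
Qed.

Lemma is_derive_flatk k (x : R) : is_derive x (1 : R) (flatk k) (- k%:R * flatk k.+1 x + flatk k.+2 x).
Proof.
have [x0|x0|->] := ltgtP x 0.
- rewrite /flatk !ltNge (ltW x0)/= mulr0 addr0.
  have H0 : is_derive x (1 : R) (fun _ : R => 0 : R) 0 by exact: is_derive_cst.
  apply: near_eq_is_derive H0.
  near=> y; rewrite ifF//; apply/negbTE; rewrite -leNgt ltW//; near: y.
  exact: lt_nbhsl.
- have x_neq0 : x != 0 by rewrite gt_eqF.
  have dV : is_derive x (1 : R) (fun y : R => y^-1) (- x ^- 2 *: 1).
    by apply: is_deriveV => //; exact: is_derive_id.
  have dX : is_derive x (1 : R) (fun y : R => y^-1 ^+ k) (k%:R * x^-1 ^+ k.-1 *: (- x ^- 2 *: 1)).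
    by have := @is_deriveX _ _ _ k _ _ _ dV; rewrite exprfctE.
  have dE : is_derive x (1 : R) (fun y : R => expR (- y^-1)) (expR (- x^-1) * (- (- x ^- 2 *: 1))).
    by apply: (@is_derive1_comp _ expR (fun y => - y^-1)); exact: is_deriveN.
  have dM : is_derive x (1 : R) (fun y => y^-1 ^+ k * expR (- y^-1))
      (- k%:R * flatk k.+1 x + flatk k.+2 x).
    apply: (is_derive_eq (is_deriveM dX dE)).
    rewrite /flatk x0 /GRing.scale/= -exprVn; move: x^-1 => t.
    case: k {dX} => [|k]; first by rewrite mulr0n; ring.
    by rewrite [k.+1.-1]/= !exprS; move: (k.+1%:R : R) (t ^+ k) => c d; ring.
  apply: near_eq_is_derive dM.
  near=> y; rewrite /flatk ifT//; near: y; exact: lt_nbhsr.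
- rewrite /flatk ltxx mulr0 addr0.
  have H : h^-1 *: (flatk k (h *: (1 : R) + 0) - flatk k 0) @[h --> (0 : R)^'] --> (0 : R).
    apply/cvgrPdist_le => e e0; near=> h.
    rewrite sub0r normrN /flatk ltxx subr0 addr0 /GRing.scale/= mulr1.
    case: ifP => h0; last by rewrite mulr0 normr0 ltW.
    (* For h > 0 the difference quotient at 0 equals [flatk k.+1 h], which is bounded by a constant
       times |h|. *)
    have := flatk_le k.+1 h; have := flatk_ge0 k.+1 h; rewrite /flatk h0 exprS -mulrA => g0 le.
    rewrite (ger0_norm g0); apply: (le_trans le).
    rewrite -ler_pdivlMl ?ltr0n ?fact_gt0//.
    near: h; apply: (@cvgr0_norm_le _ _ _ _ _ id) => //; first exact: cvg_within.
    by rewrite mulr_gt0// invr_gt0 ltr0n fact_gt0.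
  apply: DeriveDef; first by apply/cvg_ex; exists 0.
  exact/cvg_lim.
Unshelve. all: by end_near. Qed.

Lemma D1_flatk n k : D1 n (flatk k).
Proof.
elim: n k => [|n IH] k.
  move=> x; have := is_derive_flatk k x => /@ex_derive /derivable1_diffP.
  exact: differentiable_continuous.
exists (fun x => - k%:R * flatk k.+1 x + flatk k.+2 x); first exact: is_derive_flatk.
by apply: D1D => //; apply: D1M => //; exact: D1_cst.
Qed.

Definition flat (x : R) := if 0 < x then expR (- x^-1) else 0.

Lemma smooth1_flat : smooth1 flat.
Proof.
move=> k; apply: D1_ext (D1_flatk k 0) => x.
by rewrite /flatk /flat expr0 mul1r.
Qed.

Lemma flat_ge0 x : 0 <= flat x.
Proof. by rewrite /flat; case: ifP => // _; exact: expR_ge0. Qed.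

Lemma flat_le1 x : flat x <= 1.
Proof. by rewrite /flat; case: ifP => // x0; rewrite -expR0 ler_expR oppr_le0 invr_ge0 ltW. Qed.

(** Dilating [flat] produces the indicator of ]0, oo[ in the limit; this is how smooth tests
    approximate indicators of boxes. *)
Lemma cvg_flat x : (fun n : nat => flat (n.+1%:R * x)) @ \oo --> (if 0 < x then 1 else 0 : R).
Proof.
case: ifPn => x0; last first.
  rewrite (_ : (fun _ => _) = (fun=> 0)); first exact: cvg_cst.
  by apply/funext => n; rewrite /flat pmulr_rgt0// (negbTE x0).
rewrite (_ : (fun _ => _) = (fun n => expR (- (n.+1%:R^-1 * x^-1)))); last first.
  by apply/funext => n; rewrite /flat pmulr_rgt0// x0 invfM.
rewrite -[X in _ --> X]expR0; apply: continuous_cvg; first exact: continuous_expR.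
rewrite -oppr0; apply: cvgN; rewrite -(mul0r x^-1); apply: cvgM; [exact: cvg_harmonic|exact: cvg_cst].
Qed.

End smooth1.

Section tensor.
Context {R : realType}.

Definition tensor (f g : R -> R) (z : R * R) := f z.1 * g z.2.

Lemma is_derive_tensor_x f g (z : R * R) f' : is_derive z.1 (1 : R) f f' ->
  is_derive z ex (tensor f g) (f' * g z.2).
Proof.
move=> df.
have H : h^-1 *: (tensor f g (h *: ex + z) - tensor f g z) @[h --> (0 : R)^'] --> f' * g z.2.
  have c : h^-1 *: (f (h *: (1 : R) + z.1) - f z.1) @[h --> (0 : R)^'] --> f'.
    rewrite -(@derive_val _ _ _ _ _ _ _ df); exact: (@ex_derive _ _ _ _ _ _ _ df).
  rewrite (_ : (fun _ => _) = (fun h => h^-1 *: (f (h *: (1 : R) + z.1) - f z.1) * g z.2)).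
    by apply: cvgM => //; exact: cvg_cst.
  by apply/funext => h; rewrite /tensor /= /GRing.scale/= mulr0 add0r; ring.
by apply: DeriveDef; [apply/cvg_ex; exists (f' * g z.2)|exact/cvg_lim].
Qed.

Lemma is_derive_tensor_y f g (z : R * R) g' : is_derive z.2 (1 : R) g g' ->
  is_derive z ey (tensor f g) (f z.1 * g').
Proof.
move=> dg.
have H : h^-1 *: (tensor f g (h *: ey + z) - tensor f g z) @[h --> (0 : R)^'] --> f z.1 * g'.
  have c : h^-1 *: (g (h *: (1 : R) + z.2) - g z.2) @[h --> (0 : R)^'] --> g'.
    rewrite -(@derive_val _ _ _ _ _ _ _ dg); exact: (@ex_derive _ _ _ _ _ _ _ dg).
  rewrite (_ : (fun _ => _) = (fun h => f z.1 * (h^-1 *: (g (h *: (1 : R) + z.2) - g z.2)))).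
    by apply: cvgM => //; exact: cvg_cst.
  by apply/funext => h; rewrite /tensor /= /GRing.scale/= mulr0 add0r; ring.
by apply: DeriveDef; [apply/cvg_ex; exists (f z.1 * g')|exact/cvg_lim].
Qed.

Lemma smooth_tensor f g : smooth1 f -> smooth1 g -> smooth (tensor f g).
Proof.
move=> sf sg k; elim: k f g sf sg => [|k IH] f g sf sg.
  move=> z; apply: cvgM.
    by apply: continuous_comp; [exact: cvg_fst|exact: (D1_continuous (sf 0%N))].
  by apply: continuous_comp; [exact: cvg_snd|exact: (D1_continuous (sg 0%N))].
have [df sdf] := smooth1_derive sf; have [dg sdg] := smooth1_derive sg.
have cT : continuous (tensor f g).
  move=> z; apply: cvgM.
    by apply: continuous_comp; [exact: cvg_fst|exact: (D1_continuous (sf 0%N))].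
  by apply: continuous_comp; [exact: cvg_snd|exact: (D1_continuous (sg 0%N))].
have dx z : is_derive z ex (tensor f g) (tensor ('D_1 f) g z) by exact: is_derive_tensor_x.
have dy z : is_derive z ey (tensor f g) (tensor f ('D_1 g) z) by exact: is_derive_tensor_y.
split => //.
- rewrite (_ : 'D_ex _ = tensor ('D_1 f) g); first exact: IH.
  by apply/funext => z; have := dx z => H; rewrite derive_val.
- rewrite (_ : 'D_ey _ = tensor f ('D_1 g)); first exact: IH.
  by apply/funext => z; have := dy z => H; rewrite derive_val.
Qed.

End tensor.

(** * Functions whose integrals over boxes vanish *)

Section vanishing.
Context {R : realType}.
Notation lam := (@lebesgue_measure R).
Notation mu := (leb2 R).

Lemma le_abse_fine (u : \bar R) : (`|(fine u)%:E| <= `|u|)%E.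
Proof. by case: u => [r||]//=; rewrite normr0 leey. Qed.

Lemma mem_itv_set (i : interval R) (x : R) : (x \in [set` i]) = (x \in i).
Proof. by apply/idP/idP => [/set_mem//|h]; exact: mem_set. Qed.

Lemma leb2_integrable_restrict (E D : set (R * R)) (K : R * R -> R) : measurable E -> measurable D ->
  D `<=` E -> mu.-integrable E (EFin \o K) -> mu.-integrable setT (EFin \o (K \_ D)).
Proof.
move=> mE mD DE iK.
have := @integrableS _ (measurableTypeR R * measurableTypeR R)%type R mu E D _ mE mD DE iK.
move/(@integrable_mkcond _ (measurableTypeR R * measurableTypeR R)%type R mu _ _ mD).
by apply: eq_integrable => // z _; rewrite /= !patchE; case: ifP.
Qed.

Lemma ae_fst_neq (x0 : R) : {ae mu, forall z, z.1 != x0}.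
Proof.
exists ([set x0] `*` setT); split.
- exact: measurableX.
- by rewrite [LHS]product_measure1E//= lebesgue_measure_set1 mul0e.
- by move=> -[x y] /= /negP; rewrite negbK => /eqP ->.
Qed.

Lemma ae_eq0_itv (k : R -> R) : lam.-integrable setT (EFin \o k) ->
  (forall s t, s < t -> \int[lam]_(x in `]s, t[) k x = 0) ->
  {ae lam, forall x, k x = 0}.
Proof.
move=> ik k0; have mk : measurable_fun setT k by apply/measurable_EFinP; exact: measurable_int ik.
have iS (D : set (measurableTypeR R)) : measurable D -> lam.-integrable D (EFin \o k).
  by move=> mD; apply: integrableS ik.
have := ae_cvg_average ik; apply: filterS => x [cx _].
have {}cx : (fun=> 0) @ \oo --> k x.
  apply: cvg_trans cx; apply: near_eq_cvg; apply: nearW => n.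
  rewrite Rintegral_shift//.
  rewrite -Rintegral_itv_bndo_bndc; last exact: iS.
  by rewrite -Rintegral_itv_obnd_cbnd; [rewrite k0 ?mulr0// ltrDl invr_gt0|exact: iS].
by have /cvg_lim <- := cx; [rewrite lim_cst|exact: Rhausdorff].
Qed.

(** For fixed y and h, the vertical integral of K over [y, y + h], as a function of x, has zero
    integral on every interval, hence vanishes for almost every x. Letting h tend to 0 along the
    vertical lines recovers K. *)
Lemma ae_eq0_box (K : R * R -> R) : mu.-integrable setT (EFin \o K) ->
  (forall s t c d, s < t -> c < d ->
    (\int[mu]_(z in (`]s, t[ `*` `]c, d[)) (K z)%:E = 0)%E) ->
  {ae mu, forall z, K z = 0}.
Proof.
move=> iK K0.
have mK : measurable_fun setT K by apply/measurable_EFinP; exact: measurable_int iK.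
have mbox (A B : set (measurableTypeR R)) : measurable A -> measurable B -> measurable (A `*` B).
  exact: measurableX.
have M0 h : 0 < h -> {ae mu, forall z, lint ey h K z = 0}.
  move=> h0.
  suff : {ae mu, forall z, `|lint ey h K z|%:E = 0%E}.
    by apply: filterS => z [] /eqP; rewrite normr_eq0 => /eqP.
  have mL : measurable_fun setT (lint ey h K) by exact: measurable_lint.
  apply: ae_fubini_x => //.
    by apply/measurable_EFinP; exact: measurableT_comp.
  apply: nearW => y.
  pose Ky := K \_ (setT `*` `]y, (y + h)[).
  have mset : measurable ([set: R] `*` `]y, (y + h)[ : set (R * R)) by apply: measurableX => //; exact: measurable_itv.
  have iKy : mu.-integrable setT (EFin \o Ky).
    exact: leb2_integrable_restrict iK.
  have iF := @integrable_fubini_F _ _ (measurableTypeR R) (measurableTypeR R) R lam lam (EFin \o Ky) iKy.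
  pose m x := fine (fubini_F lam (EFin \o Ky) x).
  have mE x : lint ey h K (x, y) = m x.
    rewrite /lint (_ : (fun s => _) = (fun s => K (x, y + s))); last first.
      by apply/funext => s; congr K; congr pair => /=; rewrite /GRing.scale/=; ring.
    rewrite (@Rintegral_shift R y h (fun t => K (x, t))); last first.
      by apply: (measurableT_comp mK); exact: pair1_measurable.
    rewrite /m /fubini_F /Rintegral; congr fine.
    have mKx (D : set R) : measurable D -> measurable_fun D (fun t => (K (x, t))%:E).
      move=> _; apply: measurable_funTS; apply/measurable_EFinP.
      by apply: (measurableT_comp mK); exact: pair1_measurable.
    rewrite -integral_itv_bndo_bndc; last by apply: mKx; exact: measurable_itv.
    rewrite -integral_itv_obnd_cbnd; last by apply: mKx; exact: measurable_itv.
    rewrite [LHS]integral_mkcond; apply: eq_integral => t _.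
    by rewrite /Ky /= !patchE in_setX in_setT /=; case: ifP.
  have im : lam.-integrable setT (EFin \o m).
    apply/integrableP; split.
      apply/measurable_EFinP; apply: measurableT_comp; first exact: fine_measurable.
      exact: measurable_int iF.
    move/integrableP : iF => [mF]; apply: le_lt_trans; apply: ge0_le_integral => //.
    - apply/measurable_EFinP; apply: measurableT_comp => //.
      by apply: measurableT_comp; first exact: fine_measurable.
    - exact: measurableT_comp.
    - by move=> x _; exact: le_abse_fine.
  have : {ae lam, forall x, m x = 0}.
    apply: ae_eq0_itv => // s t st.
    have : (\int[lam]_(x in `]s, t[) fubini_F lam (EFin \o Ky) x = 0)%E.
      pose Kb := K \_ (`]s, t[ `*` `]y, (y + h)[).
      have mset2 : measurable (`]s, t[ `*` `]y, (y + h)[ : set (R * R)).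
        by apply: measurableX; exact: measurable_itv.
      have iKb : mu.-integrable setT (EFin \o Kb).
        exact: leb2_integrable_restrict iK.
      have H := @integral12_prod_meas1 _ _ (measurableTypeR R) (measurableTypeR R) R lam lam (EFin \o Kb) iKb.
      transitivity (\int[lam]_x fubini_F lam (EFin \o Kb) x)%E.
        rewrite integral_mkcond; apply: eq_integral => x _; rewrite patchE /fubini_F.
        case: ifPn => xs.
          by apply: eq_integral => t' _; rewrite /= /Kb /Ky !patchE !in_setX in_setT xs.
        by rewrite integral0_eq// => t' _; rewrite /= /Kb patchE in_setX (negbTE xs).
      rewrite H -[RHS](K0 s t y (y + h))// ?ltrDl// [RHS]integral_mkcond.
      by apply: eq_integral => z _; rewrite /= /Kb !patchE; case: ifP.
    have iFS := @integrableS _ (measurableTypeR R) R lam _ `]s, t[%classic _ measurableT (measurable_itv _) (@subsetT _ _) iF.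
    move=> H0; rewrite /Rintegral -[RHS]/(fine 0%E) -H0; congr fine.
    apply: ae_eq_integral => //.
    - by apply: measurable_funTS; exact: measurable_int im.
    - exact: measurable_int iFS.
    - have : {ae lam, forall x, `]s, t[%classic x -> fubini_F lam (EFin \o Ky) x \is a fin_num}.
        by apply: integrable_ae iFS.
      apply: filterS => x Hx xs.
      by rewrite /= /m fineK// Hx.
  by apply: filterS => x; rewrite mE => ->; rewrite normr0.
have : {ae mu, forall z, forall n, lint ey n.+1%:R^-1 K z = 0}.
  by apply/ae_foralln => n; apply: M0; rewrite invr_gt0.
have := ae_cvg_lint_plane (or_intror erefl) iK; apply: filterS2 => z [cz _] z0.
have {}cz : (fun=> 0) @ \oo --> K z.
  by apply: cvg_trans cz; apply: near_eq_cvg; apply: nearW => n; rewrite z0 mulr0.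
by have /cvg_lim <- := cz; [rewrite lim_cst|exact: Rhausdorff].
Qed.

End vanishing.

Section tests.
Context {R : realType} (L : R).
Hypothesis L_gt0 : 0 < L.
Notation lam := (@lebesgue_measure R).
Notation mu := (leb2 R).

(* Tends to the indicator of ]s, t[ modulo L; the two sines change sign together
   under [x |-> x + L], which makes it L-periodic. *)
Definition bumpx (s t : R) (n : nat) (x : R) : R :=
  flat (n.+1%:R * (sin (pi / L * (x - s)) * sin (pi / L * (t - x)))).

Definition bumpy (c d : R) (n : nat) (y : R) : R := flat (n.+1%:R * ((y - c) * (d - y))).

Lemma smooth1_bumpx s t n : smooth1 (bumpx s t n).
Proof.
move=> k; apply: (@D1_comp R k flat); first exact: smooth1_flat.
apply: D1M; first exact: D1_cst.
apply: D1M; apply: (@D1_comp R k sin); try exact: (D1_sincos k).1.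
- by apply: D1M; [exact: D1_cst|apply: D1D; [exact: D1_id|exact: D1_cst]].
- apply: D1M; first exact: D1_cst.
  apply: D1_ext (D1D (D1_cst k t) (D1M (D1_cst k (-1)) (D1_id k))) => x.
  by rewrite mulN1r.
Qed.

Lemma smooth1_bumpy c d n : smooth1 (bumpy c d n).
Proof.
move=> k; apply: (@D1_comp R k flat); first exact: smooth1_flat.
apply: D1M; first exact: D1_cst.
apply: D1M; first by apply: D1D; [exact: D1_id|exact: D1_cst].
apply: D1_ext (D1D (D1_cst k d) (D1M (D1_cst k (-1)) (D1_id k))) => x.
by rewrite mulN1r.
Qed.

Lemma bumpx_per s t n x : bumpx s t n (x + L) = bumpx s t n x.
Proof.
rewrite /bumpx (_ : pi / L * (x + L - s) = pi / L * (x - s) + pi); last by field; rewrite gt_eqF.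
rewrite (_ : pi / L * (t - (x + L)) = pi / L * (t - x) - pi); last by field; rewrite gt_eqF.
have sB u : sin (u - pi) = - sin u :> R.
  by rewrite -[in RHS](subrK pi u) sinDpi opprK.
by rewrite sinDpi sB mulrNN.
Qed.

Lemma sin_scaled_gt0 x : 0 < x < L -> 0 < sin (pi / L * x).
Proof.
move=> /andP[x0 xL]; apply: sin_gt0_pi; apply/andP; split.
  by rewrite mulr_gt0// divr_gt0// pi_gt0.
by rewrite -[X in _ < X]mulr1 -mulrA ltr_pM2l ?pi_gt0// mulrC ltr_pdivrMr// mul1r.
Qed.

Lemma sin_scaled_le0 x : - L <= x <= 0 -> sin (pi / L * x) <= 0.
Proof.
move=> /andP[xL x0]; rewrite -[x]opprK mulrN sinN oppr_le0.
apply: sin_ge0_pi; apply/andP; split.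
  apply: mulr_ge0; last by rewrite oppr_ge0.
  by apply: divr_ge0; [exact: pi_ge0|exact: ltW].
by rewrite -[X in _ <= X]mulr1 -mulrA ler_pM2l ?pi_gt0// mulrC ler_pdivrMr// mul1r lerNl.
Qed.

Lemma cvg_bumpx s t x : 0 <= s -> s < t -> t <= L -> 0 <= x < L ->
  (fun n => bumpx s t n x) @ \oo --> (if s < x < t then 1 else 0 : R).
Proof.
move=> s0 st tL /andP[x0 xL].
have := (@cvg_flat R (sin (pi / L * (x - s)) * sin (pi / L * (t - x)))).
rewrite (_ : (0 < _) = (s < x < t))//.
case: (ltP s x) => /= sx; last first.
  apply/negbTE; rewrite -leNgt mulr_le0_ge0//.
    by apply: sin_scaled_le0; apply/andP; split; lra.
  (* Equality t - x = L occurs only for t = L and x = 0, where the second sine vanishes instead of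
     being positive. *)
  have [tx|tx] := ltP (t - x) L.
    by rewrite ltW// sin_scaled_gt0//; apply/andP; split; lra.
  rewrite (_ : t - x = L); last lra.
  by rewrite divfK ?gt_eqF// sinpi.
case: (ltP x t) => xt.
  by rewrite mulr_gt0// sin_scaled_gt0//; apply/andP; split; lra.
apply/negbTE; rewrite -leNgt mulr_ge0_le0//.
  by rewrite ltW// sin_scaled_gt0//; apply/andP; split; lra.
by apply: sin_scaled_le0; apply/andP; split; lra.
Qed.

Lemma cvg_bumpy c d y : c < d ->
  (fun n => bumpy c d n y) @ \oo --> (if c < y < d then 1 else 0 : R).
Proof.
move=> cd; have := (@cvg_flat R ((y - c) * (d - y))).
rewrite (_ : (0 < _) = (c < y < d))//.
case: (ltP c y) => /= cy; first by rewrite pmulr_rgt0 ?subr_gt0.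
apply/negbTE; rewrite -leNgt mulr_le0_ge0//; lra.
Qed.

Lemma bumpy_supp c d n y : c < d -> ~~ (c < y < d) -> bumpy c d n y = 0.
Proof.
move=> cd /negP h; rewrite /bumpy /flat ifF//; apply/negbTE; rewrite pmulr_rgt0// -leNgt.
have [cy|cy] := leP y c; first by rewrite mulr_le0_ge0//; lra.
rewrite mulr_ge0_le0//; first lra.
by rewrite subr_le0 leNgt; apply/negP => yd; apply: h; rewrite cy yd.
Qed.

(** The end points c and d are included: there the argument of [flat] is 0, where its derivative
    vanishes, and the chain rule applies. *)
Lemma deriv_bumpy_supp c d n y : c < d -> ~~ (c < y < d) -> 'D_1 (bumpy c d n) y = 0.
Proof.
move=> cd h.
have b0 := bumpy_supp n cd h.
have xle : n.+1%:R * ((y - c) * (d - y)) <= 0.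
  by rewrite leNgt; apply/negP => g; move: b0; rewrite /bumpy /flat g => /eqP; rewrite gt_eqF// expR_gt0.
have dflat : is_derive (n.+1%:R * ((y - c) * (d - y))) (1 : R) flat 0.
  have := is_derive_flatk 0 (n.+1%:R * ((y - c) * (d - y))).
  rewrite (_ : flatk 0 = flat); last by apply/funext => z; rewrite /flatk /flat expr0 mul1r.
  by rewrite /flatk ltNge xle/= mulr0 addr0.
have dP : is_derive y (1 : R) (fun y : R => n.+1%:R * ((y - c) * (d - y)))
    ('D_1 (fun y : R => n.+1%:R * ((y - c) * (d - y))) y).
  have : smooth1 (fun y : R => n.+1%:R * ((y - c) * (d - y))).
    move=> k; apply: D1M; first exact: D1_cst.
    apply: D1M; first by apply: D1D; [exact: D1_id|exact: D1_cst].
    apply: D1_ext (D1D (D1_cst k d) (D1M (D1_cst k (-1)) (D1_id k))) => z.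
    by rewrite mulN1r.
  by move/smooth1_derive => [/(_ y)].
have := @is_derive1_comp _ flat (fun y : R => n.+1%:R * ((y - c) * (d - y))) _ _ _ dflat dP.
by rewrite mul0r => H; apply: (@derive_val _ _ _ _ _ _ _ H).
Qed.

(** The products of bumps are bounded by 1 and converge to the indicators of boxes, so dominated
    convergence by |k| reduces the claim to [ae_eq0_box]. *)
Lemma ae_eq0_tests (c d : R) (k : R * R -> R) : measurable_fun setT k ->
  (\int[mu]_(z in cyl L) `|k z|%:E < +oo)%E ->
  (forall s t c' d' n, 0 <= s -> s < t -> t <= L -> c <= c' -> c' < d' -> d' <= d ->
    (\int[mu]_(z in cyl L) (k z * tensor (bumpx s t n) (bumpy c' d' n) z)%:E = 0)%E) ->
  {ae mu, forall z, cyl L z -> c < z.2 < d -> k z = 0}.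
Proof.
move=> mk ik k0.
have mcyl : measurable (cyl L) by exact: measurable_cyl.
have ick : mu.-integrable (cyl L) (EFin \o k).
  by apply/integrableP; split => //; exact/measurable_EFinP/measurable_funTS.
(* The box is open while the fundamental domain contains x = 0; that line is null and is discarded
   by [ae_fst_neq]. *)
pose O : set (R * R) := `]0, L[ `*` `]c, d[.
pose K := k \_ O.
have mch : measurable O by apply: measurableX; exact: measurable_itv.
have chcyl : O `<=` cyl L.
  by move=> -[x y] [/=]; rewrite !in_itv/= => /andP[x0 xL] _; split; rewrite //= in_itv/= xL ltW.
have iK : mu.-integrable setT (EFin \o K).
  exact: leb2_integrable_restrict chcyl ick.
suff : {ae mu, forall z, K z = 0}.
  have := ae_fst_neq (0 : R); apply: filterS2 => -[x y] /= x0.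
  rewrite /K patchE => + [xL _] /andP[cy yd].
  rewrite mem_set//; split => /=; rewrite in_itv/= ?cy ?yd//.
  move: xL; rewrite /= in_itv/= => /andP[x1 ->].
  by rewrite andbT lt_neqAle x1 andbT eq_sym x0.
apply: ae_eq0_box => // s t c' d' st cd'.
(* K vanishes outside O, so an arbitrary box may be replaced by its intersection with O, the only
   kind of box that the tests reach. *)
have KE : (\int[mu]_(z in (`]s, t[ `*` `]c', d'[)) (K z)%:E =
    \int[mu]_(z in (`](Num.max s 0%R), (Num.min t L)[ `*` `](Num.max c c'), (Num.min d d')[)) (k z)%:E)%E.
  rewrite integral_mkcond [RHS]integral_mkcond; apply: eq_integral => -[x y] _.
  rewrite /K /O !patchE !in_setX /= !mem_itv_set.
  rewrite (_ : (x \in `](Num.max s 0), (Num.min t L)[) = (x \in `]s, t[) && (x \in `]0, L[)); last first.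
    by rewrite !in_itv/= gt_max lt_min; case: (s < x); case: (x < t); case: (0 < x); case: (x < L).
  rewrite (_ : (y \in `](Num.max c c'), (Num.min d d')[) = (y \in `]c', d'[) && (y \in `]c, d[)); last first.
    by rewrite !in_itv/= gt_max lt_min; case: (c < y); case: (y < d); case: (c' < y); case: (y < d').
  by case: (x \in `]s, t[); case: (x \in `]0, L[); case: (y \in `]c', d'[); case: (y \in `]c, d[).
rewrite KE.
have [S|S] := leP (Num.min t L) (Num.max s 0).
  by rewrite [X in X `*` _]set_itv_ge -?leNgt// set0X integral_set0.
have [C|C] := leP (Num.min d d') (Num.max c c').
  by rewrite [X in _ `*` X]set_itv_ge -?leNgt// setX0 integral_set0.
set s' := Num.max s 0 in S *; set t' := Num.min t L in S *.
set c1 := Num.max c c' in C *; set d1 := Num.min d d' in C *.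
have s'0 : 0 <= s' by rewrite le_max lexx orbT.
have t'L : t' <= L by rewrite ge_min lexx orbT.
have c1c : c <= c1 by rewrite le_max lexx.
have d1d : d1 <= d by rewrite ge_min lexx.
pose fn n z := (k z * tensor (bumpx s' t' n) (bumpy c1 d1 n) z)%:E.
pose B : set (R * R) := `]s', t'[ `*` `]c1, d1[.
have mB : measurable B by apply: measurableX; exact: measurable_itv.
have mfn n : measurable_fun (cyl L) (fn n).
  apply: measurable_funTS; apply/measurable_EFinP; apply: measurable_funM => //.
  apply: measurable_funM.
    apply: (measurableT_comp _ measurable_fst); apply: continuous_measurable_fun.
    exact: (D1_continuous (smooth1_bumpx s' t' n 0%N)).
  apply: (measurableT_comp _ measurable_snd); apply: continuous_measurable_fun.
  exact: (D1_continuous (smooth1_bumpy c1 d1 n 0%N)).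
have [] := @dominated_convergence _ _ _ mu (cyl L) mcyl fn (EFin \o (k \_ B))
  (fun z => `|k z|%:E) mfn.
- apply: measurable_funTS; apply/measurable_EFinP.
  by apply/(measurable_restrictT _ _).1 => //; exact: measurable_funTS.
- apply: nearW => -[x y] [xL _].
  apply: cvg_EFin; first exact: nearW.
  have xL' : 0 <= x < L by move: xL; rewrite /= in_itv.
  have := cvgM (cvg_cst (k (x, y))) (cvgM (cvg_bumpx s'0 S t'L xL') (@cvg_bumpy c1 d1 y C)).
  rewrite (_ : k (x, y) * _ = (k \_ B) (x, y)); first exact.
  rewrite patchE /B in_setX /=.
  rewrite !mem_itv_set !in_itv/=.
  by case: (_ < _ < _) => /=; case: (_ < _ < _); rewrite ?mulr1 ?mulr0.
- by have := integrable_norm ick.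
- apply: nearW => z n _; rewrite /fn abse_EFin lee_fin normrM ler_piMr//.
  rewrite /tensor normrM !ger0_norm ?flat_ge0//.
  by rewrite mulr_ile1 ?flat_ge0 ?flat_le1.
- move=> _ _ H.
  have {}H : (fun _ : nat => 0%E : \bar R) @ \oo --> (\int[mu]_(x in cyl L) (EFin \o k \_ B) x)%E.
    apply: cvg_trans H; apply: near_eq_cvg; apply: nearW => n.
    exact: k0.
  transitivity (\int[mu]_(z in cyl L) (EFin \o k \_ B) z)%E; last first.
    by move/cvg_lim : H => <-//; rewrite lim_cst.
  rewrite [LHS]integral_mkcond [RHS]integral_mkcond; apply: eq_integral => -[x y] _.
  rewrite -/B !patchE /= ?patchE; have [zB|zB] := boolP ((x, y) \in B); last first.
    by rewrite ?(negbTE zB); case: ifP.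
  rewrite ?zB ifT//; move: zB; rewrite /B /cyl !in_setX in_setT !mem_itv_set !in_itv/= => /andP[/andP[sx xt] _].
  by rewrite (le_trans s'0 (ltW sx)) (lt_le_trans xt t'L).
Qed.

End tests.

(** * From weak derivatives to difference quotients *)

Lemma fubini_in d1 d2 (T1 : measurableType d1) (T2 : measurableType d2) (R : realType)
    (m1 : {sigma_finite_measure set T1 -> \bar R}) (m2 : {sigma_finite_measure set T2 -> \bar R})
    (D1 : set T1) (D2 : set T2) (f : T1 * T2 -> R) :
  measurable D1 -> measurable D2 -> measurable_fun setT f ->
  (\int[m1]_(x in D1) \int[m2]_(y in D2) `|f (x, y)|%:E < +oo)%E ->
  (\int[m1]_(x in D1) \int[m2]_(y in D2) (f (x, y))%:E =
   \int[m2]_(y in D2) \int[m1]_(x in D1) (f (x, y))%:E)%E.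
Proof.
move=> mD1 mD2 mf foo.
pose g := (EFin \o f) \_ (D1 `*` D2).
have mg : measurable_fun setT g.
  by apply/(measurable_restrictT _ _).1; [exact: measurableX|exact/measurable_funTS/measurable_EFinP].
have gE x y : g (x, y) = if x \in D1 then if y \in D2 then (f (x, y))%:E else 0%E else 0%E.
  by rewrite /g patchE in_setX; case: (x \in D1).
have ig : (m1 \x m2)%E.-integrable setT g.
  apply/(integrable12ltyP m1 m2 mg); apply: le_lt_trans foo.
  rewrite le_eqVlt; apply/orP; left; apply/eqP.
  rewrite [RHS]integral_mkcond; apply: eq_integral => x _; rewrite patchE; case: ifPn => xD.
    rewrite [RHS]integral_mkcond; apply: eq_integral => y _; rewrite patchE gE xD.
    by case: ifP => //; rewrite abse0.
  by rewrite integral0_eq// => y _; rewrite gE (negbTE xD) abse0.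
transitivity (\int[m1]_x \int[m2]_y g (x, y))%E.
  rewrite [LHS]integral_mkcond; apply: eq_integral => x _; rewrite patchE; case: ifPn => xD.
    by rewrite [LHS]integral_mkcond; apply: eq_integral => y _; rewrite patchE gE xD.
  by rewrite integral0_eq// => y _; rewrite gE (negbTE xD).
rewrite (integral12_prod_meas1 ig) -(integral21_prod_meas1 ig).
rewrite [RHS]integral_mkcond; apply: eq_integral => y _; rewrite patchE; case: ifPn => yD.
  rewrite [RHS]integral_mkcond; apply: eq_integral => x _; rewrite patchE gE yD.
  by case: ifP.
by rewrite /fubini_G integral0_eq// => x _; rewrite gE (negbTE yD) if_same.
Qed.

Lemma measurable_ge0_int_in d1 d2 (T1 : measurableType d1) (T2 : measurableType d2) (R : realType)
    (m2 : {sigma_finite_measure set T2 -> \bar R}) (D2 : set T2) (f : T1 * T2 -> \bar R) :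
  measurable D2 -> measurable_fun setT f -> (forall z, 0 <= f z)%E ->
  measurable_fun setT (fun x => \int[m2]_(y in D2) f (x, y))%E.
Proof.
move=> mD2 mf f0.
have mg : measurable_fun setT (f \_ (setT `*` D2)).
  by apply/(measurable_restrictT _ _).1; [exact: measurableX|exact: measurable_funTS].
have g0 z : (0 <= (f \_ (setT `*` D2)) z)%E by rewrite patchE; case: ifP.
have := measurable_fun_fubini_tonelli_F (m2 := m2) _ mg g0.
apply: eq_measurable_fun => x _; rewrite /fubini_F [RHS]integral_mkcond.
by apply: eq_integral => y _; rewrite !patchE in_setX in_setT.
Qed.

Lemma measurable_int_in d1 d2 (T1 : measurableType d1) (T2 : measurableType d2) (R : realType)
    (m2 : {sigma_finite_measure set T2 -> \bar R}) (D2 : set T2) (f : T1 * T2 -> \bar R) :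
  measurable D2 -> measurable_fun setT f ->
  measurable_fun setT (fun x => \int[m2]_(y in D2) f (x, y))%E.
Proof.
move=> mD2 mf; under eq_fun do rewrite integralE.
apply: emeasurable_funB.
- have := @measurable_ge0_int_in _ _ _ _ _ m2 D2 _ mD2 (measurable_funepos mf) (fun=> funepos_ge0 _ _).
  by apply: eq_measurable_fun => x _; apply: eq_integral => y _; rewrite !funeposE.
- have := @measurable_ge0_int_in _ _ _ _ _ m2 D2 _ mD2 (measurable_funeneg mf) (fun=> funeneg_ge0 _ _).
  by apply: eq_measurable_fun => x _; apply: eq_integral => y _; rewrite !funenegE.
Qed.

Section bounded.
Context {R : realType}.

Lemma continuous_itv_bounded (f : R -> R) (a b : R) : continuous f ->
  exists2 C, 0 <= C & forall x, a <= x <= b -> `|f x| <= C.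
Proof.
move=> cf; have : compact (f @` `[a, b]).
  by apply: continuous_compact; [exact: continuous_subspaceT|exact: segment_compact].
move/compact_bounded => [M [_ hM]]; exists (`|M| + 1); first by rewrite addr_ge0.
move=> x xab; apply: (hM (`|M| + 1)); first by rewrite (le_lt_trans (ler_norm _))// ltrDl.
by exists x => //=; rewrite in_itv.
Qed.

Lemma continuous_supp_bounded (f : R -> R) (a b : R) : continuous f ->
  (forall x, ~~ (a < x < b) -> f x = 0) -> exists2 C, 0 <= C & forall x, `|f x| <= C.
Proof.
move=> cf f0; have [C C0 hC] := continuous_itv_bounded a b cf; exists C => // x.
have [/andP[ax xb]|/f0 ->] := boolP (a < x < b); first by apply: hC; rewrite !ltW.
by rewrite normr0.
Qed.

Lemma continuous_per_bounded (L : R) (f : R -> R) : 0 < L -> continuous f ->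
  (forall x, f (x + L) = f x) -> exists2 C, 0 <= C & forall x, `|f x| <= C.
Proof.
move=> L0 cf pf; have [C C0 hC] := continuous_itv_bounded 0 L cf; exists C => // x.
have pz : xper L (fun z : R * R => f z.1) by move=> z; exact: pf.
have := xperZ (- Num.floor (x / L)) pz (x, 0).
rewrite /= rmorphN mulNr -/(wrap L x) => <-.
by apply: hC; have := wrap_in L0 x; rewrite in_itv/= => /andP[-> /ltW ->].
Qed.

Lemma Rintegral_deriv (p p' : R -> R) (h : R) : 0 < h -> (forall r : R, is_derive r (1 : R) p (p' r)) ->
  continuous p' ->
  (\int[@lebesgue_measure R]_(r in `[0%R, h]) (p' r)%:E = (p h - p 0%R)%:E)%E.
Proof.
move=> h0 dp cp'.
have cp : continuous p.
  by move=> r; have := dp r => /@ex_derive /derivable1_diffP; exact: differentiable_continuous.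
rewrite EFinB; apply: continuous_FTC2 => //.
- exact: continuous_subspaceT.
- split.
  + by move=> r _; exact: ex_derive.
  + by apply: cvg_at_right_filter; exact: cp.
  + by apply: cvg_at_left_filter; exact: cp.
- by move=> r _; rewrite derive1E; apply: derive_val.
Qed.

End bounded.

Lemma bounded_itv_integrable (R : realType) (f : R -> R) (h C : R) : measurable_fun setT f ->
  (forall x, `|f x| <= C) -> (@lebesgue_measure R).-integrable `[0, h] (EFin \o f).
Proof.
move=> mf fC; have C0 : 0 <= C by exact: le_trans (fC 0).
have ic : (@lebesgue_measure R).-integrable `[0, h] (EFin \o (cst C : R -> R)).
  by apply: continuous_compact_integrable; [exact: segment_compact|move=> x; exact: cvg_cst].
apply: le_integrable ic => //; first exact/measurable_funTS/measurable_EFinP.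
by move=> x _; rewrite /= lee_fin (ger0_norm C0).
Qed.

Section weak_to_difference.
Context {R : realType} (L : R).
Hypothesis L_gt0 : 0 < L.
Notation lam := (@lebesgue_measure R).
Notation mu := (leb2 R).

Lemma integrable_cylM (F b : R * R -> R) C : measurable_fun setT F ->
  (\int[mu]_(z in cyl L) `|F z|%:E < +oo)%E -> measurable_fun setT b ->
  (forall z, `|b z| <= C) -> mu.-integrable (cyl L) (fun z => (F z * b z)%:E).
Proof.
move=> mF iF mb bC.
have mcyl : measurable (cyl L) := measurable_cyl L.
have C0 : 0 <= C by exact: le_trans (bC (0, 0)).
have iFC : mu.-integrable (cyl L) (fun z => C%:E * (F z)%:E)%E.
  apply: integrableZl => //; apply/integrableP; split => //.
  exact/measurable_funTS/measurable_EFinP.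
apply: le_integrable iFC => //.
  by apply/measurable_funTS/measurable_EFinP; exact: measurable_funM.
by move=> z _; rewrite -EFinM !abse_EFin lee_fin !normrM mulrC (ger0_norm C0) ler_wpM2r.
Qed.

Lemma integral_cyl_lint_lty (e : R * R) h (k : R * R -> R) : 0 <= h ->
  measurable_fun setT k -> xper L k -> (\int[mu]_(z in cyl L) `|k z|%:E < +oo)%E ->
  (\int[mu]_(z in cyl L) \int[lam]_(s in `[0%R, h]) `|k (z + s *: e)%R|%:E < +oo)%E.
Proof.
move=> h0 mk pk ik.
rewrite (@integral_cyl_lint _ _ _ _ _ (fun z => `|k z|%:E))//.
- by rewrite lte_mul_pinfty.
- by apply/measurable_EFinP; exact: measurableT_comp.
- by move=> z; rewrite pk.
Qed.

Lemma ae_lint_integrable (e : R * R) h (k : R * R -> R) : 0 <= h ->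
  measurable_fun setT k -> xper L k -> (\int[mu]_(z in cyl L) `|k z|%:E < +oo)%E ->
  {ae mu, forall z, cyl L z -> lam.-integrable `[0, h] (fun s => (k (z + s *: e))%:E)}.
Proof.
move=> h0 mk pk ik.
have mkE : measurable_fun setT (fun z => `|k z|%:E).
  by apply/measurable_EFinP; exact: measurableT_comp.
have : mu.-integrable (cyl L) (fun z => \int[lam]_(s in `[0%R, h]) `|k (z + s *: e)%R|%:E)%E.
  apply/integrableP; split.
    by apply: measurable_funTS; apply: (@measurable_ge0_lint _ _ _ (fun z => `|k z|%:E)) => // z; rewrite lee_fin.
  under eq_integral do rewrite gee0_abs ?integral_ge0//.
  exact: integral_cyl_lint_lty.
move=> H; have : {ae mu, forall z, cyl L z ->
    (\int[lam]_(s in `[0%R, h]) `|k (z + s *: e)%R|%:E)%E \is a fin_num}.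
  by apply: integrable_ae H; exact: measurable_cyl.
apply: filterS => z + cz => /(_ cz) fz; apply/integrableP; split.
  apply: measurable_funTS; apply/measurable_EFinP.
  by apply: (measurableT_comp mk); exact: measurable_line.
by move: fz; rewrite ge0_fin_numE ?integral_ge0.
Qed.

(** Translation invariance moves the shift from psi to G; Fubini then collects the values of G along
    each segment. *)
Lemma integral_cyl_lint_signed (e : R * R) h (G psi : R * R -> R) C : 0 <= h ->
  measurable_fun setT G -> xper L G -> (\int[mu]_(z in cyl L) `|G z|%:E < +oo)%E ->
  measurable_fun setT psi -> xper L psi -> (forall z, `|psi z| <= C) ->
  (\int[lam]_(s in `[0%R, h]) \int[mu]_(z in cyl L) (G z * psi (z - s *: e))%:E =
   \int[mu]_(z in cyl L) (lint e h G z * psi z)%:E)%E.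
Proof.
move=> h0 mG pG iG mpsi ppsi bpsi.
have C0 : 0 <= C by exact: le_trans (bpsi (0, 0)).
transitivity (\int[lam]_(s in `[0%R, h]) \int[mu]_(z in cyl L) (G (z + s *: e)%R * psi z)%:E)%E.
  apply: eq_integral => s _.
  rewrite -[LHS](@integral_cyl_shift R L L_gt0 (fun z => (G z * psi (z - s *: e))%:E) (s *: e)).
  - by apply: eq_integral => z _; rewrite addrK.
  - apply/measurable_EFinP; apply: measurable_funM => //.
    by apply: (measurableT_comp mpsi); exact: measurable_shift2.
  - by move=> z; rewrite pG addrAC ppsi.
have mH : measurable_fun setT (fun zs : (R * R) * R => G (zs.1 + zs.2 *: e) * psi zs.1).
  apply: measurable_funM; first by apply: (measurableT_comp mG); exact: measurable_shift_line.
  exact: (measurableT_comp mpsi).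
have mcyl : measurable (cyl L) := measurable_cyl L.
rewrite -(@fubini_in _ _ (measurableTypeR R * measurableTypeR R)%type (measurableTypeR R) R
  (leb2_sigma_finite R) lam (cyl L) `[0%R, h]%classic _ mcyl (measurable_itv _) mH).
  apply: ae_eq_integral => //.
  - apply: measurable_funTS.
    apply: (@measurable_int_in _ _ (measurableTypeR R * measurableTypeR R)%type (measurableTypeR R) R
      lam `[0%R, h]%classic (fun zs => (G (zs.1 + zs.2 *: e) * psi zs.1)%:E)) => //.
    exact/measurable_EFinP.
  - apply: measurable_funTS; apply/measurable_EFinP; apply: measurable_funM => //.
    exact: measurable_lint.
  - have := ae_lint_integrable e h0 mG pG iG; apply: filterS => z + cz => /(_ cz) iz.
    rewrite /= /lint EFinM muleC /Rintegral fineK; last exact: integrable_fin_num iz.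
    rewrite -integralZl//.
    by apply: eq_integral => s _; rewrite EFinM muleC.
have mGE : measurable_fun setT (fun z => `|G z|%:E).
  by apply/measurable_EFinP; exact: measurableT_comp.
have mLG : measurable_fun setT (fun z : R * R => \int[lam]_(s in `[0%R, h]) `|G (z + s *: e)%R|%:E)%E.
  by apply: (@measurable_ge0_lint _ _ _ (fun z => `|G z|%:E)) => // z; rewrite lee_fin.
apply: (@le_lt_trans _ _ (C%:E * \int[mu]_(z in cyl L) \int[lam]_(s in `[0%R, h]) `|G (z + s *: e)%R|%:E)%E); last first.
  rewrite lte_mul_pinfty//; exact: integral_cyl_lint_lty.
rewrite -ge0_integralZl//; last 2 first.
- by first [exact: measurable_funTS|move=> z _; exact: integral_ge0|rewrite lee_fin].
- by first [exact: measurable_funTS|move=> z _; exact: integral_ge0|rewrite lee_fin].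
apply: ge0_le_integral => //.
- by move=> z _; exact: integral_ge0.
- apply: measurable_funTS.
  apply: (@measurable_int_in _ _ (measurableTypeR R * measurableTypeR R)%type (measurableTypeR R) R
      lam `[0%R, h]%classic (fun zs => `|G (zs.1 + zs.2 *: e) * psi zs.1|%:E)) => //.
  by apply/measurable_EFinP; exact: measurableT_comp.
- by apply: measurable_funTS; exact: emeasurable_funM.
- move=> z _.
  have mGz : measurable_fun setT (fun s : R => `|G (z + s *: e)|%:E).
    by apply: (measurableT_comp mGE); exact: measurable_line.
  rewrite -ge0_integralZl//; last exact: measurable_funTS.
  apply: ge0_le_integral => //.
  + apply: measurable_funTS; apply/measurable_EFinP; apply: measurableT_comp => //.
    have mz : measurable_fun setT (fun s : R => G (z + s *: e) * psi z).
      apply: measurable_funM; last exact: measurable_cst.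
      exact: (measurableT_comp mG (measurable_line e z)).
    exact: mz.
  + by apply: measurable_funTS; exact: emeasurable_funM.
  + by move=> s _; rewrite -EFinM lee_fin normrM mulrC ler_wpM2r.
Qed.

Lemma loc_integrable_pext a b c d f : loc_integrable L a b f -> a < c -> d < b ->
  measurable_fun setT (pext L c d f) /\ (\int[mu]_(z in cyl L) `|pext L c d f z|%:E < +oo)%E.
Proof.
move=> lf ac db; have i1 := lf c d ac db.
have mch : measurable (channel L c d) := measurable_channel L c d.
have sub : channel L c d `<=` (`[0, L[ `*` `[c, d]).
  by move=> -[x y] [/= ? ]; rewrite in_itv/= => /andP[/ltW cy /ltW yd]; split; rewrite //= in_itv/= cy.
have mS : measurable (`[0, L[ `*` `[c, d] : set (R * R)) by apply: measurableX; exact: measurable_itv.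
have i2 := @integrableS _ (measurableTypeR R * measurableTypeR R)%type R mu _ _ _ mS mch sub i1.
have mf : measurable_fun (channel L c d) f by apply/measurable_EFinP; exact: measurable_int i2.
split; first exact: measurable_pext.
case/integrableP : i2 => _; apply: le_lt_trans; rewrite le_eqVlt; apply/orP; left; apply/eqP.
rewrite [LHS]integral_mkcond [RHS]integral_mkcond; apply: eq_integral => -[x y] _.
rewrite !patchE /cyl /channel !in_setX in_setT andbT !mem_itv_set.
case: ifPn => //= xL; rewrite (pextE L_gt0) /= (wrap_id L_gt0 xL) in_itv/=.
by case: ifP => //; rewrite normr0.
Qed.

Lemma smooth1_shift (f : R -> R) s : smooth1 f -> smooth1 (fun x => f (x - s)).
Proof.
move=> sf k; apply: (@D1_comp R k f); first exact: sf.
by apply: D1D; [exact: D1_id|exact: D1_cst].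
Qed.

Lemma is_derive_shift (f : R -> R) s (x : R) : smooth1 f ->
  is_derive x (1 : R) (fun x => f (x - s)) ('D_1 f (x - s)).
Proof.
move=> /smooth1_derive[/(_ (x - s)) df _].
have ds : is_derive x (1 : R) (fun x : R => x - s) (1 - 0).
  by apply: is_deriveB.
by have := @is_derive1_comp _ f (fun x => x - s) _ _ _ df ds; rewrite subr0 mulr1.
Qed.

Lemma is_derive_reflect (f : R -> R) x (r : R) : smooth1 f ->
  is_derive r (1 : R) (fun r => f (x - r)) (- 'D_1 f (x - r)).
Proof.
move=> /smooth1_derive[/(_ (x - r)) df _].
have ds : is_derive r (1 : R) (fun r : R => x - r) (0 - 1).
  by apply: is_deriveB.
by have := @is_derive1_comp _ f (fun r => x - r) _ _ _ df ds; rewrite sub0r mulrN1.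
Qed.

Lemma measurable_tensor (f g : R -> R) : continuous f -> continuous g ->
  measurable_fun setT (tensor f g).
Proof.
move=> cf cg; apply: measurable_funM.
  by apply: (measurableT_comp _ measurable_fst); exact: continuous_measurable_fun.
by apply: (measurableT_comp _ measurable_snd); exact: continuous_measurable_fun.
Qed.

(** The weak derivative is going to be tested against all translates psi(z - r e) with 0 <= r <= h.
    They must stay supported inside the channel, whence the condition d + h e.2 < b, and integrating
    their derivatives over r must give back a difference of psi. *)
Lemma tensor_test (e : R * R) (al be : R -> R) (a b c d h : R) : e = ex \/ e = ey ->
  smooth1 al -> smooth1 be -> (forall x, al (x + L) = al x) ->
  (forall y, ~~ (c < y < d) -> be y = 0 /\ 'D_1 be y = 0) ->
  0 < h -> a < c -> d + h * e.2 < b ->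
  exists psi', [/\
    forall w z, 'D_e (fun z => tensor al be (z - w)) z = psi' (z - w),
    forall z, ~~ (c < z.2 < d) -> psi' z = 0,
    measurable_fun setT psi' /\ xper L psi',
    exists C, forall z, `|psi' z| <= C &
    (forall z : R * R, (\int[lam]_(r in `[0%R, h]) (psi' (z - r *: e)%R)%:E =
       (tensor al be z - tensor al be (z - h *: e))%:E)%E) /\
    forall r, 0 <= r <= h -> test_function L a b (fun z => tensor al be (z - r *: e))].
Proof.
move=> he sal sbe pal sube h0 ac dhb.
have [dal sdal] := smooth1_derive sal; have [dbe sdbe] := smooth1_derive sbe.
have [cal cbe] := (D1_continuous (sal 0%N), D1_continuous (sbe 0%N)).
have [cdal cdbe] := (D1_continuous (sdal 0%N), D1_continuous (sdbe 0%N)).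
have pdal x : 'D_1 al (x + L) = 'D_1 al x.
  have : is_derive x (1 : R) al ('D_1 al (x + L)).
    have := @is_derive_shift al (- L) x sal; rewrite opprK; congr is_derive.
    by apply/funext => u; rewrite pal.
  by move=> H; exact/esym/(@derive_val _ _ _ _ _ _ _ H).
have [C1 C10 hC1] := continuous_per_bounded L_gt0 cal pal.
have [C2 C20 hC2] := continuous_per_bounded L_gt0 cdal pdal.
have [C3 C30 hC3] := continuous_supp_bounded cbe (fun y hy => (sube y hy).1).
have [C4 C40 hC4] := continuous_supp_bounded cdbe (fun y hy => (sube y hy).2).
have tst r : 0 <= r <= h -> test_function L a b (fun z => tensor al be (z - r *: e)).
  move=> /andP[r0 rh]; split.
  - have -> : (fun z => tensor al be (z - r *: e)) =
      tensor (fun x => al (x - r * e.1)) (fun y => be (y - r * e.2)) by [].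
    by apply: smooth_tensor; exact: smooth1_shift.
  - by move=> x y; rewrite /tensor /= addrAC pal.
  - exists c, (d + h * e.2); split => // x y /negP hy.
    rewrite /tensor /= (sube _ _).1 ?mulr0//; apply/negP => /andP[y1 y2]; apply: hy.
    move: y1 y2; case: he => -> /=; rewrite /GRing.scale/= ?mulr0 ?mulr1 ?addr0 ?subr0 => y1 y2.
      by rewrite !ltW.
    by apply/andP; split; lra.
case: he => ?; subst e.
- exists (tensor ('D_1 al) be); split => //.
  + move=> w z.
    have -> : (fun z => tensor al be (z - w)) =
      tensor (fun x => al (x - w.1)) (fun y => be (y - w.2)) by [].
    have H := @is_derive_tensor_x R (fun x => al (x - w.1)) (fun y => be (y - w.2)) z _
       (is_derive_shift w.1 z.1 sal).
    by rewrite derive_val.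
  + by move=> z hz; rewrite /tensor (sube _ hz).1 mulr0.
  + split; first exact: measurable_tensor.
    by move=> z; rewrite /tensor /= pdal addr0.
  + by exists (C2 * C3) => z; rewrite /tensor normrM ler_pM.
  + split => // z.
    rewrite (_ : (fun r => _) = (fun r => ('D_1 al (z.1 - r) * be z.2)%:E)); last first.
      apply/funext => r; rewrite /tensor /= /GRing.scale/= mulr1 mulr0 subr0//.
    have dp (r : R) : is_derive r (1 : R) (fun r => - al (z.1 - r) * be z.2) ('D_1 al (z.1 - r) * be z.2).
      have H := is_derive_reflect z.1 r sal.
      have H2 := is_deriveN H; rewrite opprK in H2.
      have := is_deriveM H2 (is_derive_cst (be z.2) r 1).
      move=> H3; apply: (is_derive_eq H3).
      by rewrite /GRing.scale/= mulr0 add0r mulrC.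
    have cp : continuous (fun r => 'D_1 al (z.1 - r) * be z.2).
      move=> r; apply: cvgM; last exact: cvg_cst.
      apply: (@continuous_comp _ _ _ (fun r => z.1 - r) ('D_1 al)); last exact: cdal.
      by apply: cvgB; [exact: cvg_cst|exact: cvg_id].
    rewrite (Rintegral_deriv h0 dp cp); congr EFin.
    by rewrite /tensor /= /GRing.scale/= mulr1 mulr0 !subr0; ring.
- exists (tensor al ('D_1 be)); split => //.
  + move=> w z.
    have -> : (fun z => tensor al be (z - w)) =
      tensor (fun x => al (x - w.1)) (fun y => be (y - w.2)) by [].
    have H := @is_derive_tensor_y R (fun x => al (x - w.1)) (fun y => be (y - w.2)) z _
       (is_derive_shift w.2 z.2 sbe).
    by rewrite derive_val.
  + by move=> z hz; rewrite /tensor (sube _ hz).2 mulr0.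
  + split; first exact: measurable_tensor.
    by move=> z; rewrite /tensor /= pal addr0.
  + by exists (C1 * C4) => z; rewrite /tensor normrM ler_pM.
  + split => // z.
    rewrite (_ : (fun r => _) = (fun r => (al z.1 * 'D_1 be (z.2 - r))%:E)); last first.
      by apply/funext => r; rewrite /tensor /= /GRing.scale/= mulr1 mulr0 subr0.
    have dp (r : R) : is_derive r (1 : R) (fun r => al z.1 * - be (z.2 - r)) (al z.1 * 'D_1 be (z.2 - r)).
      have H := is_derive_reflect z.2 r sbe.
      have H2 := is_deriveN H; rewrite opprK in H2.
      have := is_deriveM (is_derive_cst (al z.1) r 1) H2.
      move=> H3; apply: (is_derive_eq H3).
      by rewrite /GRing.scale/= mulr0 addr0.
    have cp : continuous (fun r => al z.1 * 'D_1 be (z.2 - r)).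
      move=> r; apply: cvgM; first exact: cvg_cst.
      apply: (@continuous_comp _ _ _ (fun r => z.2 - r) ('D_1 be)); last exact: cdbe.
      by apply: cvgB; [exact: cvg_cst|exact: cvg_id].
    rewrite (Rintegral_deriv h0 dp cp); congr EFin.
    by rewrite /tensor /= /GRing.scale/= mulr1 mulr0 !subr0; ring.
Qed.

(** Turns the real-valued defining identity on the channel into one between extended-real integrals
    over the cylinder. Both sides are finite because the extensions are integrable and the tests
    bounded, so [fine] can be undone. *)
Lemma weak_deriv_pext (a b c d : R) (e : R * R) f g phi dphi :
  is_weak_deriv L a b e f g -> a < c -> d < b -> test_function L a b phi ->
  (forall z, 'D_e phi z = dphi z) ->
  measurable_fun setT dphi -> (exists C, forall z, `|dphi z| <= C) ->
  measurable_fun setT phi -> (exists C, forall z, `|phi z| <= C) ->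
  (forall z, ~~ (c < z.2 < d) -> phi z = 0 /\ dphi z = 0) ->
  (\int[mu]_(z in cyl L) (pext L c d f z * dphi z)%:E =
   - \int[mu]_(z in cyl L) (pext L c d g z * phi z)%:E)%E.
Proof.
move=> [lf lg H] ac db tphi Dphi mdphi [C1 hC1] mphi [C2 hC2] sup.
have [mF iF] := loc_integrable_pext lf ac db.
have [mG iG] := loc_integrable_pext lg ac db.
have := H phi tphi; under eq_Rintegral do rewrite Dphi.
have E k kphi : (forall z, ~~ (c < z.2 < d) -> kphi z = 0) ->
    \int[mu]_(z in channel L a b) (k z * kphi z) = fine (\int[mu]_(z in cyl L) (pext L c d k z * kphi z)%:E)%E.
  move=> k0; rewrite /Rintegral; congr fine.
  rewrite [LHS]integral_mkcond [RHS]integral_mkcond; apply: eq_integral => -[x y] _.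
  rewrite !patchE /cyl /channel !in_setX in_setT andbT !mem_itv_set.
  case: (boolP (x \in `[0, L[)) => //= xL; rewrite (pextE L_gt0) /= (wrap_id L_gt0 xL) in_itv/=.
  have [/andP[cy yd]|hy] := boolP (c < y < d).
    by rewrite (lt_trans ac cy) (lt_trans yd db).
  by rewrite (k0 (x, y) hy) !mulr0; case: ifP.
rewrite E; last by move=> z /sup[].
rewrite E; last by move=> z /sup[].
have i1 := integrable_cylM mF iF mdphi hC1.
have i2 := integrable_cylM mG iG mphi hC2.
have f1 : (\int[mu]_(z in cyl L) (pext L c d f z * dphi z)%:E)%E \is a fin_num.
  by apply: integrable_fin_num i1; exact: measurable_cyl.
have f2 : (\int[mu]_(z in cyl L) (pext L c d g z * phi z)%:E)%E \is a fin_num.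
  by apply: integrable_fin_num i2; exact: measurable_cyl.
by move=> HH; rewrite -(fineK f1) -(fineK f2) HH.
Qed.

(** Testing against psi(z - r e) and integrating over r in [0, h] gives a difference of psi on the
    side of f and, after exchanging integrals, [lint e h] of g on the other. A translation moves the
    difference from psi to f. The resulting identity holds for all product bumps, which separate
    functions. *)
Theorem weak_deriv_difference (a b c d h : R) (e : R * R) f g : e = ex \/ e = ey ->
  is_weak_deriv L a b e f g -> a < c -> d < b -> 0 < h ->
  {ae mu, forall z : R * R, c < z.2 -> z.2 + h * e.2 < d ->
    pext L c d f (z + h *: e) - pext L c d f z = lint e h (pext L c d g) z}.
Proof.
move=> he wfg ac db h0; have [lf lg _] := wfg.
set F := pext L c d f; set G := pext L c d g.
have [mF iF] := loc_integrable_pext lf ac db.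
have [mG iG] := loc_integrable_pext lg ac db.
have pF : xper L F := xper_pext L_gt0 c d f.
have pG : xper L G := xper_pext L_gt0 c d g.
have mcyl : measurable (cyl L) := measurable_cyl L.
pose F' (z : R * R) := F (z + h *: e).
have mF' : measurable_fun setT F' by apply: (measurableT_comp mF); exact: measurable_shift2.
have iF' : (\int[mu]_(z in cyl L) `|F' z|%:E < +oo)%E.
  rewrite (@ge0_integral_cyl_shift R L L_gt0 (fun z => `|F z|%:E) (h *: e))//.
  - by apply/measurable_EFinP; exact: measurableT_comp.
  - by move=> z; rewrite pF.
have mI : measurable_fun setT (lint e h G) by exact: measurable_lint.
have iI : (\int[mu]_(z in cyl L) `|lint e h G z|%:E < +oo)%E.
  apply: le_lt_trans (integral_cyl_lint_lty e (ltW h0) mG pG iG).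
  apply: ae_ge0_le_integral => //.
  - by apply/measurable_funTS/measurable_EFinP; exact: measurableT_comp.
  - by move=> z _; exact: integral_ge0.
  - apply: measurable_funTS; apply: (@measurable_ge0_lint _ _ _ (fun z => `|G z|%:E)) => //.
    by apply/measurable_EFinP; exact: measurableT_comp.
  - have := ae_lint_integrable e (ltW h0) mG pG iG; apply: filterS => z + cz => /(_ cz) iz.
    rewrite /lint EFin_normr_Rintegral//; exact: le_abse_integral (measurable_int _ iz).
(* The defect of the claimed identity; it is shown to integrate to 0 against every bump. *)
pose k z := F' z - F z - lint e h G z.
have mk : measurable_fun setT k by apply: measurable_funB => //; exact: measurable_funB.
have int1 (u : R * R -> R) : measurable_fun setT u -> (\int[mu]_(z in cyl L) `|u z|%:E < +oo)%E ->
    mu.-integrable (cyl L) (EFin \o u).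
  by move=> mu' iu; apply/integrableP; split => //; exact/measurable_funTS/measurable_EFinP.
have ik : (\int[mu]_(z in cyl L) `|k z|%:E < +oo)%E.
  have H : mu.-integrable (cyl L) ((EFin \o F') \- (EFin \o F) \- (EFin \o lint e h G))%E.
    by apply: integrableB => //; [apply: integrableB => //|]; exact: int1.
  by case/integrableP : H => _.
(* The bumps live in the period cell and in the strip of those z whose segment up to z + h e stays
   below d. *)
suff H : {ae mu, forall z, cyl L z -> c < z.2 < d - h * e.2 -> k z = 0}.
  have {}H : {ae mu, forall z, c < z.2 < d - h * e.2 -> k z = 0}.
    apply: (ae_xper L_gt0); last first.
      by apply: filterS H => z H cz; exact: H.
    move=> z; rewrite /= addr0 (_ : k (z + (L, 0)) = k z)// /k /F'.
    congr (_ - _ - _); [by rewrite addrAC pF|by rewrite pF|].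
    by apply: eq_Rintegral => s _; rewrite addrAC pG.
  apply: filterS H => z H cz zd; apply/eqP; rewrite -subr_eq0; apply/eqP/H.
  by rewrite cz/= ltrBrDr.
apply: (ae_eq0_tests L_gt0 mk ik) => s t c' d' n s0 st tL cc' cd' dd'.
set al := bumpx L s t n; set be := bumpy c' d' n.
have sal : smooth1 al by exact: smooth1_bumpx.
have sbe : smooth1 be by exact: smooth1_bumpy.
have pal x : al (x + L) = al x by exact: bumpx_per.
have sube y : ~~ (c' < y < d') -> be y = 0 /\ 'D_1 be y = 0.
  by move=> hy; split; [exact: bumpy_supp|exact: deriv_bumpy_supp].
have ac' : a < c' by exact: lt_le_trans cc'.
have dhb : d' + h * e.2 < b by lra.
have [psi' [Dpsi psi0 [mpsi' ppsi'] [C' bpsi'] [ftc tst]]] :=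
  tensor_test he sal sbe pal sube h0 ac' dhb.
pose psi := tensor al be.
have mpsi : measurable_fun setT psi.
  by apply: measurable_tensor; [exact: (D1_continuous (sal 0%N))|exact: (D1_continuous (sbe 0%N))].
have ppsi : xper L psi by move=> z; rewrite /psi /tensor /= pal addr0.
have bpsi z : `|psi z| <= 1.
  rewrite /psi /tensor normrM !ger0_norm ?flat_ge0//.
  by rewrite mulr_ile1 ?flat_ge0 ?flat_le1.
have W r : 0 <= r <= h -> (\int[mu]_(z in cyl L) (F z * psi' (z - r *: e))%:E =
    - \int[mu]_(z in cyl L) (G z * psi (z - r *: e))%:E)%E.
  move=> hr; apply: (weak_deriv_pext wfg ac db (tst r hr)) => //.
  - by apply: (measurableT_comp mpsi'); exact: measurable_shift2.
  - by exists C' => z.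
  - by apply: (measurableT_comp mpsi); exact: measurable_shift2.
  - by exists 1 => z.
  - move=> z /negP hz.
    have hz' : ~~ (c' < (z - r *: e).2 < d').
      apply/negP => /andP[] /=; move: dd' hr hz; case: he => -> /=.
        by rewrite /GRing.scale/= !mulr0 !subr0 => dd' hr hz y1 y2; apply: hz; apply/andP; split; lra.
      rewrite /GRing.scale/= !mulr1 => dd' /andP[r0 rh] hz y1 y2; apply: hz; apply/andP; split; lra.
    by split; [rewrite /tensor (sube _ hz').1 mulr0|exact: psi0].
(* Along each segment the r-integral of the derivative of psi telescopes; Fubini is justified by the
   boundedness of psi' and the integrability of F. *)
have FT : (\int[lam]_(r in `[0%R, h]) \int[mu]_(z in cyl L) (F z * psi' (z - r *: e))%:E =
    \int[mu]_(z in cyl L) (F z * (psi z - psi (z - h *: e)))%:E)%E.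
  have mH : measurable_fun setT (fun zs : (R * R) * R => F zs.1 * psi' (zs.1 - zs.2 *: e)).
    apply: measurable_funM; first exact: (measurableT_comp mF).
    apply: (measurableT_comp mpsi').
    have := measurable_shift_line (- e); apply: eq_measurable_fun => zs _.
    by rewrite scalerN.
  rewrite -(@fubini_in _ _ (measurableTypeR R * measurableTypeR R)%type (measurableTypeR R) R
    (leb2_sigma_finite R) lam (cyl L) `[0%R, h]%classic _ mcyl (measurable_itv _) mH).
    apply: eq_integral => z _ /=.
    rewrite EFinM -[X in (_ * X)%E]ftc -integralZl//.
    apply: (@bounded_itv_integrable _ (fun r => psi' (z - r *: e)) h C') => //.
    apply: (measurableT_comp mpsi').
    by have := measurable_line (- e) z; apply: eq_measurable_fun => r _; rewrite scalerN.
  have C'0 : 0 <= C' by exact: le_trans (bpsi' (0, 0)).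
  apply: (@le_lt_trans _ _ (\int[mu]_(z in cyl L) ((C' * h)%:E * `|F z|%:E))%E); last first.
    rewrite ge0_integralZl//; last 2 first.
    - by apply/measurable_funTS/measurable_EFinP; exact: measurableT_comp.
    - by rewrite lee_fin mulr_ge0// ltW.
    by rewrite lte_mul_pinfty// lee_fin mulr_ge0// ltW.
  apply: ge0_le_integral => //.
  - by move=> z _; exact: integral_ge0.
  - apply: measurable_funTS.
    apply: (@measurable_int_in _ _ (measurableTypeR R * measurableTypeR R)%type (measurableTypeR R) R
      lam `[0%R, h]%classic (fun zs => `|F zs.1 * psi' (zs.1 - zs.2 *: e)|%:E)) => //.
    by apply/measurable_EFinP; exact: measurableT_comp.
  - apply/measurable_funTS/measurable_EFinP; apply: measurable_funM => //; exact: measurableT_comp.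
  - move=> z _; apply: (@le_trans _ _ (\int[lam]_(s in `[0%R, h]) (C' * `|F z|)%:E)%E).
      apply: ge0_le_integral => //.
      + apply/measurable_funTS/measurable_EFinP; apply: measurableT_comp => //.
        have mz : measurable_fun setT (fun s : R => F z * psi' (z - s *: e)).
          apply: measurable_funM; first exact: measurable_cst.
          apply: (measurableT_comp mpsi').
          by have := measurable_line (- e) z; apply: eq_measurable_fun => r _; rewrite scalerN.
        exact: mz.
      + by move=> s' _; rewrite lee_fin normrM mulrC ler_wpM2r.
    rewrite (_ : (\int[lam]_(s in _) _ = (C' * `|F z|)%:E * lam `[0%R, h])%E); last exact: integral_cst.
    rewrite lebesgue_measure_itv/= lte_fin h0 sube0 -!EFinM lee_fin.
    by rewrite le_eqVlt; apply/orP; left; apply/eqP; ring.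
have GT := integral_cyl_lint_signed e (ltW h0) mG pG iG mpsi ppsi bpsi.
have I12 : (\int[mu]_(z in cyl L) (F z * (psi z - psi (z - h *: e)))%:E =
    - \int[mu]_(z in cyl L) (lint e h G z * psi z)%:E)%E.
  rewrite -FT -GT.
  transitivity (\int[lam]_(r in `[0%R, h]) (- \int[mu]_(z in cyl L) (G z * psi (z - r *: e))%:E))%E.
    by apply: eq_integral => r; rewrite inE/= in_itv/= => hr; exact: W.
  (* Pulling out the sign requires the inner integral to be integrable in r; it is bounded by the
     L^1 norm of G. *)
  apply: integralN; apply: integrable_add_def; first exact: measurable_itv.
  have mB : measurable_fun setT (fun r : R => \int[mu]_(z in cyl L) (G z * psi (z - r *: e))%:E)%E.
    apply: (@measurable_int_in _ _ (measurableTypeR R) (measurableTypeR R * measurableTypeR R)%type R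
      (leb2_sigma_finite R) (cyl L) (fun sz => (G sz.2 * psi (sz.2 - sz.1 *: e))%:E)) => //.
    apply/measurable_EFinP; apply: measurable_funM; first exact: (measurableT_comp mG).
    apply: (measurableT_comp mpsi).
    have := measurableT_comp (measurable_shift_line (- e)) (@measurable_swap _ _ (measurableTypeR R) (measurableTypeR R * measurableTypeR R)%type).
    by apply: eq_measurable_fun => sz _; rewrite /= scalerN.
  have ic : lam.-integrable `[0, h] (EFin \o (cst (fine (\int[mu]_(z in cyl L) `|G z|%:E)%E) : R -> R)).
    by apply: continuous_compact_integrable; [exact: segment_compact|move=> x; exact: cvg_cst].
  apply: le_integrable ic => //; first exact: measurable_funTS.
  move=> r _ /=; rewrite ger0_norm ?fine_ge0 ?integral_ge0//.
  rewrite fineK; last by rewrite ge0_fin_numE ?integral_ge0.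
  have mpr : measurable_fun setT (fun z : R * R => psi (z - r *: e)).
    by apply: (measurableT_comp mpsi); exact: measurable_shift2.
  apply: (le_trans (le_abse_integral _ _ _)) => //.
    by apply/measurable_funTS/measurable_EFinP; exact: measurable_funM.
  apply: ge0_le_integral => //.
  - apply/measurable_funTS; apply: measurableT_comp => //; apply/measurable_EFinP; exact: measurable_funM.
  - by apply/measurable_funTS/measurable_EFinP; exact: measurableT_comp.
  - by move=> z _; rewrite lee_fin normrM ler_piMr.
have Fsh : (\int[mu]_(z in cyl L) (F z * psi (z - h *: e))%:E =
    \int[mu]_(z in cyl L) (F' z * psi z)%:E)%E.
  rewrite -[LHS](@integral_cyl_shift R L L_gt0 (fun z => (F z * psi (z - h *: e))%:E) (h *: e)).
  - by apply: eq_integral => z _; rewrite addrK.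
  - apply/measurable_EFinP; apply: measurable_funM => //.
    by apply: (measurableT_comp mpsi); exact: measurable_shift2.
  - by move=> z; rewrite pF addrAC ppsi.
have j1 := integrable_cylM mF' iF' mpsi bpsi.
have j2 := integrable_cylM mF iF mpsi bpsi.
have j3 := integrable_cylM mI iI mpsi bpsi.
have mpsih : measurable_fun setT (fun z : R * R => psi (z - h *: e)).
  by apply: (measurableT_comp mpsi); exact: measurable_shift2.
have j4 := integrable_cylM mF iF mpsih (fun z => bpsi (z - h *: e)).
have E1 : (\int[mu]_(z in cyl L) (F z * (psi z - psi (z - h *: e)))%:E =
   \int[mu]_(z in cyl L) (F z * psi z)%:E - \int[mu]_(z in cyl L) (F z * psi (z - h *: e))%:E)%E.
  rewrite -[RHS]integralB; [|exact: mcyl|exact: j2|exact: j4].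
  by apply: eq_integral => z _; rewrite -EFinB mulrBr.
have -> : (\int[mu]_(z in cyl L) (k z * psi z)%:E =
   \int[mu]_(z in cyl L) (F' z * psi z)%:E - \int[mu]_(z in cyl L) (F z * psi z)%:E
     - \int[mu]_(z in cyl L) (lint e h G z * psi z)%:E)%E.
  have j12 : mu.-integrable (cyl L) (fun z => (F' z * psi z)%:E - (F z * psi z)%:E)%E.
    by apply: integrableB; [exact: mcyl|exact: j1|exact: j2].
  have -> : (\int[mu]_(z in cyl L) (F' z * psi z)%:E - \int[mu]_(z in cyl L) (F z * psi z)%:E =
      \int[mu]_(z in cyl L) ((F' z * psi z)%:E - (F z * psi z)%:E))%E.
    by apply/esym; apply: integralB; [exact: mcyl|exact: j1|exact: j2].
  apply/esym; rewrite -[LHS]integralB; [|exact: mcyl|exact: j12|exact: j3].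
  by apply: eq_integral => z _; rewrite /k -!EFinB !mulrBl.
move: I12; rewrite E1 Fsh.
have f1 : (\int[mu]_(z in cyl L) (F' z * psi z)%:E)%E \is a fin_num by apply: integrable_fin_num j1.
have f2 : (\int[mu]_(z in cyl L) (F z * psi z)%:E)%E \is a fin_num by apply: integrable_fin_num j2.
have f3 : (\int[mu]_(z in cyl L) (lint e h G z * psi z)%:E)%E \is a fin_num by apply: integrable_fin_num j3.
rewrite -(fineK f1) -(fineK f2) -(fineK f3) -!EFinB -EFinN => -[H].
by congr EFin; apply/eqP; rewrite subr_eq0; apply/eqP; rewrite -[RHS]opprK -H opprB.
Qed.

End weak_to_difference.

(** * Difference quotients on the channel and their limits *)

Section difference_quotients.
Context {R : realType} (L a b : R).
Hypothesis L_gt0 : 0 < L.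
Notation lam := (@lebesgue_measure R).
Notation mu := (leb2 R).

(* The only consequence of weak differentiability that is used below: [f] is a
   primitive of [g] along almost every line of direction [e]. *)
Definition diffq (e : R * R) (f g : R * R -> R) := forall h, 0 < h ->
  {ae mu, forall z : R * R, a < z.2 -> z.2 + h * e.2 < b -> f (z + h *: e) - f z = lint e h g z}.

Lemma pext_sub c d f (z : R * R) : a <= c -> d <= b -> c < z.2 < d ->
  pext L c d f z = pext L a b f z.
Proof.
move=> ac db /andP[cz zd]; rewrite !(pextE L_gt0) cz zd.
by rewrite (le_lt_trans ac cz) (lt_le_trans zd db).
Qed.

(** The open channel is exhausted by the strips ]a + 1/(n+1), b - 1/(n+1)[. Any segment inside the
    channel lies in one of them, where the two extensions agree. *)
Lemma weak_deriv_diffq e f g : e = ex \/ e = ey -> is_weak_deriv L a b e f g ->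
  diffq e (pext L a b f) (pext L a b g).
Proof.
move=> he wfg h h0.
have e20 : 0 <= e.2 by case: he => -> /=.
have H n := weak_deriv_difference L_gt0 (c := a + n.+1%:R^-1) (d := b - n.+1%:R^-1) he wfg
  (ltac:(by rewrite ltrDl invr_gt0)) (ltac:(by rewrite ltrBlDr ltrDl invr_gt0)) h0.
have {H} : {ae mu, forall z : R * R, forall n, a + n.+1%:R^-1 < z.2 -> z.2 + h * e.2 < b - n.+1%:R^-1 ->
    pext L (a + n.+1%:R^-1) (b - n.+1%:R^-1) f (z + h *: e) - pext L (a + n.+1%:R^-1) (b - n.+1%:R^-1) f z
    = lint e h (pext L (a + n.+1%:R^-1) (b - n.+1%:R^-1) g) z}.
  by apply/ae_foralln => n; exact: H.
apply: filterS => z Hz az zb.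
have [n [n1 n2]] : exists n : nat, a + n.+1%:R^-1 < z.2 /\ z.2 + h * e.2 < b - n.+1%:R^-1.
  have N1 : \forall n \near \oo, n.+1%:R^-1 < z.2 - a.
    by apply: near_harmonic_lt; rewrite subr_gt0.
  have N2 : \forall n \near \oo, n.+1%:R^-1 < b - (z.2 + h * e.2).
    by apply: near_harmonic_lt; rewrite subr_gt0.
  near \oo => n; exists n; split.
    by rewrite -ltrBrDl; near: n.
  by rewrite ltrBrDr -ltrBrDl; near: n.
have := Hz n n1 n2.
have hn : 0 < n.+1%:R^-1 :> R by rewrite invr_gt0.
have ac : a <= a + n.+1%:R^-1 by rewrite lerDl ltW.
have db : b - n.+1%:R^-1 <= b by rewrite gerBl ltW.
have he0 : 0 <= h * e.2 by rewrite mulr_ge0// ltW.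
rewrite !pext_sub//; last 2 first.
- by rewrite n1/=; apply: le_lt_trans n2; rewrite lerDl.
- by rewrite /= [_ *: _]/(h * e.2) n2 andbT (lt_le_trans n1)// lerDl.
move=> ->; apply: eq_Rintegral => s; rewrite inE/= in_itv/= => /andP[s0 sh].
rewrite pext_sub//= [_ *: _]/(s * e.2); apply/andP; split.
  by rewrite (lt_le_trans n1)// lerDl mulr_ge0.
by apply: le_lt_trans n2; rewrite lerD2l ler_wpM2r.
Unshelve. all: by end_near. Qed.

Lemma lint_reverse e h (g : R * R -> R) (z : R * R) : measurable_fun setT g ->
  lint e h g (z - h *: e) = lint (- e) h g z.
Proof.
move=> mg; rewrite /lint.
have mk : measurable_fun setT (fun s : R => g (z - h *: e + s *: e)).
  exact: (measurableT_comp mg (measurable_line e _)).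
have := @Rintegral_refl R h h (fun s => g (z - h *: e + s *: e)) mk.
rewrite subrr => <-; apply: eq_Rintegral => s _; congr g.
by rewrite scalerBl addrA subrK scalerN.
Qed.

Lemma diffq_backward e f g : measurable_fun setT g -> diffq e f g -> forall h, 0 < h ->
  {ae mu, forall z : R * R, a < z.2 - h * e.2 -> z.2 < b ->
    f z - f (z - h *: e) = lint (- e) h g z}.
Proof.
move=> mg dfg h h0; have := ae_leb2_shift (- (h *: e)) (dfg h h0).
by apply: filterS => z H az zb; rewrite -lint_reverse// -H ?subrK//.
Qed.

(** By [diffq] and its backward form, the quotients are averages of g over segments as soon as these
    fit into the strip; such averages converge almost everywhere. *)
Lemma diffq_cvg e (f g : R * R -> R) : e = ex \/ e = ey ->
  measurable_fun setT g -> xper L g -> (\int[mu]_(z in cyl L) `|g z|%:E < +oo)%E -> diffq e f g ->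
  {ae mu, forall z : R * R, a < z.2 < b ->
    ((fun n : nat => n.+1%:R * (f (z + n.+1%:R^-1 *: e) - f z)) @ \oo --> g z) /\
    ((fun n : nat => n.+1%:R * (f z - f (z - n.+1%:R^-1 *: e))) @ \oo --> g z)}.
Proof.
move=> he mg pg ig dfg.
have e20 : 0 <= e.2 <= 1 by case: he => -> /=; rewrite lexx ler01.
have H1 : {ae mu, forall z : R * R, forall n : nat, a < z.2 -> z.2 + n.+1%:R^-1 * e.2 < b ->
    f (z + n.+1%:R^-1 *: e) - f z = lint e n.+1%:R^-1 g z}.
  by apply/ae_foralln => n; apply: dfg; rewrite invr_gt0.
have H2 : {ae mu, forall z : R * R, forall n : nat, a < z.2 - n.+1%:R^-1 * e.2 -> z.2 < b ->
    f z - f (z - n.+1%:R^-1 *: e) = lint (- e) n.+1%:R^-1 g z}.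
  by apply/ae_foralln => n; apply: diffq_backward => //; rewrite invr_gt0.
have H3 := ae_cvg_lint L_gt0 he mg pg ig.
apply: filterS3 H1 H2 H3 => z h1 h2 [c1 c2] /andP[az zb]; split.
- apply: cvg_trans c1; apply: near_eq_cvg.
  have N1 : \forall n \near \oo, n.+1%:R^-1 < b - z.2.
    by apply: near_harmonic_lt; rewrite subr_gt0.
  apply: filterS N1 => n hn; rewrite h1//.
  rewrite -ltrBrDl; apply: le_lt_trans hn; rewrite ler_piMr ?invr_ge0//.
  by case/andP: e20.
- apply: cvg_trans c2; apply: near_eq_cvg.
  have N1 : \forall n \near \oo, n.+1%:R^-1 < z.2 - a.
    by apply: near_harmonic_lt; rewrite subr_gt0.
  apply: filterS N1 => n hn; rewrite h2//.
  rewrite ltrBrDl -ltrBrDr; apply: le_lt_trans hn; rewrite ler_piMr ?invr_ge0//.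
  by case/andP: e20.
Qed.

(* Fatou's lemma for [g_ n + f_ n >= 0]; [kappa] is the amount by which the
   integrals of [f_ n] stay negative. *)
Lemma fatou_energy (D : set (R * R)) (f_ g_ : nat -> R * R -> R) (f g : R * R -> R) (kappa : \bar R) :
  measurable D ->
  (forall n, measurable_fun setT (f_ n)) -> (forall n, measurable_fun setT (g_ n)) ->
  measurable_fun setT f -> measurable_fun setT g ->
  (forall n, {ae mu, forall z, D z -> `|f_ n z| <= g_ n z}) ->
  {ae mu, forall z, D z -> (f_ ^~ z @ \oo --> f z) /\ (g_ ^~ z @ \oo --> g z)} ->
  (forall z, D z -> 0 <= f z) -> (forall n z, D z -> 0 <= g_ n z) -> (forall z, D z -> 0 <= g z) ->
  (forall n, \int[mu]_(z in D) (g_ n z)%:E <= \int[mu]_(z in D) (g z)%:E)%E ->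
  (\int[mu]_(z in D) (g z)%:E < +oo)%E ->
  (0 <= kappa)%E ->
  (forall n, \int[mu]_(z in D) (f_ n z)%:E <= - kappa)%E ->
  (\int[mu]_(z in D) (f z)%:E = 0)%E /\ (kappa = 0)%E.
Proof.
move=> mD mf_ mg_ mf mg fg cfg f0 g_0 g0 ig gfin k0 ifk.
have mE (u : R * R -> R) : measurable_fun setT u -> measurable_fun D (fun z => (u z)%:E).
  by move=> mu'; exact/measurable_funTS/measurable_EFinP.
have intg n : mu.-integrable D (EFin \o g_ n).
  apply/integrableP; split; first exact: mE.
  apply: le_lt_trans gfin; apply: le_trans (ig n); rewrite le_eqVlt; apply/orP; left; apply/eqP.
  by apply: eq_integral => z; rewrite inE => Dz; rewrite /= ger0_norm// g_0.
have intf n : mu.-integrable D (EFin \o f_ n).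
  apply/integrableP; split; first exact: mE.
  case/integrableP: (intg n) => _; apply: le_lt_trans; apply: ae_ge0_le_integral => //.
  - by apply: measurableT_comp => //; exact: mE.
  - by apply: measurableT_comp => //; exact: mE.
  - apply: filterS (fg n) => z H Dz; rewrite /= lee_fin (ger0_norm (g_0 n z Dz)); exact: H.
(* Fatou's lemma is applied to functions nonnegative everywhere, whereas |f_n| <= g_n holds only
   almost everywhere; the maximum bridges the gap. *)
pose p n z := (Num.max 0 (g_ n z + f_ n z))%:E.
have mp n : measurable_fun D (p n).
  apply: mE; apply: measurable_maxr; first exact: measurable_cst.
  exact: measurable_funD.
have p0 n z : D z -> (0 <= p n z)%E by move=> _; rewrite lee_fin le_max lexx.
have Fat := fatou mu mD mp p0.
have L1 : (\int[mu]_(z in D) limn_einf (p ^~ z) = \int[mu]_(z in D) (g z + f z)%:E)%E.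
  apply: ae_eq_integral => //.
  - rewrite (_ : (fun z => limn_einf _) = (fun z => - limn_esup (fun n => - p n z))%E)//.
    apply: measurableT_comp; first exact: oppe_measurable.
    by apply: measurable_fun_limn_esup => n; apply: measurableT_comp (mp n); exact: oppe_measurable.
  - by apply: mE; exact: measurable_funD.
  - apply: filterS cfg => z H Dz; have [cf cg] := H Dz.
    have c : (p ^~ z) @ \oo --> (g z + f z)%:E.
      apply: cvg_EFin; first exact: nearW.
      rewrite (_ : g z + f z = Num.max 0 (g z + f z)); last first.
        by apply/esym/max_idPr; rewrite addr_ge0// ?g0 ?f0.
      have /= cs : (fun n => (g_ n z + f_ n z + `|g_ n z + f_ n z|) / 2) @ \oo -->
          (g z + f z + `|g z + f z|) / 2.
        by apply: cvgMl; apply: cvgD; [exact: cvgD|apply: cvg_norm; exact: cvgD].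
      have maxE (t : R) : Num.max 0 t = (t + `|t|) / 2.
        by case: (lerP 0 t) => t0; [rewrite ger0_norm//|rewrite ltr0_norm//]; lra.
      rewrite maxE; apply: cvg_trans cs; apply: near_eq_cvg; apply: nearW => n.
      by rewrite /= maxE.
    by rewrite is_cvg_limn_einfE; [exact/cvg_lim|apply/cvg_ex; eexists; exact: c].
have L2 n : (\int[mu]_(z in D) p n z <= \int[mu]_(z in D) (g z)%:E - kappa)%E.
  have -> : (\int[mu]_(z in D) p n z = \int[mu]_(z in D) (g_ n z)%:E + \int[mu]_(z in D) (f_ n z)%:E)%E.
    have -> : (\int[mu]_(z in D) p n z = \int[mu]_(z in D) (g_ n z + f_ n z)%:E)%E; last first.
      by under eq_integral do rewrite EFinD; apply: integralD => //; [exact: intg|exact: intf].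
    apply: ae_eq_integral => //.
    - exact: mp.
    - by apply: mE; exact: measurable_funD.
    - apply: filterS (fg n) => z H Dz; rewrite /p /=; congr EFin; apply/max_idPr.
      have := H Dz; rewrite ler_norml => /andP[]; lra.
  by apply: leeD => //; exact: ig.
have {}Fat : (\int[mu]_(z in D) (g z + f z)%:E <= \int[mu]_(z in D) (g z)%:E - kappa)%E.
  rewrite -L1; apply: le_trans Fat _; rewrite limn_einf_lim.
  apply: lime_le; first exact: is_cvg_einfs.
  apply: nearW => n; apply: le_trans (L2 n); apply: ereal_inf_lbound.
  by exists n => //=.
move: Fat; rewrite (_ : \int[mu]_(z in D) (g z + f z)%:E =
  \int[mu]_(z in D) (g z)%:E + \int[mu]_(z in D) (f z)%:E)%E; last first.
  rewrite -ge0_integralD//.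
  - exact: mE.
  - exact: mE.
have G0 : (0 <= \int[mu]_(z in D) (g z)%:E)%E by apply: integral_ge0 => z Dz; rewrite lee_fin g0.
have F0 : (0 <= \int[mu]_(z in D) (f z)%:E)%E by apply: integral_ge0 => z Dz; rewrite lee_fin f0.
have gf : (\int[mu]_(z in D) (g z)%:E)%E \is a fin_num by rewrite ge0_fin_numE.
(* Cancelling the finite integral of g leaves int f <= - kappa, which forces both nonnegative
   quantities to vanish. *)
rewrite leeD2lE// => H.
have K0 : (- kappa <= 0)%E by rewrite leeNl oppe0.
have E0 : (\int[mu]_(z in D) (f z)%:E = 0)%E.
  by apply/eqP; rewrite eq_le F0 andbT; exact: le_trans K0.
split => //; apply/eqP; rewrite eq_le k0 andbT.
by move: H; rewrite E0 leeNr oppe0.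
Qed.

End difference_quotients.

(** * The energy identity *)

Section truncation.
Context {R : realType}.

Definition sqpos (s : R) : R := Num.max 0 s ^+ 2.

(** A first-order expansion; the remainder is quadratic because the derivative 2 max(0, s) is
    2-Lipschitz. *)
Lemma sqpos_taylor (s t : R) : `|sqpos t - sqpos s - 2 * Num.max 0 s * (t - s)| <= (t - s) ^+ 2.
Proof.
rewrite /sqpos ler_norml; case: (lerP 0 s) => s0; case: (lerP 0 t) => t0.
- by have := sqr_ge0 (t - s) => st; apply/andP; split; nra.
- by have := mulr_ge0_le0 s0 (ltW t0) => st; apply/andP; split; nra.
- by have := mulr_le0_ge0 (ltW s0) t0 => st; apply/andP; split; nra.
- by have := sqr_ge0 (t - s) => st; apply/andP; split; nra.
Qed.

(* [trunc d] is C^1 and nondecreasing and vanishes exactly on [-d, d], so that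
   [trunc d (u2 / u1)] is supported away from the walls. *)
Definition trunc (d s : R) : R := sqpos (s - d) - sqpos (- s - d).
Definition dtrunc (d s : R) : R := 2 * (Num.max 0 (s - d) + Num.max 0 (- s - d)).

Lemma trunc_taylor d s t : `|trunc d t - trunc d s - dtrunc d s * (t - s)| <= 2 * (t - s) ^+ 2.
Proof.
rewrite /trunc /dtrunc; have := sqpos_taylor (s - d) (t - d); have := sqpos_taylor (- s - d) (- t - d).
move: (sqpos _) (sqpos _) (sqpos _) (sqpos _) (Num.max _ _) (Num.max _ _) => a b c e x y.
rewrite !ler_norml => /andP[h1 h2] /andP[h3 h4]; apply/andP; split; nra.
Qed.

Lemma dtrunc_ge0 d s : 0 <= dtrunc d s.
Proof. by rewrite /dtrunc mulr_ge0// addr_ge0// le_max lexx. Qed.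

Lemma dtrunc_le d s S : 0 <= d -> `|s| <= S -> dtrunc d s <= 2 * S.
Proof.
rewrite /dtrunc ler_norml => d0 /andP[s1 s2].
by case: (lerP 0 (s - d)) => ?; case: (lerP 0 (- s - d)) => ?; lra.
Qed.

(** In [trunc_taylor] the linear term contributes 2 S, and the quadratic one 4 S since |t - s| <= 2
    S. *)
Lemma trunc_lipschitz d s t S : 0 <= d -> `|s| <= S -> `|t| <= S ->
  `|trunc d t - trunc d s| <= 6 * S * `|t - s|.
Proof.
move=> d0 sS tS; have := trunc_taylor d s t; have := dtrunc_le d0 sS; have := dtrunc_ge0 d s.
move: (dtrunc _ _) => D D0 DS.
have h : `|t - s| <= 2 * S by rewrite (le_trans (ler_normB _ _))//; lra.
rewrite -(real_normK (num_real (t - s))); move: h (normr_ge0 (t - s)).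
have : `|D * (t - s)| <= 2 * S * `|t - s| by rewrite normrM (ger0_norm D0) ler_wpM2r.
move: (trunc d t - trunc d s) => T; move: (D * _) => E hE h n0 hT.
have hT2 : `|T| <= `|T - E| + `|E| by rewrite -[X in `|X| <= _](subrK E) ler_normD.
have : 2 * `|t - s| ^+ 2 <= 4 * S * `|t - s| by nra.
lra.
Qed.

Lemma trunc_eq0 d s : 0 <= d -> (trunc d s == 0) = (`|s| <= d).
Proof.
rewrite /trunc /sqpos ler_norml => d0; apply/idP/idP => [|/andP[h1 h2]]; last first.
  by rewrite !max_l ?subrr//; lra.
case: (lerP 0 (s - d)) => ?; case: (lerP 0 (- s - d)) => ? /eqP h; apply/andP; split; nra.
Qed.

Lemma measurable_sqpos : measurable_fun setT sqpos.
Proof.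
apply: measurable_funX; apply: measurable_maxr; [exact: measurable_cst|exact: measurable_id].
Qed.

Lemma measurable_trunc d : measurable_fun setT (trunc d).
Proof.
by apply: measurable_funB; apply: (measurableT_comp measurable_sqpos); apply: measurable_funB.
Qed.

Lemma measurable_dtrunc d : measurable_fun setT (dtrunc d).
Proof.
apply: measurable_funM; first exact: measurable_cst.
by apply: measurable_funD; apply: measurable_maxr => //; apply: measurable_funB.
Qed.

(** The chain rule for sequences of difference quotients: by [trunc_taylor] the error is at most
    |c_n (s - s_n)| times 2 |s - s_n|, a convergent factor times one tending to 0. *)
Lemma cvg_trunc d (s_ : nat -> R) (c_ : nat -> R) (s l : R) : s_ @ \oo --> s ->
  (fun n => c_ n * (s - s_ n)) @ \oo --> l ->
  (fun n => c_ n * (trunc d s - trunc d (s_ n))) @ \oo --> dtrunc d s * l.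
Proof.
move=> cs cl; pose r n := trunc d (s_ n) - trunc d s - dtrunc d s * (s_ n - s).
have -> : (fun n => c_ n * (trunc d s - trunc d (s_ n))) =
    (fun n => dtrunc d s * (c_ n * (s - s_ n)) - c_ n * r n).
  by apply/funext => n; rewrite /r; ring.
rewrite -[X in _ --> X]subr0; apply: cvgB; first exact: cvgMr.
have c2 : (fun n => `|c_ n * (s - s_ n)| * (2 * `|s - s_ n|)) @ \oo --> 0.
  rewrite -(mulr0 `|l|); apply: cvgM; first exact: cvg_norm.
  rewrite -(mulr0 2); apply: cvgMr; rewrite -(normr0 R); apply: cvg_norm.
  by rewrite -(subrr s); apply: cvgB => //; exact: cvg_cst.
apply/norm_cvg0P; apply: squeeze_cvgr c2; last exact: cvg_cst.
apply: nearW => n /=; rewrite normr_ge0/= !normrM.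
rewrite -mulrA ler_wpM2l// mulrCA -expr2 real_normK ?num_real//.
by rewrite -sqrrN opprB; exact: trunc_taylor.
Qed.
End truncation.

Section jacobian.
Context {R : realType} (L : R).
Hypothesis L_gt0 : 0 < L.
Notation mu := (leb2 R).

(** By translation invariance the integral of Q(z + s) P(z + t) depends on s - t alone. *)
Lemma integral_cyl_bracket (Q P : R * R -> R) (s t s' t' : R * R) C :
  measurable_fun setT Q -> measurable_fun setT P -> xper L Q -> xper L P ->
  (\int[mu]_(z in cyl L) `|Q z|%:E < +oo)%E -> (forall z, `|P z| <= C) -> s - t = s' - t' ->
  mu.-integrable (cyl L) (fun z : R * R => (Q (z + s) * P (z + t) - Q (z + s') * P (z + t'))%:E) /\
  (\int[mu]_(z in cyl L) (Q (z + s)%R * P (z + t)%R - Q (z + s')%R * P (z + t')%R)%:E = 0)%E.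
Proof.
move=> mQ mP pQ pP iQ PC st.
have ms w (f : R * R -> R) : measurable_fun setT f -> measurable_fun setT (fun z : R * R => f (z + w)).
  by move=> mf; exact: (measurableT_comp mf (measurable_shift2 w)).
have I (u w : R * R) : mu.-integrable (cyl L) (fun z : R * R => (Q (z + u) * P (z + w))%:E).
  apply: (@integrable_cylM _ L (fun z => Q (z + u)) (fun z => P (z + w)) C); [exact: ms| |exact: ms|by []].
  rewrite (@ge0_integral_cyl_shift _ _ L_gt0 (fun z => `|Q z|%:E) u)//.
    by apply/measurable_EFinP; exact: measurableT_comp.
  by move=> z; rewrite pQ.
have E (u w : R * R) : (\int[mu]_(z in cyl L) (Q (z + u)%R * P (z + w)%R)%:E =
    \int[mu]_(z in cyl L) (Q (z + (u - w))%R * P z)%:E)%E.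
  rewrite -(@integral_cyl_shift _ _ L_gt0 (fun z : R * R => (Q (z + (u - w)) * P z)%:E) w).
  - by apply: eq_integral => z _; rewrite -addrA [w + _]addrC subrK.
  - by apply/measurable_EFinP; apply: measurable_funM => //; exact: ms.
  - by move=> z; rewrite pP addrAC pQ.
split; first by under eq_fun do rewrite EFinB; apply: integrableB => //; exact: measurable_cyl.
under eq_integral do rewrite EFinB.
rewrite integralB//=; last exact: measurable_cyl.
rewrite !E st subee// -E; apply: integrable_fin_num; [exact: measurable_cyl|exact: I].
Qed.

(* Discrete counterpart of the identity [\int (d_v Q d_w P - d_w Q d_v P) = 0]:
   with a forward difference on [Q] and a backward one on [P] it is exact. *)
Lemma discrete_jacobian (Q P : R * R -> R) (v w : R * R) C :
  measurable_fun setT Q -> measurable_fun setT P -> xper L Q -> xper L P ->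
  (\int[mu]_(z in cyl L) `|Q z|%:E < +oo)%E -> (forall z, `|P z| <= C) ->
  (\int[mu]_(z in cyl L) ((Q (z + v)%R - Q z) * (P z - P (z - w)%R) -
     (Q (z + w)%R - Q z) * (P z - P (z - v)%R))%:E = 0)%E.
Proof.
move=> mQ mP pQ pP iQ PC.
have B s t s' t' := @integral_cyl_bracket Q P s t s' t' C mQ mP pQ pP iQ PC.
(* Once expanded, the terms Q P cancel and the other six pair up according to the shift differences
   v, w and v + w. *)
have [i1 e1] := B v 0 0 (- v) (ltac:(by rewrite subr0 sub0r opprK)).
have [i2 e2] := B 0 (- w) w 0 (ltac:(by rewrite subr0 sub0r opprK)).
have [i3 e3] := B w (- v) v (- w) (ltac:(by rewrite !opprK addrC)).
have -> : (0 = 0 + 0 + 0 :> \bar R)%E by rewrite !adde0.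
rewrite -{1}e1 -{1}e2 -{1}e3.
rewrite -integralD//=; last exact: measurable_cyl.
rewrite -integralD//=; [|exact: measurable_cyl|by apply: integrableD => //; exact: measurable_cyl].
by apply: eq_integral => z _; rewrite -!EFinD !addr0; congr EFin; ring.
Qed.
End jacobian.

(** N is the inverse step, A and D are differences of Q, B and E differences of P, and the x's and
    y's are horizontal and vertical differences of the two velocity components. Young's inequality
    separates each product into squares, which [dominating_lint] controls. *)
Lemma jacobian_le (R : realDomainType) (N C A B D E x1 x2 y1 y2 : R) : 0 <= N -> 0 <= C ->
  `|B| <= C * (`|y1| + `|y2|) -> `|E| <= C * (`|x1| + `|x2|) ->
  `|N ^+ 2 * (A * B - D * E)| <= C * (((N * A) ^+ 2 + (N * D) ^+ 2) +
    (((N * x1) ^+ 2 + (N * x2) ^+ 2) + ((N * y1) ^+ 2 + (N * y2) ^+ 2))).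
Proof.
move=> N0 C0 hB hE.
have sq (t : R) : (N * t) ^+ 2 = N ^+ 2 * `|t| ^+ 2 by rewrite exprMn real_normK ?num_real.
rewrite normrM (ger0_norm (sqr_ge0 N)) !sq -!mulrDr mulrCA ler_wpM2l ?sqr_ge0//.
rewrite (le_trans (ler_normB _ _))// !normrM.
have h1 : `|A| * `|B| <= `|A| * (C * (`|y1| + `|y2|)) by rewrite ler_wpM2l.
have h2 : `|D| * `|E| <= `|D| * (C * (`|x1| + `|x2|)) by rewrite ler_wpM2l.
apply: (le_trans (lerD h1 h2)).
rewrite mulrCA [`|D| * _]mulrCA -mulrDr.
apply: ler_wpM2l => //.
move: `|A| `|D| `|x1| `|x2| `|y1| `|y2| => u v w x y t.
have := sqr_ge0 (u - y); have := sqr_ge0 (u - t); have := sqr_ge0 (v - w); have := sqr_ge0 (v - x).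
rewrite !sqrrB; have := sqr_ge0 w; have := sqr_ge0 x; have := sqr_ge0 y; have := sqr_ge0 t; nra.
Qed.

(** A first-order quotient is estimated by 1 plus squares, so the same quadratic dominating
    sequences serve again; the constant is harmless on a strip of finite measure. *)
Lemma difference_le (R : realFieldType) (N C s t u : R) : 0 <= N -> 0 <= C ->
  u <= C * (`|s| + `|t|) -> N * u <= C * (1 + ((N * s) ^+ 2 + (N * t) ^+ 2)).
Proof.
move=> N0 C0 h.
have sqn (r : R) : N * `|r| <= 1 / 2 + (N * r) ^+ 2.
  have -> : N * `|r| = `|N * r| by rewrite normrM (ger0_norm N0).
  rewrite -[(N * r) ^+ 2]real_normK ?num_real//; move: `|N * r| => q.
  by have := sqr_ge0 (q - 1 / 2); rewrite sqrrB; have := sqr_ge0 q; nra.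
apply: le_trans (ler_wpM2l N0 h) _; rewrite mulrCA; apply: ler_wpM2l => //.
by rewrite mulrDr; have := sqn s; have := sqn t; lra.
Qed.

Lemma strip_exit (R : realFieldType) (a b eta y B : R) : 0 < eta -> b - a <= B ->
  y <= b - eta -> y - B < a + eta.
Proof. by move=> *; lra. Qed.

Lemma strip_step (R : realFieldType) (a b eta y t : R) : 0 < eta -> a + eta / 2 < y < b - eta / 2 ->
  0 <= t <= eta / 4 -> [/\ a < y, y < b, a < y - t, y + t < b &
    (a + eta / 4 < y < b - eta / 4) && (a + eta / 4 < y + t < b - eta / 4)].
Proof.
move=> e0 /andP[y1 y2] /andP[t0 t1]; split; [lra|lra|lra|lra|].
by apply/andP; split; apply/andP; split; lra.
Qed.

Section dominating.
Context {R : realType} (L : R).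
Hypothesis L_gt0 : 0 < L.
Notation mu := (leb2 R).

(** The requirements of [fatou_energy] on the majorants, packaged so as to be stable under sums,
    nonnegative multiples and shifts of the index. *)
Definition dominating (g_ : nat -> R * R -> R) (g : R * R -> R) :=
  [/\ (forall n, measurable_fun setT (g_ n)) /\ measurable_fun setT g,
      (forall n z, 0 <= g_ n z) /\ (forall z, 0 <= g z),
      forall n, (\int[mu]_(z in cyl L) (g_ n z)%:E <= \int[mu]_(z in cyl L) (g z)%:E)%E,
      (\int[mu]_(z in cyl L) (g z)%:E < +oo)%E &
      {ae mu, forall z, g_ ^~ z @ \oo --> g z}].

Lemma dominatingD f_ f g_ g : dominating f_ f -> dominating g_ g ->
  dominating (fun n z => f_ n z + g_ n z) (fun z => f z + g z).
Proof.
move=> [[mf_ mf] [f_0 f0] fle flt cf] [[mg_ mg] [g_0 g0] gle glt cg].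
have E (u v : R * R -> R) : measurable_fun setT u -> measurable_fun setT v ->
    (forall z, 0 <= u z) -> (forall z, 0 <= v z) ->
    (\int[mu]_(z in cyl L) (u z + v z)%:E = \int[mu]_(z in cyl L) (u z)%:E + \int[mu]_(z in cyl L) (v z)%:E)%E.
  move=> mu' mv u0 v0; under eq_integral do rewrite EFinD.
  apply: ge0_integralD; first exact: measurable_cyl.
  - by move=> z _; rewrite lee_fin.
  - exact/measurable_funTS/measurable_EFinP.
  - by move=> z _; rewrite lee_fin.
  - exact/measurable_funTS/measurable_EFinP.
split.
- by split => [n|]; exact: measurable_funD.
- by split => [n z|z]; rewrite addr_ge0.
- by move=> n; rewrite !E//; exact: leeD.
- by rewrite E// lte_add_pinfty.
- by apply: filterS2 cf cg => z c1 c2; exact: cvgD.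
Qed.

Lemma dominatingZ c g_ g : 0 <= c -> dominating g_ g ->
  dominating (fun n z => c * g_ n z) (fun z => c * g z).
Proof.
move=> c0 [[mg_ mg] [g_0 g0] gle glt cg].
have E (u : R * R -> R) : measurable_fun setT u -> (forall z, 0 <= u z) ->
    (\int[mu]_(z in cyl L) (c * u z)%:E = c%:E * \int[mu]_(z in cyl L) (u z)%:E)%E.
  move=> mu' u0; under eq_integral do rewrite EFinM.
  apply: ge0_integralZl => //; first exact: measurable_cyl.
    exact/measurable_funTS/measurable_EFinP.
  by move=> z _; rewrite lee_fin.
split.
- by split => [n|]; apply: measurable_funM => //; exact: measurable_cst.
- by split => [n z|z]; rewrite mulr_ge0.
- by move=> n; rewrite !E//; exact: lee_wpmul2l.
- by rewrite E// lte_mul_pinfty.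
- by apply: filterS cg => z c1; exact: cvgMr.
Qed.

Lemma dominating_shift N g_ g : dominating g_ g -> dominating (fun n => g_ (n + N)%N) g.
Proof.
move=> [[mg_ mg] [g_0 g0] gle glt cg]; split => //.
apply: filterS cg => z c1; rewrite -(cvg_shiftn N) in c1; exact: c1.
Qed.

(** Both integrability conditions are needed: L^1 for the differentiation of averages, L^2 for the
    dominating sequences. *)
Definition L12 (G : R * R -> R) :=
  [/\ measurable_fun setT G, xper L G,
      (\int[mu]_(z in cyl L) `|G z|%:E < +oo)%E &
      (\int[mu]_(z in cyl L) (G z ^+ 2)%:E < +oo)%E].

Lemma dominating_lint e G : e = ex \/ e = ey -> L12 G ->
  dominating (fun n z => (n.+1%:R * lint e n.+1%:R^-1 G z) ^+ 2) (fun z => G z ^+ 2) /\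
  dominating (fun n z => (n.+1%:R * lint (- e) n.+1%:R^-1 G z) ^+ 2) (fun z => G z ^+ 2).
Proof.
move=> he [mG pG i1 i2].
have cv := ae_cvg_lint L_gt0 he mG pG i1.
split; split => //.
- split => [n|]; apply: measurable_funX => //; apply: measurable_funM; first exact: measurable_cst.
  exact: measurable_lint.
- by split => *; exact: sqr_ge0.
- move=> n; have := @integral_sqr_lint_le R L L_gt0 e n.+1%:R^-1 G (ltac:(by rewrite invr_gt0)) mG pG.
  by rewrite invrK.
- by apply: filterS cv => z [c1 _]; under eq_fun do rewrite expr2; rewrite expr2; exact: cvgM.
- split => [n|]; apply: measurable_funX => //; apply: measurable_funM; first exact: measurable_cst.
  exact: measurable_lint.
- by split => *; exact: sqr_ge0.
- move=> n; have := @integral_sqr_lint_le R L L_gt0 (- e) n.+1%:R^-1 G (ltac:(by rewrite invr_gt0)) mG pG.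
  by rewrite invrK.
- by apply: filterS cv => z [_ c1]; under eq_fun do rewrite expr2; rewrite expr2; exact: cvgM.
Qed.

Lemma dominating_cst (g : R * R -> R) : measurable_fun setT g -> (forall z, 0 <= g z) ->
  (\int[mu]_(z in cyl L) (g z)%:E < +oo)%E -> dominating (fun=> g) g.
Proof.
by move=> mg g0 gfin; split => //; apply: aeW => z; exact: cvg_cst.
Qed.

Lemma strip_measure_lty (c d : R) :
  (\int[mu]_(z in cyl L) (if (c < z.2 < d)%R then 1%R else 0%R)%:E < +oo)%E.
Proof.
have -> : (\int[mu]_(z in cyl L) (if (c < z.2 < d)%R then 1%R else 0%R)%:E =
   \int[mu]_(z in channel L c d) 1)%E.
  rewrite [LHS]integral_mkcond [RHS]integral_mkcond; apply: eq_integral => -[x y] _.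
  rewrite !patchE /cyl /channel !in_setX !mem_itv_set in_setT andbT /=.
  have -> : (y \in `]c, d[) = (c < (y : R) < d) by rewrite in_itv.
  by case: (in_mem x _); case: (c < (y : R) < d).
rewrite integral_cst; last exact: measurable_channel.
rewrite mul1e; apply: (@le_lt_trans _ _ (L%:E * (`|d - c|)%:E)%E).
  rewrite [X in (X <= _)%E]product_measure1E//=.
  rewrite !lebesgue_measure_itv/= lte_fin L_gt0 oppr0 adde0.
  apply: lee_wpmul2l; first by rewrite lee_fin ltW.
  by case: ifP => _; rewrite ?lee_fin// ler_norm.
by rewrite ltry.
Qed.

End dominating.

(** * The energy argument for an extended velocity and pressure *)

Section energy.
Context {R : realType} (L a b k K : R).
Hypotheses (L_gt0 : 0 < L) (k_gt0 : 0 < k).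
Variables (Q U1 U2 G1 G2 U1x U1y U2x U2y : R * R -> R).
Notation mu := (leb2 R).
Hypotheses (mQ : measurable_fun setT Q) (pQ : xper L Q).
Hypotheses (mU1 : measurable_fun setT U1) (pU1 : xper L U1).
Hypotheses (mU2 : measurable_fun setT U2) (pU2 : xper L U2).
Hypothesis iQ : forall c d, a < c -> d < b ->
  (\int[mu]_(z in cyl L) `|if (c < z.2 < d)%R then Q z else 0%R|%:E < +oo)%E.
Hypothesis U1_bounded : forall z, k <= `|U1 z| <= K.
Hypothesis U2_bounded : forall z, `|U2 z| <= K.
Hypotheses (L12G1 : L12 L G1) (L12G2 : L12 L G2).
Hypotheses (L12U1x : L12 L U1x) (L12U1y : L12 L U1y) (L12U2x : L12 L U2x) (L12U2y : L12 L U2y).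
Hypotheses (dQx : diffq a b ex Q G1) (dQy : diffq a b ey Q G2).
Hypotheses (dU1x : diffq a b ex U1 U1x) (dU1y : diffq a b ey U1 U1y).
Hypotheses (dU2x : diffq a b ex U2 U2x) (dU2y : diffq a b ey U2 U2y).
Hypothesis momentum : {ae mu, forall z : R * R, a < z.2 < b ->
  [/\ G1 z = - (U1 z * U1x z + U2 z * U1y z), G2 z = - (U1 z * U2x z + U2 z * U2y z) &
      U1x z + U2y z = 0]}.

Let phi z := U2 z / U1 z.
Let S := K / k.

Let U1_neq0 z : U1 z != 0.
Proof. by rewrite -normr_gt0 (lt_le_trans k_gt0)//; case/andP: (U1_bounded z). Qed.

Let K_gt0 : 0 < K.
Proof. by case/andP: (U1_bounded (0, 0)) => h1 h2; rewrite (lt_le_trans k_gt0)// (le_trans h1). Qed.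

Let normV z : `|U1 z|^-1 <= k^-1.
Proof. by rewrite lef_pV2 ?posrE ?normr_gt0//; case/andP: (U1_bounded z). Qed.

Let phi_bounded z : `|phi z| <= S.
Proof. by rewrite /phi normrM normfV ler_pM ?invr_ge0. Qed.

Let phi_diff z w : `|phi z - phi w| <= K / k ^+ 2 * (`|U1 z - U1 w| + `|U2 z - U2 w|).
Proof.
have -> : phi z - phi w = ((U2 z - U2 w) * U1 z - U2 z * (U1 z - U1 w)) * (U1 z)^-1 * (U1 w)^-1.
  by rewrite /phi; field; rewrite !U1_neq0.
rewrite 2!normrM !normfV -exprVn expr2 mulrA mulrAC [leRHS]mulrAC ler_pM ?mulr_ge0 ?invr_ge0//.
rewrite mulrAC ler_pM ?invr_ge0//.
rewrite (le_trans (ler_normB _ _))// !normrM mulrDr addrC lerD//; first exact: ler_wpM2r.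
by rewrite mulrC ler_wpM2r//; case/andP: (U1_bounded z).
Qed.

Let mphi : measurable_fun setT phi.
Proof.
(* The reciprocal of U1 is written as U1 times a real power of U1^2, which is visibly measurable. *)
have -> : phi = fun z => U2 z * (U1 z * (U1 z ^+ 2) `^ (- 1)).
  by apply/funext => z; rewrite /phi powR_inv1 ?sqr_ge0//; field.
apply: measurable_funM => //; apply: measurable_funM => //.
apply: (measurableT_comp (measurable_powR (- 1))).
exact: measurable_funX.
Qed.

(** The Lipschitz constant of [trunc d] on [-S, S] times that of the quotient U2 / U1 in
    [phi_diff]. *)
Let C1 := 6 * S * (K / k ^+ 2).
Let C1_ge0 : 0 <= C1.
Proof. by rewrite /C1 !mulr_ge0 ?invr_ge0 ?exprn_ge0 ?(ltW K_gt0) ?(ltW k_gt0). Qed.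

Section cutoff.
Variables (d eta : R).
Hypotheses (d_ge0 : 0 <= d) (eta_gt0 : 0 < eta).
Hypothesis near_boundary : {ae mu, forall z : R * R, a < z.2 < b ->
  ~~ (a + eta <= z.2 <= b - eta) -> `|phi z| <= d}.

(** The explicit cutoff makes P vanish at every point near or beyond the walls, while almost
    everywhere in the channel it does not change [trunc d (phi z)], which is already 0 there by
    [near_boundary]. *)
Let P (z : R * R) := if a + eta <= z.2 <= b - eta then trunc d (phi z) else 0.

Let pP : xper L P.
Proof. by move=> z; rewrite /P /phi pU1 pU2 /= addr0. Qed.

Let mP : measurable_fun setT P.
Proof.
apply: measurable_fun_ifT => //.
- rewrite (_ : (fun z => _) = (fun z : R * R => (a + eta <= z.2) && (z.2 <= b - eta)))//.
  apply: measurable_and; apply: measurable_fun_ler => //.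
- exact: (measurableT_comp (measurable_trunc d) mphi).
Qed.

Let trunc0 : trunc d 0 = 0.
Proof. by apply/eqP; rewrite trunc_eq0// normr0. Qed.

Let P_bounded z : `|P z| <= 6 * S * S.
Proof.
have S0 : 0 <= S by exact: le_trans (phi_bounded z).
rewrite /P; case: ifP => _; last first.
  by rewrite normr0; exact: mulr_ge0 (mulr_ge0 (ler0n _ 6) S0) S0.
have := @trunc_lipschitz R d 0 (phi z) S d_ge0; rewrite normr0 trunc0 !subr0 => H.
by apply: (le_trans (H S0 (phi_bounded z))); apply: ler_wpM2l (phi_bounded z); exact: mulr_ge0 (ler0n _ 6) S0.
Qed.

Let P_ae : {ae mu, forall z : R * R, a < z.2 < b -> P z = trunc d (phi z)}.
Proof.
apply: filterS near_boundary => z H zs; rewrite /P; case: ifPn => // h.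
by apply/esym/eqP; rewrite trunc_eq0// H.
Qed.

Let P_diff e (U1e U2e : R * R -> R) h : e = ex \/ e = ey -> 0 < h ->
  measurable_fun setT U1e -> measurable_fun setT U2e ->
  diffq a b e U1 U1e -> diffq a b e U2 U2e ->
  {ae mu, forall z : R * R, a < z.2 - h * e.2 -> z.2 < b ->
    `|P z - P (z - h *: e)| <= C1 * (`|lint (- e) h U1e z| + `|lint (- e) h U2e z|)}.
Proof.
move=> he h0 m1 m2 d1 d2.
have e20 : 0 <= e.2 by case: he => -> /=.
have Pe := ae_leb2_shift (- (h *: e)) P_ae.
have B1 := diffq_backward m1 d1 h0; have B2 := diffq_backward m2 d2 h0.
have PP : {ae mu, forall z : R * R, (a < z.2 < b -> P z = trunc d (phi z)) /\
   (a < (z - h *: e).2 < b -> P (z - h *: e) = trunc d (phi (z - h *: e)))}.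
  by apply: filterS2 P_ae Pe => z; split.
apply: filterS3 PP B1 B2 => z [h1 h2] h3 h4 az zb.
have he0 : 0 <= h * e.2 by rewrite mulr_ge0// ltW.
rewrite h1 ?h2 -?h3 -?h4//; last 2 first.
- by rewrite /= [_ *: _]/(h * e.2) az (le_lt_trans _ zb)// gerBl.
- by rewrite zb andbT (lt_le_trans az)// gerBl.
rewrite distrC; apply: le_trans (trunc_lipschitz d_ge0 (phi_bounded z) (phi_bounded _)) _.
rewrite /C1 -[X in _ <= X]mulrA; apply: ler_wpM2l.
  by apply: mulr_ge0 => //; exact: le_trans (phi_bounded z).
by rewrite distrC; exact: phi_diff.
Qed.

(** The limit is T'(phi) times the quotient rule for U2 / U1, computed on backward difference
    quotients. *)
Let P_cvg e (U1e U2e : R * R -> R) : e = ex \/ e = ey -> L12 L U1e -> L12 L U2e ->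
  diffq a b e U1 U1e -> diffq a b e U2 U2e ->
  {ae mu, forall z : R * R, a < z.2 < b ->
    (fun n : nat => n.+1%:R * (P z - P (z - n.+1%:R^-1 *: e))) @ \oo -->
    dtrunc d (phi z) * ((U2e z * U1 z - U2 z * U1e z) / U1 z ^+ 2)}.
Proof.
move=> he [m1 p1 i1 _] [m2 p2 i2 _] d1 d2.
have e20 : 0 <= e.2 <= 1 by case: he => -> /=; rewrite lexx ler01.
have Pe : {ae mu, forall z : R * R, forall n : nat,
    a < (z - n.+1%:R^-1 *: e).2 < b -> P (z - n.+1%:R^-1 *: e) = trunc d (phi (z - n.+1%:R^-1 *: e))}.
  by apply/ae_foralln => n; exact: (ae_leb2_shift (- (n.+1%:R^-1 *: e)) P_ae).
have PP : {ae mu, forall z : R * R, (a < z.2 < b -> P z = trunc d (phi z)) /\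
   forall n : nat,
    a < (z - n.+1%:R^-1 *: e).2 < b -> P (z - n.+1%:R^-1 *: e) = trunc d (phi (z - n.+1%:R^-1 *: e))}.
  by apply: filterS2 P_ae Pe => z; split.
have B1 := diffq_cvg L_gt0 he m1 p1 i1 d1; have B2 := diffq_cvg L_gt0 he m2 p2 i2 d2.
apply: filterS3 PP B1 B2 => z [h1 h2] h3 h4 zs; have [_ c1] := h3 zs; have [_ c2] := h4 zs.
have [az zb] := andP zs.
have n0 : (fun n : nat => n.+1%:R^-1 : R) @ \oo --> (0 : R) := cvg_harmonic.
(* Convergent difference quotients force the translated values themselves to converge, as the step
   tends to 0. *)
have back (u : nat -> R) (w l : R) : (fun n => n.+1%:R * (w - u n)) @ \oo --> l -> u @ \oo --> w.
  move=> cw; have -> : u = fun n => w - n.+1%:R^-1 * (n.+1%:R * (w - u n)).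
    by apply/funext => n; rewrite mulrA mulVf ?mul1r ?subKr// pnatr_eq0.
  rewrite -[X in _ --> X]subr0 -(mul0r l); apply: cvgB; [exact: cvg_cst|exact: cvgM].
have c1' := back _ _ _ c1; have c2' := back _ _ _ c2.
have cphi : (fun n : nat => phi (z - n.+1%:R^-1 *: e)) @ \oo --> phi z.
  by apply: cvgM => //; apply: cvgV.
have dphi : (fun n : nat => n.+1%:R * (phi z - phi (z - n.+1%:R^-1 *: e))) @ \oo -->
    (U2e z * U1 z - U2 z * U1e z) / U1 z ^+ 2.
  have -> : (fun n : nat => n.+1%:R * (phi z - phi (z - n.+1%:R^-1 *: e))) =
    (fun n : nat => (n.+1%:R * (U2 z - U2 (z - n.+1%:R^-1 *: e)) * U1 z -
       U2 z * (n.+1%:R * (U1 z - U1 (z - n.+1%:R^-1 *: e)))) * (U1 z * U1 (z - n.+1%:R^-1 *: e))^-1).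
    by apply/funext => n; rewrite /phi; field; rewrite !U1_neq0.
  apply: cvgM; first by apply: cvgB; [exact: cvgMl|exact: cvgMr].
  by apply: cvgV; [rewrite expf_neq0|rewrite expr2; exact: cvgMr].
have := cvg_trunc (d := d) cphi dphi; apply: cvg_trans; apply: near_eq_cvg.
have N1 : \forall n \near \oo, n.+1%:R^-1 < z.2 - a.
  by apply: near_harmonic_lt; rewrite subr_gt0.
apply: filterS N1 => n hn; rewrite h1// h2//=.
rewrite [_ *: _]/(n.+1%:R^-1 * e.2) (le_lt_trans _ zb) ?andbT.
  rewrite ltrBrDl -ltrBrDr (le_lt_trans _ hn)// ler_piMr ?invr_ge0//.
  by case/andP: e20.
by rewrite gerBl mulr_ge0 ?invr_ge0//; case/andP: e20.
Qed.

(** Three nested margins with steps below eta / 4: P lives at distance at least eta from the walls,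
    its differences vanish outside margin eta / 2 ([P_out]), and Q is only evaluated inside margin
    eta / 4 where they do not ([step]). *)
Let c := a + eta / 2.
Let c' := b - eta / 2.

Let P_out e (h : R) (z : R * R) : e = ex \/ e = ey -> 0 < h < eta / 4 -> ~~ (c < z.2 < c') ->
  P z = 0 /\ P (z - h *: e) = 0.
Proof.
move=> he /andP[h0 h4]; rewrite negb_and -!leNgt /c /c' => zc.
have hb : 0 <= h * e.2 <= h.
  by case: he => -> /=; rewrite ?mulr0 ?mulr1 lexx ltW.
rewrite /P; have -> : (z - h *: e).2 = z.2 - h * e.2 by [].
move: (h * e.2) hb => t /andP[t0 th].
by split; case: ifP => // /andP[]; case/orP: zc; lra.
Qed.

Let step e (h : R) (z : R * R) : e = ex \/ e = ey -> 0 < h < eta / 4 -> c < z.2 < c' ->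
  [/\ a < z.2, z.2 < b, a < z.2 - h * e.2, z.2 + h * e.2 < b &
    (a + eta / 4 < z.2 < b - eta / 4) && (a + eta / 4 < z.2 + h * e.2 < b - eta / 4)].
Proof.
move=> he /andP[h0 h4] zc; apply: strip_step => //.
have e4 : 0 < eta / 4 by rewrite divr_gt0.
case: he => ->; first by rewrite (_ : ex.2 = 0 :> R)// mulr0 lexx ltW.
by rewrite (_ : ey.2 = 1 :> R)// mulr1 !ltW.
Qed.

(** Q is cut off to be integrable on the cylinder, as the exact identity [discrete_jacobian]
    requires. The cut is not seen, since the differences of P vanish wherever those of [Qt] and Q
    differ. *)
Let Qt (z : R * R) := if a + eta / 4 < z.2 < b - eta / 4 then Q z else 0.

Let mstrip x y : measurable_fun setT (fun z : R * R => x < z.2 < y).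
Proof.
by apply: measurable_and; apply: measurable_fun_ltr.
Qed.

Let step_exists : exists N : nat, forall n, 0 < ((n + N).+1%:R^-1 : R) < eta / 4.
Proof.
have [N _ HN] : \forall n \near \oo, n.+1%:R^-1 < eta / 4 by apply: near_harmonic_lt; rewrite divr_gt0.
exists N => n.
by rewrite invr_gt0 ltr0n/=; apply: HN; rewrite /= leq_addl.
Qed.

Let dom0 n (z : R * R) : R := C1 *
  (((n.+1%:R * lint ex n.+1%:R^-1 G1 z) ^+ 2 + (n.+1%:R * lint ey n.+1%:R^-1 G2 z) ^+ 2) +
   (((n.+1%:R * lint (- ex) n.+1%:R^-1 U1x z) ^+ 2 + (n.+1%:R * lint (- ex) n.+1%:R^-1 U2x z) ^+ 2) +
    ((n.+1%:R * lint (- ey) n.+1%:R^-1 U1y z) ^+ 2 + (n.+1%:R * lint (- ey) n.+1%:R^-1 U2y z) ^+ 2))).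

Let dom0_dominating : dominating L dom0 (fun z => C1 *
  ((G1 z ^+ 2 + G2 z ^+ 2) + ((U1x z ^+ 2 + U2x z ^+ 2) + (U1y z ^+ 2 + U2y z ^+ 2)))).
Proof.
have X := dominating_lint L_gt0 (or_introl (erefl (@ex R))).
have Y := dominating_lint L_gt0 (or_intror (erefl (@ey R))).
apply: dominatingZ => //; apply: dominatingD; apply: dominatingD.
- exact: (X _ L12G1).1.
- exact: (Y _ L12G2).1.
- by apply: dominatingD; [exact: (X _ L12U1x).2|exact: (X _ L12U2x).2].
- by apply: dominatingD; [exact: (Y _ L12U1y).2|exact: (Y _ L12U2y).2].
Qed.

Let jac n (z : R * R) : R := n.+1%:R ^+ 2 *
  ((Qt (z + n.+1%:R^-1 *: ex) - Qt z) * (P z - P (z - n.+1%:R^-1 *: ey)) -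
   (Qt (z + n.+1%:R^-1 *: ey) - Qt z) * (P z - P (z - n.+1%:R^-1 *: ex))).

Let integral_jac n : 0 < (n.+1%:R^-1 : R) < eta / 4 -> (\int[mu]_(z in cyl L) (jac n z)%:E = 0)%E.
Proof.
move=> /andP[h0 h4].
have mQt : measurable_fun setT Qt by apply: measurable_fun_ifT.
have iQt : (\int[mu]_(z in cyl L) `|Qt z|%:E < +oo)%E.
  by apply: iQ; rewrite ?ltrBlDr ltrDl divr_gt0.
pose Q' z := n.+1%:R ^+ 2 * Qt z.
have iQ' : (\int[mu]_(z in cyl L) `|Q' z|%:E < +oo)%E.
  rewrite /Q'; under eq_integral do rewrite normrM EFinM.
  rewrite ge0_integralZl//; first by rewrite lte_mul_pinfty.
    exact: measurable_cyl.
  by apply/measurable_funTS/measurable_EFinP; exact: measurableT_comp.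
have mQ' : measurable_fun setT Q' by apply: measurable_funM => //; exact: measurable_cst.
have pQ' : xper L Q' by move=> z; rewrite /Q' /Qt pQ /= addr0.
rewrite -[RHS](discrete_jacobian L_gt0 (n.+1%:R^-1 *: ex) (n.+1%:R^-1 *: ey) mQ' mP pQ' pP iQ' P_bounded).
by apply: eq_integral => z _; rewrite /jac /Q' !mulrBr !mulrBl; congr EFin; ring.
Qed.

Let jac_le n : 0 < (n.+1%:R^-1 : R) < eta / 4 -> {ae mu, forall z, `|jac n z| <= dom0 n z}.
Proof.
move=> hn; have [h0 h4] := andP hn.
have [mG1 _ _ _] := L12G1; have [mG2 _ _ _] := L12G2.
have [m1x _ _ _] := L12U1x; have [m1y _ _ _] := L12U1y.
have [m2x _ _ _] := L12U2x; have [m2y _ _ _] := L12U2y.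
have ax := P_diff (or_introl (erefl ex)) h0 m1x m2x dU1x dU2x.
have ay := P_diff (or_intror (erefl ey)) h0 m1y m2y dU1y dU2y.
have qq : {ae mu, forall z : R * R, c < z.2 < c' ->
   Q (z + n.+1%:R^-1 *: ex) - Q z = lint ex n.+1%:R^-1 G1 z /\
   Q (z + n.+1%:R^-1 *: ey) - Q z = lint ey n.+1%:R^-1 G2 z}.
  apply: filterS2 (dQx h0) (dQy h0) => z h1 h2 zc.
  have [? ? _ ? _] := step (or_introl (erefl ex)) hn zc.
  have [_ _ _ ? _] := step (or_intror (erefl ey)) hn zc.
  by split; [exact: h1|exact: h2].
apply: filterS3 ax ay qq => z hx hy hq.
have [zc|zc] := boolP (c < z.2 < c'); last first.
  have [P1 P2] := P_out (or_introl (erefl ex)) hn zc.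
  have [_ P3] := P_out (or_intror (erefl ey)) hn zc.
  rewrite /jac P1 P2 P3 subrr !mulr0 subrr mulr0 normr0; by have [_ [g0 _] _ _ _] := dom0_dominating; exact: g0.
have [hq1 hq2] := hq zc.
have [_ zb ax0 _ sx] := step (or_introl (erefl ex)) hn zc.
have [_ _ ay0 _ sy] := step (or_intror (erefl ey)) hn zc.
have /andP[Q0 Q1] := sx; have /andP[_ Q2] := sy.
rewrite /jac /Qt Q0 Q1 Q2 hq1 hq2.
by apply: jacobian_le; rewrite ?ler0n//; [exact: hy|exact: hx].
Qed.

Let jac_lim (z : R * R) := if c < z.2 < c' then dtrunc d (phi z) * (G1 z ^+ 2 + G2 z ^+ 2) / U1 z ^+ 2 else 0.

Let cvg_jac (N : nat) : (forall n, 0 < ((n + N).+1%:R^-1 : R) < eta / 4) ->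
  {ae mu, forall z : R * R, (fun n => jac (n + N) z) @ \oo --> jac_lim z}.
Proof.
move=> hN.
have [mG1 pG1 iG1 _] := L12G1; have [mG2 pG2 iG2 _] := L12G2.
have cx := P_cvg (or_introl (erefl ex)) L12U1x L12U2x dU1x dU2x.
have cy := P_cvg (or_intror (erefl ey)) L12U1y L12U2y dU1y dU2y.
have qx := diffq_cvg L_gt0 (or_introl (erefl ex)) mG1 pG1 iG1 dQx.
have qy := diffq_cvg L_gt0 (or_intror (erefl ey)) mG2 pG2 iG2 dQy.
have PP : {ae mu, forall z : R * R, a < z.2 < b ->
    (fun n : nat => n.+1%:R * (P z - P (z - n.+1%:R^-1 *: ex))) @ \oo -->
      dtrunc d (phi z) * ((U2x z * U1 z - U2 z * U1x z) / U1 z ^+ 2) /\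
    (fun n : nat => n.+1%:R * (P z - P (z - n.+1%:R^-1 *: ey))) @ \oo -->
      dtrunc d (phi z) * ((U2y z * U1 z - U2 z * U1y z) / U1 z ^+ 2)}.
  by apply: filterS2 cx cy => z h1 h2 zs; split; [exact: h1|exact: h2].
have QQ : {ae mu, forall z : R * R, a < z.2 < b ->
    (fun n : nat => n.+1%:R * (Q (z + n.+1%:R^-1 *: ex) - Q z)) @ \oo --> G1 z /\
    (fun n : nat => n.+1%:R * (Q (z + n.+1%:R^-1 *: ey) - Q z)) @ \oo --> G2 z}.
  by apply: filterS2 qx qy => z h1 h2 zs; split; [exact: (h1 zs).1|exact: (h2 zs).1].
apply: filterS3 PP QQ momentum => z hP hQ hM; rewrite /jac_lim.
case: ifPn => zc; last first.
  rewrite (_ : (fun n => _) = fun=> 0); first exact: cvg_cst.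
  apply/funext => n; have [P1 P2] := P_out (or_introl (erefl ex)) (hN n) zc.
  have [_ P3] := P_out (or_intror (erefl ey)) (hN n) zc.
  by rewrite /jac P1 P2 P3 subrr !mulr0 subrr mulr0.
have zs : a < z.2 < b.
  by have [? ? _ _ _] := step (or_introl (erefl ex)) (hN 0%N) zc; apply/andP.
have [cPx cPy] := hP zs; have [cQx cQy] := hQ zs; have [e1 e2 e3] := hM zs.
(* Incompressibility turns the momentum equations into G1 = U1^2 d_y phi and G2 = - U1^2 d_x phi, so
   the Jacobian of Q and T(phi) is a nonnegative square. *)
have -> : dtrunc d (phi z) * (G1 z ^+ 2 + G2 z ^+ 2) / U1 z ^+ 2 =
    G1 z * (dtrunc d (phi z) * ((U2y z * U1 z - U2 z * U1y z) / U1 z ^+ 2)) -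
    G2 z * (dtrunc d (phi z) * ((U2x z * U1 z - U2 z * U1x z) / U1 z ^+ 2)).
  have e4 : U1x z = - U2y z by apply/eqP; rewrite -addr_eq0 e3.
  by rewrite e1 e2 e4; field.
have cj : (fun n : nat => n.+1%:R * (Q (z + n.+1%:R^-1 *: ex) - Q z) * (n.+1%:R * (P z - P (z - n.+1%:R^-1 *: ey))) -
     n.+1%:R * (Q (z + n.+1%:R^-1 *: ey) - Q z) * (n.+1%:R * (P z - P (z - n.+1%:R^-1 *: ex)))) @ \oo -->
    G1 z * (dtrunc d (phi z) * ((U2y z * U1 z - U2 z * U1y z) / U1 z ^+ 2)) -
    G2 z * (dtrunc d (phi z) * ((U2x z * U1 z - U2 z * U1x z) / U1 z ^+ 2)).
  by apply: cvgB; apply: cvgM.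
rewrite -(cvg_shiftn N) in cj; apply: cvg_trans cj; apply: near_eq_cvg; apply: nearW => n /=.
have [_ _ _ _ /andP[Q0 Q1]] := step (or_introl (erefl ex)) (hN n) zc.
have [_ _ _ _ /andP[_ Q2]] := step (or_intror (erefl ey)) (hN n) zc.
rewrite /jac /Qt Q0 Q1 Q2; ring.
Qed.

(** Each discrete Jacobian has integral 0, so [fatou_energy] with kappa = 0 annihilates the integral
    of the nonnegative limit. Since G1 = U1^2 d_y phi, this is d_y T(phi) = 0 in disguise. *)
Let energy_zero : {ae mu, forall z : R * R, c < z.2 < c' -> dtrunc d (phi z) * G1 z = 0}.
Proof.
have [N hN] := step_exists.
have D0 := dominating_shift N dom0_dominating.
have [[mg_ mg] [g_0 g0] gle glt cg] := D0.
have ms w (f : R * R -> R) : measurable_fun setT f -> measurable_fun setT (fun z : R * R => f (z + w)).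
  by move=> mf; exact: (measurableT_comp mf (measurable_shift2 w)).
have mQt : measurable_fun setT Qt by apply: measurable_fun_ifT.
have mjac n : measurable_fun setT (jac n).
  apply: measurable_funM; first exact: measurable_cst.
  apply: measurable_funB; apply: measurable_funM; apply: measurable_funB => //; exact: ms.
have mG1 : measurable_fun setT G1 by case: L12G1.
have mG2 : measurable_fun setT G2 by case: L12G2.
have lim0 z : 0 <= jac_lim z.
  by rewrite /jac_lim; case: ifP => // _; rewrite mulr_ge0 ?invr_ge0 ?sqr_ge0// mulr_ge0 ?dtrunc_ge0// addr_ge0 ?sqr_ge0.
have mlim : measurable_fun setT jac_lim.
  have -> : jac_lim = fun z => if c < z.2 < c' then dtrunc d (phi z) * (G1 z ^+ 2 + G2 z ^+ 2) * (U1 z ^+ 2) `^ (- 1) else 0.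
    by apply/funext => z; rewrite /jac_lim powR_inv1 ?sqr_ge0.
  apply: measurable_fun_ifT => //; apply: measurable_funM; last first.
    apply: (measurableT_comp (measurable_powR (- 1))); exact: measurable_funX.
  apply: measurable_funM; first exact: (measurableT_comp (measurable_dtrunc d) mphi).
  by apply: measurable_funD; exact: measurable_funX.
have mc : measurable (cyl L) := measurable_cyl L.
have [] := @fatou_energy R (cyl L) (fun n => jac (n + N)) _ jac_lim _ 0 mc (fun n => mjac _) mg_ mlim mg.
- by move=> n; apply: filterS (jac_le (hN n)) => z h _.
- by apply: filterS2 (cvg_jac hN) cg => z h1 h2 _.
- by move=> z _.
- by move=> n z _.
- by move=> z _.
- exact: gle.
- exact: glt.
- by [].
- by move=> n; rewrite integral_jac// oppe0.
move=> E0 _.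
have pl : xper L (fun z : R * R => jac_lim z = 0).
  have [_ pG1 _ _] := L12G1; have [_ pG2 _ _] := L12G2.
  move=> z; rewrite /jac_lim /phi pU1 pU2 pG1 pG2.
  by have -> : (z + (L, 0)).2 = z.2 by rewrite /= addr0.
have : {ae mu, forall z, jac_lim z = 0}.
  apply: (ae_xper L_gt0 pl).
  have /(ae_eq_integral_abs mu mc) : measurable_fun (cyl L) (fun z => (jac_lim z)%:E).
    exact/measurable_funTS/measurable_EFinP.
  move=> [H _]; have : ae_eq mu (cyl L) (fun z => (jac_lim z)%:E) (cst 0%E).
    apply: H; rewrite -[RHS]E0; apply: eq_integral => z _; by rewrite /= ger0_norm.
  by apply: filterS => z h zc; have [] := h zc.
apply: filterS => z; rewrite /jac_lim => h zc; move: h; rewrite zc.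
move=> /eqP; rewrite mulf_eq0 invr_eq0 expf_eq0/= (negbTE (U1_neq0 z)) orbF mulf_eq0 => /orP[/eqP ->|].
  by rewrite mul0r.
by rewrite paddr_eq0 ?sqr_ge0// !sqrf_eq0 => /andP[/eqP -> _]; rewrite mulr0.
Qed.

Let dist1 n (z : R * R) : R := n.+1%:R * `|P z - P (z - n.+1%:R^-1 *: ey)|.

Let mdist1 n : measurable_fun setT (dist1 n).
Proof.
apply: measurable_funM; first exact: measurable_cst.
apply: measurableT_comp => //; apply: measurable_funB => //.
exact: (measurableT_comp mP (measurable_shift2 _)).
Qed.

Let dom1 n (z : R * R) : R := C1 * ((if c < z.2 < c' then 1 else 0) +
  ((n.+1%:R * lint (- ey) n.+1%:R^-1 U1y z) ^+ 2 + (n.+1%:R * lint (- ey) n.+1%:R^-1 U2y z) ^+ 2)).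

Let dom1_dominating : dominating L dom1
  (fun z => C1 * ((if c < z.2 < c' then 1 else 0) + (U1y z ^+ 2 + U2y z ^+ 2))).
Proof.
have Y := dominating_lint L_gt0 (or_intror (erefl (@ey R))).
apply: dominatingZ => //; apply: dominatingD; last first.
  by apply: dominatingD; [exact: (Y _ L12U1y).2|exact: (Y _ L12U2y).2].
apply: dominating_cst.
- exact: measurable_fun_ifT.
- by move=> z; case: ifP.
- exact: strip_measure_lty.
Qed.

Let dist1_le n : 0 < (n.+1%:R^-1 : R) < eta / 4 -> {ae mu, forall z, dist1 n z <= dom1 n z}.
Proof.
move=> hn; have [h0 h4] := andP hn.
have [m1y _ _ _] := L12U1y; have [m2y _ _ _] := L12U2y.
apply: filterS (P_diff (or_intror (erefl ey)) h0 m1y m2y dU1y dU2y) => z hy.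
have [zc|zc] := boolP (c < z.2 < c'); last first.
  have [P1 P2] := P_out (or_intror (erefl ey)) hn zc.
  rewrite /dist1 P1 P2 subrr normr0 mulr0.
  by have [_ [g0 _] _ _ _] := dom1_dominating; exact: g0.
have [_ zb ay0 _ _] := step (or_intror (erefl ey)) hn zc.
rewrite /dist1 /dom1 zc; have := hy ay0 zb.
exact: difference_le.
Qed.

(** The vertical derivative of T(phi) is T'(phi) G1 / U1^2, which [energy_zero] makes 0. The minus
    sign fits the role of [f_] in [fatou_energy]. *)
Let cvg_dist1 (N : nat) : (forall n, 0 < ((n + N).+1%:R^-1 : R) < eta / 4) ->
  {ae mu, forall z : R * R, (fun n => - dist1 (n + N) z) @ \oo --> 0}.
Proof.
move=> hN.
have cy := P_cvg (or_intror (erefl ey)) L12U1y L12U2y dU1y dU2y.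
apply: filterS3 cy energy_zero momentum => z hP hE hM.
rewrite -oppr0; apply: cvgN.
have [zc|zc] := boolP (c < z.2 < c'); last first.
  rewrite (_ : (fun n => _) = fun=> 0); first exact: cvg_cst.
  apply/funext => n; have [P1 P2] := P_out (or_intror (erefl ey)) (hN n) zc.
  by rewrite /dist1 P1 P2 subrr normr0 mulr0.
have zs : a < z.2 < b.
  by have [? ? _ _ _] := step (or_introl (erefl ex)) (hN 0%N) zc; apply/andP.
have := hP zs; have [e1 e2 e3] := hM zs.
rewrite (_ : dtrunc d (phi z) * _ = 0); last first.
  have e4 : U2y z = - U1x z by apply/eqP; rewrite -addr_eq0 addrC e3.
  have -> : U2y z * U1 z - U2 z * U1y z = G1 z by rewrite e1 e4; ring.
  by rewrite mulrA hE// mul0r.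
move=> cj; 
have {}cj : (fun n : nat => `|n.+1%:R * (P z - P (z - n.+1%:R^-1 *: ey))|) @ \oo --> (0 : R).
  by rewrite -(normr0 R); exact: cvg_norm.
rewrite -(cvg_shiftn N) in cj; apply: cvg_trans cj; apply: near_eq_cvg; apply: nearW => n /=.
by rewrite /dist1 normrM ger0_norm.
Qed.

(** From any point of the support of P, B (n+1) downward steps of length 1/(n+1) leave the strip, as
    B >= b - a. So |P| is at most a sum of that many vertical differences, all with the same
    integral by translation invariance. *)
Let telescope_bound (B n : nat) : b - a <= B%:R ->
  (\int[mu]_(z in cyl L) `|P z|%:E <= B%:R%:E * \int[mu]_(z in cyl L) (dist1 n z)%:E)%E.
Proof.
move=> hB; set h : R := n.+1%:R^-1; pose J := (B * n.+1)%N.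
pose D (z : R * R) := `|P z - P (z - h *: ey)|.
have mD : measurable_fun setT D.
  apply: measurableT_comp => //; apply: measurable_funB => //.
  exact: (measurableT_comp mP (measurable_shift2 _)).
have D0 z : 0 <= D z by exact: normr_ge0.
have pD : xper L D.
  by move=> z; rewrite /D pP addrAC pP.
have mc : measurable (cyl L) := measurable_cyl L.
have PD z : `|P z| <= \sum_(0 <= j < J) D (z + (- (j%:R * h) *: ey)).
  have PJ : P z = 0 \/ P (z - (J%:R * h) *: ey) = 0.
    rewrite /P; case: ifPn => [/andP[z1 z2]|_]; [right|by left].
    rewrite ifF//; apply/negbTE; rewrite negb_and -ltNge; apply/orP; left.
    have -> : (z - (J%:R * h) *: ey).2 = z.2 - B%:R.
      rewrite /J /h natrM mulfK ?pnatr_eq0//=; congr (_ - _).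
      by rewrite [_ *: _]mulr1.
    exact: (strip_exit eta_gt0 hB z2).
  case: PJ => [->|PJ]; first by rewrite normr0 sumr_ge0// => j _; exact: normr_ge0.
  have -> : P z = - \sum_(0 <= j < J) (P (z - (j.+1%:R * h) *: ey) - P (z - (j%:R * h) *: ey)).
    rewrite (telescope_sumr (fun j => P (z - (j%:R * h) *: ey)))//.
    by rewrite PJ mul0r scale0r subr0 sub0r opprK.
  rewrite normrN; apply: le_trans (ler_norm_sum _ _ _) _; apply: ler_sum => j _.
  rewrite distrC /D scaleNr -addrA -opprD -scalerDl -natr1 mulrDl mul1r //.
have E w : (\int[mu]_(z in cyl L) (D (z + w)%R)%:E = \int[mu]_(z in cyl L) (D z)%:E)%E.
  rewrite (@ge0_integral_cyl_shift _ _ L_gt0 (fun z => (D z)%:E))//.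
  - exact/measurable_EFinP.
  - by move=> z; rewrite pD.
apply: (@le_trans _ _ (\int[mu]_(z in cyl L) (\sum_(0 <= j < J) D (z + (- (j%:R * h) *: ey))%R)%:E)%E).
  apply: ge0_le_integral => //.
  - by apply/measurable_funTS/measurable_EFinP; exact: measurableT_comp.
  - apply/measurable_funTS/measurable_EFinP; apply: measurable_sum => j.
    exact: (measurableT_comp mD (measurable_shift2 _)).
  - by move=> z _; rewrite lee_fin.
under eq_integral do rewrite -sumEFin.
rewrite ge0_integral_sum//; last 2 first.
- move=> j; apply/measurable_funTS/measurable_EFinP.
  exact: (measurableT_comp mD (measurable_shift2 _)).
- by move=> j z _; rewrite lee_fin.
under eq_bigr do rewrite E.
have -> : (\int[mu]_(z in cyl L) (dist1 n z)%:E = n.+1%:R%:E * \int[mu]_(z in cyl L) (D z)%:E)%E.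
  under eq_integral do rewrite /dist1 EFinM.
  rewrite ge0_integralZl//.
  exact/measurable_funTS/measurable_EFinP.
rewrite muleA -EFinM -natrM -/J.
by rewrite sumr_const_nat subn0 mule_natl.
Qed.

(** Here f = 0 and f_n is minus the modulus of the vertical quotient, whose integral is at most -
    kappa with kappa = (int |P|) / B by [telescope_bound]. The conclusion kappa = 0 of
    [fatou_energy] is the point. *)
Let P_zero : {ae mu, forall z : R * R, P z = 0}.
Proof.
have [N hN] := step_exists.
have D1 := dominating_shift N dom1_dominating.
have [[mg_ mg] [g_0 g0] gle glt cg] := D1.
have mc : measurable (cyl L) := measurable_cyl L.
have [B [B0 hB]] : exists B : nat, 0 < (B%:R : R) /\ b - a <= B%:R.
  exists (Num.trunc `|b - a|).+1; split; first by rewrite ltr0n.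
  by rewrite (le_trans (ler_norm _))// ltW// truncnS_gt.
pose I := (\int[mu]_(z in cyl L) `|P z|%:E)%E.
have I0 : (0 <= I)%E by apply: integral_ge0 => z _; rewrite lee_fin.
have dist0 n z : 0 <= dist1 n z by rewrite /dist1 mulr_ge0.
have [] := @fatou_energy R (cyl L) (fun n z => - dist1 (n + N) z) _ (cst 0) _ (B%:R^-1%:E * I) mc
   _ mg_ (measurable_cst _) mg.
- by move=> n; exact: measurableT_comp.
- by move=> n; apply: filterS (dist1_le (hN n)) => z h _; rewrite normrN ger0_norm.
- by apply: filterS2 (cvg_dist1 hN) cg => z h1 h2 _.
- by move=> z _.
- by move=> n z _.
- by move=> z _.
- exact: gle.
- exact: glt.
- by rewrite mule_ge0// lee_fin invr_ge0 ltW.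
- move=> n; under eq_integral do rewrite EFinN.
  rewrite integral_ge0N; last by move=> z _; rewrite lee_fin.
  rewrite leeN2 lee_pdivrMl//; exact: telescope_bound.
move=> _ /eqP; rewrite mule_eq0 eqe invr_eq0 (gt_eqF B0)/= => /eqP IE.
have pl : xper L (fun z : R * R => P z = 0) by move=> z; rewrite pP.
apply: (ae_xper L_gt0 pl).
have /(ae_eq_integral_abs mu mc) : measurable_fun (cyl L) (fun z => (P z)%:E).
  exact/measurable_funTS/measurable_EFinP.
move=> [H _]; have : ae_eq mu (cyl L) (fun z => (P z)%:E) (cst 0%E) by exact: H.
by apply: filterS => z h zc; have [] := h zc.
Qed.

Lemma ratio_le_cutoff : {ae mu, forall z : R * R, a < z.2 < b -> `|U2 z / U1 z| <= d}.
Proof.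
apply: filterS2 P_zero P_ae => z h1 h2 zs; rewrite -[_ / _]/(phi z).
by have := h2 zs; rewrite h1 => /esym/eqP; rewrite trunc_eq0.
Qed.

End cutoff.
Lemma cross_velocity_vanishes :
  (forall del, 0 < del -> exists2 eta, 0 < eta & {ae mu, forall z : R * R, a < z.2 < b ->
     ~~ (a + eta <= z.2 <= b - eta) -> `|U2 z| <= del}) ->
  {ae mu, forall z : R * R, a < z.2 < b -> U2 z = 0}.
Proof.
move=> bdry.
have H : {ae mu, forall z : R * R, forall n : nat, a < z.2 < b -> `|phi z| <= n.+1%:R^-1}.
  apply/ae_foralln => n.
  have n0 : 0 < n.+1%:R^-1 :> R by rewrite invr_gt0.
  (* A bound on U2 by k / (n+1) becomes a bound on phi by 1/(n+1), because |U1| >= k. *)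
  have [eta eta0 He] := bdry _ (mulr_gt0 n0 k_gt0).
  apply: (ratio_le_cutoff (ltW n0) eta0); apply: filterS He => z h zs zo.
  rewrite normrM normfV ler_pdivrMr ?normr_gt0//; apply: le_trans (h zs zo) _.
  by rewrite ler_pM2l//; case/andP: (U1_bounded z).
apply: filterS H => z h zs.
have : phi z = 0.
  apply/eqP; rewrite -normr_le0; apply/ler_addgt0Pl => e e0; rewrite addr0.
  have : \forall n \near \oo, n.+1%:R^-1 < e by exact: near_harmonic_lt.
  by move=> [n _ /(_ n (leqnn n)) hn]; apply: le_trans (h n zs) (ltW hn).
by move=> /eqP; rewrite mulf_eq0 invr_eq0 (negbTE (U1_neq0 z)) orbF => /eqP.
Qed.

End energy.

(** * Shear flows from vanishing cross velocity *)

Section rigidity.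
Context {R : realType} (L a b : R).
Hypothesis L_gt0 : 0 < L.
Notation mu := (leb2 R).
Notation lam := (@lebesgue_measure R).

Lemma diffq_zero_deriv e (f g : R * R -> R) : e = ex \/ e = ey ->
  measurable_fun setT g -> xper L g -> (\int[mu]_(z in cyl L) `|g z|%:E < +oo)%E -> diffq a b e f g ->
  {ae mu, forall z : R * R, a < z.2 < b -> f z = 0} ->
  {ae mu, forall z : R * R, a < z.2 < b -> g z = 0}.
Proof.
move=> he mg pg ig dfg f0.
have e20 : 0 <= e.2 <= 1 by case: he => -> /=; rewrite lexx ler01.
have H1 : {ae mu, forall z : R * R, forall n : nat, a < (z + n.+1%:R^-1 *: e).2 < b -> f (z + n.+1%:R^-1 *: e) = 0}.
  by apply/ae_foralln => n; exact: (ae_leb2_shift (n.+1%:R^-1 *: e) f0).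
apply: filterS3 H1 f0 (diffq_cvg L_gt0 he mg pg ig dfg) => z h1 h2 h3 zs.
have [c1 _] := h3 zs; apply/esym; apply: cvg_unique c1 => //.
have [az zb] := andP zs.
have N1 : \forall n \near \oo, n.+1%:R^-1 < b - z.2.
  by apply: near_harmonic_lt; rewrite subr_gt0.
have c0 : (fun=> 0 : R) @ \oo --> (0 : R) by exact: cvg_cst.
change ((fun n : nat => n.+1%:R * (f (z + n.+1%:R^-1 *: e) - f z)) @ \oo --> (0 : R)).
apply: cvg_trans c0; apply: near_eq_cvg; apply: filterS N1 => n hn.
have he2 : 0 <= n.+1%:R^-1 * e.2 < b - z.2.
  case/andP: e20 => e0 e1; rewrite mulr_ge0 ?invr_ge0//=; apply: le_lt_trans hn.
  by rewrite ler_piMr ?invr_ge0.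
rewrite h1 ?h2 ?subr0 ?mulr0//.
rewrite (_ : (z + _).2 = z.2 + n.+1%:R^-1 * e.2)//.
by case/andP: he2 => e0 e1; rewrite (lt_le_trans az) ?lerDl//= -ltrBrDl.
Qed.

(** The L^2 contraction [integral_sqr_lint_le] transfers the vanishing of g to its line integrals
    without choosing good lines; negative shifts follow by translating the positive case. *)
Lemma diffq_ex_const (f g : R * R -> R) : measurable_fun setT g -> xper L g ->
  diffq a b ex f g -> {ae mu, forall z, g z = 0} -> forall s,
  {ae mu, forall z : R * R, a < z.2 < b -> f (z + s *: ex) = f z}.
Proof.
move=> mg pg dfg g0.
have pos s : 0 < s -> {ae mu, forall z : R * R, a < z.2 < b -> f (z + s *: ex) = f z}.
  move=> s0; have mc := measurable_cyl L.
  have ml : measurable_fun setT (fun z => s^-1 * lint ex s g z).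
    by apply: measurable_funM; [exact: measurable_cst|exact: measurable_lint].
  have pl : xper L (fun z : R * R => s^-1 * lint ex s g z = 0).
    move=> z; congr (_ * _ = _); apply: eq_Rintegral => t _.
    by rewrite addrAC pg.
  have E : (\int[mu]_(z in cyl L) ((s^-1 * lint ex s g z) ^+ 2)%:E = 0)%E.
    apply/eqP; rewrite eq_le; apply/andP; split; last first.
      by apply: integral_ge0 => z _; rewrite lee_fin sqr_ge0.
    apply: le_trans (integral_sqr_lint_le L_gt0 ex s0 mg pg) _.
    rewrite (ae_eq_integral (cst 0%E)) ?integral0//.
      by apply/measurable_funTS/measurable_EFinP; exact: measurable_funX.
    by apply: filterS g0 => z -> _; rewrite expr0n.
  have : {ae mu, forall z : R * R, s^-1 * lint ex s g z = 0}.
    apply: (ae_xper L_gt0 pl).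
    have /(ae_eq_integral_abs mu mc) : measurable_fun (cyl L) (fun z => ((s^-1 * lint ex s g z) ^+ 2)%:E).
      by apply/measurable_funTS/measurable_EFinP; exact: measurable_funX.
    move=> [H _]; have : ae_eq mu (cyl L) (fun z => ((s^-1 * lint ex s g z) ^+ 2)%:E) (cst 0%E).
      apply: H; rewrite -[RHS]E; apply: eq_integral => z _.
      by rewrite /= ger0_norm// sqr_ge0.
    by apply: filterS => z h zc; have [] := h zc => /eqP; rewrite sqrf_eq0 => /eqP.
  apply: filterS2 (dfg s s0) => z h1 h2 zs; apply/eqP; rewrite -subr_eq0 h1.
  - by move/eqP: h2; rewrite mulf_eq0 invr_eq0 (gt_eqF s0).
  - by case/andP: zs.
  - by rewrite (_ : ex.2 = 0 :> R)// mulr0 addr0; case/andP: zs.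
move=> s; case: (ltrgtP 0 s) => [||<-]; first exact: pos.
- move=> s0; have := ae_leb2_shift (s *: ex) (pos (- s) (ltac:(by rewrite oppr_gt0))).
  apply: filterS => z h zs; rewrite -h ?scaleNr ?addrK//.
  by rewrite (_ : (z + s *: ex).2 = z.2)//= [_ *: _]mulr0 addr0.
- by apply: aeW => z _; rewrite scale0r addr0.
Qed.

(** The null set in the hypothesis depends on s. Tonelli on pairs (z, s) swaps the quantifiers: for
    almost every z the equality holds for almost every s, so f is almost everywhere equal to f z on
    the circle through z, and f z is the mean. *)
Lemma ae_average (f : R * R -> R) : measurable_fun setT f ->
  (forall s, {ae mu, forall z : R * R, a < z.2 < b -> f (z + s *: ex) = f z}) ->
  {ae mu, forall z : R * R, cyl L z -> a < z.2 < b ->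
     f z = L^-1 * \int[lam]_(t in `[0, L]) f (t, z.2)}.
Proof.
move=> mf fs; have mc := measurable_cyl L.
pose F (zs : (R * R) * R) := if a < zs.1.2 < b then `|f (zs.1 + zs.2 *: ex) - f zs.1| else 0.
have m12 : measurable_fun setT (fun zs : (R * R) * R => zs.1.2).
  exact: (measurableT_comp measurable_snd measurable_fst).
have mF : measurable_fun setT F.
  apply: measurable_fun_ifT => //.
  - by apply: measurable_and; apply: measurable_fun_ltr.
  - apply: measurableT_comp => //; apply: measurable_funB.
      by apply: (measurableT_comp mf); exact: measurable_shift_line.
    exact: (measurableT_comp mf).
have F0 zs : 0 <= F zs by rewrite /F; case: ifP.
(* Shifts s in [-L, L] are used so that x + s covers [0, L] whatever x in [0, L[. *)
have E : (\int[mu]_(z in cyl L) \int[lam]_(s in `[(- L)%R, L]) (F (z, s))%:E = 0)%E.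
  rewrite (@ge0_fubini_in _ _ (measurableTypeR R * measurableTypeR R)%type (measurableTypeR R) R (leb2_sigma_finite R) lam (cyl L) `[- L, L]%classic (EFin \o F) (measurable_cyl L))//; last exact/measurable_EFinP.
  apply: integral0_eq => s _ /=.
  have : {ae mu, forall z, cyl L z -> (F (z, s))%:E = 0%E}.
    by apply: filterS (fs s) => z h _; rewrite /F /=; case: ifP => // zs; rewrite h// subrr normr0.
  move=> h; rewrite (ae_eq_integral (cst 0%E)) ?integral0//.
  apply/measurable_funTS/measurable_EFinP; exact: (measurableT_comp mF).
have mI : measurable_fun setT (fun z : R * R => \int[lam]_(s in `[(- L)%R, L]) (F (z, s))%:E)%E.
  apply: (@measurable_ge0_int_in _ _ (measurableTypeR R * measurableTypeR R)%type (measurableTypeR R) R lam `[- L, L]%classic (EFin \o F)) => //.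
  exact/measurable_EFinP.
have /(ae_eq_integral_abs mu mc) [H _] := measurable_funTS mI (D := cyl L).
have : ae_eq mu (cyl L) (fun z : R * R => \int[lam]_(s in `[(- L)%R, L]) (F (z, s))%:E)%E (cst 0%E).
  apply: H; rewrite -[RHS]E; apply: eq_integral => z _; rewrite gee0_abs//.
  by apply: integral_ge0 => s _; rewrite lee_fin.
apply: filterS => -[x y] h zc zs; have {}h := h zc.
have /andP[x0 xL] : 0 <= (x : R) < L by case: zc => /=; rewrite in_itv.
have mg : measurable_fun setT (fun t : R => f (t, y)) by apply: (measurableT_comp mf).
have I0 : (\int[lam]_(t in `[0%R, L]) (`|f (t, y) - f (x, y)|)%:E = 0)%E.
  apply/eqP; rewrite eq_le; apply/andP; split; last first.
    by apply: integral_ge0 => t _; rewrite lee_fin.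
  have mG : measurable_fun setT (fun t : R => (`|f (t, y) - f (x, y)|)%:E).
    by apply/measurable_EFinP; apply: measurableT_comp => //; apply: measurable_funB.
  rewrite -(@ge0_integral_lebesgue_shift R x `[0, L]%classic)//.
  rewrite -[leRHS]h.
  rewrite [leLHS](_ : _ = \int[lam]_(s in (fun s : R => (s + x)%R) @^-1` `[0%R, L]) (F ((x, y), s))%:E)%E.
    apply: ge0_subset_integral => //.
    - by rewrite -[_ @^-1` _]setTI; exact: measurable_addr.
    - apply/measurable_funTS/measurable_EFinP; exact: (measurableT_comp mF).
    - by move=> s _; rewrite lee_fin.
    - by move=> s /=; rewrite !in_itv/= => /andP[s1 s2]; apply/andP; split; lra.
  apply: eq_integral => s _; rewrite /F /= zs; congr (`|f _ - _|%:E).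
  by apply/pair_equal_spec; split; rewrite /= ?[_ *: _]mulr1 ?[_ *: _]mulr0 ?addr0// addrC.
have mD : measurable (`[0, L]%classic : set R) by [].
have /(ae_eq_integral_abs lam mD) [H2 _] : measurable_fun `[0, L]%classic (fun t : R => (f (t, y) - f (x, y))%:E).
  by apply/measurable_funTS/measurable_EFinP; apply: measurable_funB.
have {}H2 : {ae lam, forall t : R, `[0, L]%classic t -> (f (t, y))%:E = (f (x, y))%:E}.
  by apply: filterS (H2 I0) => t ht tD; have [] := ht tD => /eqP; rewrite subr_eq0 => /eqP ->.
rewrite /Rintegral (ae_eq_integral (cst (f (x, y))%:E))//; last exact/measurable_funTS/measurable_EFinP.
rewrite integral_cst//= lebesgue_measure_itv/= lte_fin L_gt0 oppr0 adde0 -EFinM/=.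
by rewrite mulrCA mulVf ?mulr1// gt_eqF.
Qed.

End rigidity.

(** * Morrey's inequality on squares *)

Lemma integral_leb2_shift (R : realType) (w : R * R) (D : set (R * R)) (f : R * R -> \bar R) : measurable D ->
  measurable_fun setT f ->
  (\int[leb2 R]_(z in (fun z : R * R => (z + w)%R) @^-1` D) f (z + w)%R = \int[leb2 R]_(z in D) f z)%E.
Proof.
move=> mD mf; rewrite [LHS]integralE [RHS]integralE; congr (_ - _)%E.
- rewrite -[RHS](ge0_integral_leb2_shift w mD (measurable_funepos mf))//.
  by apply: eq_integral => z _; rewrite !funeposE.
- rewrite -[RHS](ge0_integral_leb2_shift w mD (measurable_funeneg mf))//.
  by apply: eq_integral => z _; rewrite !funenegE.
Qed.

(** Above the threshold c one has (t / c)^(p - 1) >= 1. *)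
Lemma le_absorb_powR (R : realType) (p c t : R) : 1 <= p -> 0 < c -> 0 <= t ->
  t <= c + c `^ (1 - p) * t `^ p.
Proof.
move=> p1 c0 t0; have [tc|ct] := leP t c; first by rewrite (le_trans tc)// lerDl mulr_ge0// powR_ge0.
have t0' : 0 < t := lt_trans c0 ct.
apply: (@le_trans _ _ (t `^ (1 - p) * t `^ p)).
  by rewrite -powRD ?subrK ?powRr1// (gt_eqF t0') implybT.
rewrite -[leLHS]add0r; apply: lerD; first exact: ltW.
rewrite ler_wpM2r ?powR_ge0//.
rewrite -[1 - p]opprB !powRN lef_pV2 ?posrE ?powR_gt0//.
by apply: ge0_ler_powR; rewrite ?subr_ge0 ?nnegrE//; exact: ltW.
Qed.

Section boxes.
Context {R : realType} (sg : R).
Hypothesis sgE : sg = 1 \/ sg = -1.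
Notation mu := (leb2 R).
Notation lam := (@lebesgue_measure R).

(** The sign sg says whether boxes extend upwards or downwards from their base point, so that near
    either wall they can be chosen inside the channel. *)
Definition side (k : R) : set R := [set t | 0 <= sg * t < k].
Definition box (h k : R) : set (R * R) := `[0, h[ `*` side k.

Let sg2 : sg * sg = 1.
Proof. by case: sgE => ->; rewrite ?mulrNN mulr1. Qed.

Lemma measurable_side k : measurable (side k).
Proof.
rewrite (_ : side k = (fun t => sg * t) @^-1` `[0, k[); last first.
  by apply/seteqP; split => t; rewrite /side /= in_itv.
by rewrite -[_ @^-1` _]setTI; apply: measurable_funM => //; exact: measurable_cst.
Qed.

Lemma measurable_box h k : measurable (box h k).
Proof. by apply: measurableX => //; exact: measurable_side. Qed.

Lemma lebesgue_measure_side (k : R) : 0 <= k -> lam (side k) = k%:E.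
Proof.
move=> k0; case: sgE => sgE'.
  rewrite (_ : side k = `[0, k[%classic); last first.
    by apply/seteqP; split => t; rewrite /side sgE' /= in_itv/= mul1r.
  rewrite lebesgue_measure_itv/= lte_fin oppr0 adde0; case: ltP => // k0'.
  by congr EFin; apply/eqP; rewrite eq_le k0 k0'.
rewrite (_ : side k = `](- k), 0]%classic); last first.
  apply/seteqP; split => t; rewrite /side sgE' /= in_itv/= mulN1r oppr_ge0 ltrNl => /andP[? ?]; exact/andP.
rewrite lebesgue_measure_itv/= lte_fin oppr_lt0 opprK add0e; case: ltP => // k0'.
by congr EFin; apply/eqP; rewrite eq_le k0 k0'.
Qed.

Lemma leb2_box (h k : R) : 0 <= h -> 0 <= k -> mu (box h k) = (h * k)%:E.
Proof.
move=> h0 k0; rewrite [LHS]product_measure1E//; last exact: measurable_side.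
rewrite [X in (_ * X)%E]lebesgue_measure_side// EFinM; congr (_ * _)%E.
rewrite [LHS]lebesgue_measure_itv/= lte_fin oppr0 adde0; case: ltP => // h0'.
by congr EFin; apply/eqP; rewrite eq_le h0 h0'.
Qed.

Lemma integral_boxDl h h' k (f : R * R -> \bar R) : 0 <= h -> 0 <= h' -> measurable_fun setT f ->
  (\int[mu]_(z in box (h + h')%R k) f z =
   \int[mu]_(z in box h k) f z + \int[mu]_(z in box h' k) f (z + h *: ex)%R)%E.
Proof.
move=> h0 h0' mf; pose B : set (R * R) := `[h, h + h'[ `*` side k.
have mB : measurable B by apply: measurableX => //; exact: measurable_side.
rewrite (_ : box (h + h') k = box h k `|` B); last first.
  apply/seteqP; split => -[x y]; rewrite /box /B /= !in_itv/=.
    by move=> [/andP[x0 xh] yk]; case: (ltP x h) => xh'; [left|right]; rewrite ?x0.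
  by case=> -[/andP[x0 xh] yk]; split => //; apply/andP; split => //; lra.
rewrite integral_setU//; last 3 first.
- exact: measurable_box.
- exact: measurable_funTS.
- apply/disj_setPS => -[x y]; rewrite /box /B /= !in_itv/= => -[[/andP[? ?] _] [/andP[? ?] _]]; lra.
congr (_ + _)%E; rewrite -(integral_leb2_shift (h *: ex) mB mf); congr integral.
apply/seteqP; split => -[x y]; rewrite /box /B /= !in_itv/= [_ *: 1]mulr1 [_ *: 0]mulr0 addr0.
  by move=> [/andP[x0 xh] yk]; split => //; apply/andP; split; lra.
by move=> [/andP[x0 xh] yk]; split => //; apply/andP; split; lra.
Qed.

Lemma integral_boxDr h k k' (f : R * R -> \bar R) : 0 <= k -> 0 <= k' -> measurable_fun setT f ->
  (\int[mu]_(z in box h (k + k')%R) f z =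
   \int[mu]_(z in box h k) f z + \int[mu]_(z in box h k') f (z + (k * sg) *: ey)%R)%E.
Proof.
move=> k0 k0' mf; pose B : set (R * R) := `[0, h[ `*` [set t | k <= sg * t < k + k'].
have mB : measurable B.
  apply: measurableX => //.
  rewrite (_ : [set t | _] = (fun t => sg * t) @^-1` `[k, k + k'[); last first.
    by apply/seteqP; split => t; rewrite /side /= in_itv.
  by rewrite -[_ @^-1` _]setTI; apply: measurable_funM => //; exact: measurable_cst.
rewrite (_ : box h (k + k') = box h k `|` B); last first.
  apply/seteqP; split => -[x y]; rewrite /box /B /side /=.
    by move=> [xh /andP[y0 yk]]; case: (ltP (sg * y) k) => yk'; [left|right]; rewrite ?y0 ?yk'.
  by case=> -[xh /andP[y0 yk]]; split => //; apply/andP; split => //; lra.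
rewrite integral_setU//; last 3 first.
- exact: measurable_box.
- exact: measurable_funTS.
- apply/disj_setPS => -[x y]; rewrite /box /B /side /= => -[[_ /andP[? ?]] [_ /andP[? ?]]]; lra.
congr (_ + _)%E; rewrite -(integral_leb2_shift ((k * sg) *: ey) mB mf); congr integral.
apply/seteqP; split => -[x y]; rewrite /box /B /side /= [_ *: 1]mulr1 [_ *: 0]mulr0 addr0 mulrDr mulrCA sg2 mulr1.
  by move=> [xh /andP[y0 yk]]; split => //; apply/andP; split; lra.
by move=> [xh /andP[y0 yk]]; split => //; apply/andP; split; lra.
Qed.

End boxes.

(** The first two terms bound the mean over a square of side H. The last sums the errors (H/2 + 2/H)
    r^n of the successive halvings, with r = 2^(2/p) / 2, which is less than 1 exactly because p >
    2. *)
Definition morrey_const (R : realType) (p H : R) : R :=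
  1 / H ^+ 2 + 1 + (H / 2 + 2 / H) / (1 - 2 `^ (2 / p) / 2).

Section morrey.
Context {R : realType} (L a b p N H sg : R).
Hypotheses (L_gt0 : 0 < L) (p_gt2 : 2 < p) (N_gt0 : 0 < N) (H_gt0 : 0 < H) (H_leL : H <= L).
Hypothesis sgE : sg = 1 \/ sg = -1.
Notation mu := (leb2 R).
Notation lam := (@lebesgue_measure R).
Variables (w gx gy : R * R -> R).
Hypotheses (mw : measurable_fun setT w) (pw : xper L w).
Hypotheses (mgx : measurable_fun setT gx) (pgx : xper L gx).
Hypotheses (mgy : measurable_fun setT gy) (pgy : xper L gy).
Hypothesis iw : (\int[mu]_(z in cyl L) `|w z|%:E < +oo)%E.
Hypothesis igx : (\int[mu]_(z in cyl L) `|gx z|%:E < +oo)%E.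
Hypothesis igy : (\int[mu]_(z in cyl L) `|gy z|%:E < +oo)%E.
Hypothesis Nw : (\int[mu]_(z in cyl L) (`|w z| `^ p)%:E <= (N `^ p)%:E)%E.
Hypothesis Ngx : (\int[mu]_(z in cyl L) (`|gx z| `^ p)%:E <= (N `^ p)%:E)%E.
Hypothesis Ngy : (\int[mu]_(z in cyl L) (`|gy z| `^ p)%:E <= (N `^ p)%:E)%E.

(** An inequality form of [diffq] that treats forward and backward directions alike, so both signs
    of sg share one proof. *)
Definition increments e (f g : R * R -> R) := forall t, 0 < t ->
  {ae mu, forall z : R * R, a < z.2 < b -> a < (z + t *: e).2 < b ->
    (`|f (z + t *: e)%R - f z|%:E <= \int[lam]_(s in `[0%R, t]) `|g (z + s *: e)%R|%:E)%E}.

Hypothesis incx : increments ex w gx.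
Hypothesis incy : increments (sg *: ey) w gy.

Let sg2 : sg * sg = 1.
Proof. by case: sgE => ->; rewrite ?mulrNN mulr1. Qed.

Let box_cyl h k : h <= L -> box sg h k `<=` cyl L.
Proof.
move=> hL [x y] [/=]; rewrite in_itv/= => /andP[x0 xh] _; split => //=.
by rewrite in_itv/= x0 (lt_le_trans xh).
Qed.

Let mshift (g : R * R -> R) z : measurable_fun setT g -> measurable_fun setT (fun y : R * R => g (z + y)).
Proof.
move=> mg; rewrite (_ : (fun y => _) = fun y : R * R => g (y + z)).
  exact: (measurableT_comp mg (measurable_shift2 z)).
by apply/funext => y; rewrite addrC.
Qed.

Let integral_box_le (g : R * R -> \bar R) z h k : measurable_fun setT g -> xper L g ->
  (forall z, 0 <= g z)%E -> h <= L ->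
  (\int[mu]_(y in box sg h k) g (z + y)%R <= \int[mu]_(y in cyl L) g y)%E.
Proof.
move=> mg pg g0 hL; rewrite -(ge0_integral_cyl_shift L_gt0 z mg g0 pg).
under [leRHS]eq_integral do rewrite addrC.
apply: ge0_subset_integral => //.
- exact: measurable_box.
- exact: measurable_cyl.
- apply: measurable_funTS; rewrite (_ : (fun y => _) = fun y : R * R => g (y + z)%R).
    exact: (measurableT_comp mg (measurable_shift2 z)).
  by apply/funext => y; rewrite addrC.
- exact: box_cyl.
Qed.

(** [le_absorb_powR] with threshold N c, scaled by N so that the resulting bound is linear in N. *)
Let integral_box_absorb (g : R * R -> R) z h k c : measurable_fun setT g -> xper L g ->
  (\int[mu]_(z in cyl L) (`|g z| `^ p)%:E <= (N `^ p)%:E)%E -> 0 <= h -> h <= L -> 0 <= k -> 0 < c ->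
  (\int[mu]_(y in box sg h k) `|g (z + y)%R|%:E <= (N * (c * (h * k) + c `^ (1 - p)))%:E)%E.
Proof.
move=> mg pg Ng h0 hL k0 c0; have mB := measurable_box sg h k.
have Nc : 0 < N * c by rewrite mulr_gt0.
have mgp : measurable_fun setT (fun y : R * R => `|g y| `^ p).
  by apply: (measurableT_comp (measurable_powR p)); exact: measurableT_comp.
apply: (@le_trans _ _ (\int[mu]_(y in box sg h k) ((N * c)%:E + ((N * c) `^ (1 - p))%:E * (`|g (z + y)%R| `^ p)%:E))%E).
  apply: ge0_le_integral => //.
  - by apply/measurable_funTS/measurable_EFinP; apply: measurableT_comp => //; exact: mshift.
  - apply: measurable_funTS; apply: emeasurable_funD; first exact: measurable_cst.
    apply: emeasurable_funM; first exact: measurable_cst.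
    by apply/measurable_EFinP; exact: (@mshift (fun y => `|g y| `^ p)).
  - move=> y _; rewrite -EFinM -EFinD lee_fin; apply: le_absorb_powR => //.
    by rewrite (le_trans _ (ltW p_gt2))// ler1n.
rewrite ge0_integralD; [|by []| | | |]; last 4 first.
- by move=> y _; rewrite lee_fin ltW.
- exact: measurable_cst.
- by move=> y _; rewrite -EFinM lee_fin mulr_ge0 ?powR_ge0.
- apply: measurable_funTS; apply: emeasurable_funM; first exact: measurable_cst.
  by apply/measurable_EFinP; exact: (@mshift (fun y => `|g y| `^ p)).
rewrite integral_cst//= leb2_box// ge0_integralZl//; last 2 first.
- by first [by rewrite lee_fin powR_ge0|apply/measurable_funTS/measurable_EFinP; exact: (@mshift (fun y => `|g y| `^ p))].
- by first [by rewrite lee_fin powR_ge0|apply/measurable_funTS/measurable_EFinP; exact: (@mshift (fun y => `|g y| `^ p))].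
have -> : (N * (c * (h * k) + c `^ (1 - p)))%:E = ((N * c)%:E * (h * k)%:E + (N * c `^ (1 - p))%:E)%E.
  by rewrite -EFinM -EFinD; congr EFin; ring.
apply: leeD; first exact: lexx.
apply: (@le_trans _ _ (((N * c) `^ (1 - p))%:E * (N `^ p)%:E)%E).
  apply: lee_wpmul2l; first by rewrite lee_fin powR_ge0.
  apply: le_trans Ng; apply: (@integral_box_le (fun y => (`|g y| `^ p)%:E)) => //.
  - exact/measurable_EFinP.
  - by move=> y; rewrite pg.
rewrite -EFinM lee_fin powRM ?(ltW c0) ?(ltW N_gt0)// mulrAC -powRD; last by rewrite (gt_eqF N_gt0) implybT.
by rewrite subrK powRr1// ltW.
Qed.

Let S (h k : R) (z : R * R) : R := \int[mu]_(y in box sg h k) w (z + y).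

Let iS (h k : R) (z : R * R) : h <= L -> mu.-integrable (box sg h k) (fun y : R * R => (w (z + y))%:E).
Proof.
move=> hL; apply/integrableP; split; first by apply/measurable_funTS/measurable_EFinP; exact: mshift.
apply: le_lt_trans iw; apply: (@integral_box_le (fun y => `|w y|%:E)) => //.
- by apply/measurable_EFinP; exact: measurableT_comp.
- by move=> y; rewrite pw.
Qed.

Let SE (h k : R) (z : R * R) : h <= L -> ((S h k z)%:E = \int[mu]_(y in box sg h k) (w (z + y)%R)%:E)%E.
Proof.
by move=> hL; rewrite /S /Rintegral fineK//; apply: integrable_fin_num (iS _ _ hL); exact: measurable_box.
Qed.

Let S_double (h : R) (z : R * R) : 0 <= h -> h + h <= L -> S (h + h) (h + h) z =
  S h h z + S h h (z + (h * sg) *: ey) + (S h h (z + h *: ex) + S h h (z + h *: ex + (h * sg) *: ey)).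
Proof.
move=> h0 hL; have hL1 : h <= L by rewrite (le_trans _ hL)// lerDl.
have mW : measurable_fun setT (fun y : R * R => (w (z + y))%:E) by apply/measurable_EFinP; exact: mshift.
have mW' : measurable_fun setT (fun y : R * R => (w (z + (y + h *: ex)))%:E).
  apply/measurable_EFinP; exact: (measurableT_comp (mshift z mw) (measurable_shift2 _)).
apply: EFin_inj; rewrite SE// integral_boxDl//.
rewrite (integral_boxDr sgE)// (@integral_boxDr _ _ sgE h h h (fun y : R * R => (w (z + (y + h *: ex))%R)%:E))//.
rewrite !EFinD !SE//; congr (_ + _ + (_ + _))%E; apply: eq_integral => y _; congr (w _)%:E.
- by rewrite addrA addrAC.
- by rewrite addrA addrAC.
- rewrite -!addrA; congr (_ + _); rewrite [LHS]addrC [X in X + y]addrC -addrA //.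
Qed.

(** The difference is the integral over the box of increments of w. After exchanging integrals, each
    s in [0, t] contributes the integral of |g| over a translated box, estimated by
    [integral_box_absorb]. *)
Let S_shift_le e g (h t c : R) (z : R * R) : increments e w g -> measurable_fun setT g -> xper L g ->
  (\int[mu]_(z in cyl L) (`|g z| `^ p)%:E <= (N `^ p)%:E)%E -> 0 <= h -> h <= L -> 0 < t -> 0 < c ->
  (forall y, box sg h h y -> a < (z + y).2 < b /\ a < (z + y + t *: e).2 < b) ->
  `|S h h (z + t *: e) - S h h z| <= t * (N * (c * h ^+ 2 + c `^ (1 - p))).
Proof.
move=> inc mg pg Ng h0 hL t0 c0 hz; have mB := measurable_box sg h h.
have SB : (S h h (z + t *: e) - S h h z)%:E =
    (\int[mu]_(y in box sg h h) (w (z + t *: e + y)%R - w (z + y)%R)%:E)%E.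
  rewrite EFinB !SE//.
  by under [RHS]eq_integral do rewrite EFinB; rewrite [RHS]integralB//; exact: iS.
have mD : measurable_fun setT (fun y : R * R => (w (z + t *: e + y)%R - w (z + y)%R)%:E).
  by apply/measurable_EFinP; apply: measurable_funB; exact: mshift.
rewrite -lee_fin -abse_EFin SB.
apply: le_trans (le_abse_integral mu mB (measurable_funTS mD)) _.
pose F (ys : (R * R) * R) := (`|g (z + ys.1 + ys.2 *: e)|%:E).
have mF : measurable_fun setT F.
  apply/measurable_EFinP; apply: measurableT_comp => //.
  rewrite (_ : (fun ys => _) = fun ys : (R * R) * R => g (z + (ys.1 + ys.2 *: e))).
    exact: (measurableT_comp (mshift z mg) (measurable_shift_line e)).
  by apply/funext => ys; rewrite addrA.
have F0 ys : (0 <= F ys)%E by rewrite lee_fin.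
apply: (@le_trans _ _ (\int[mu]_(y in box sg h h) \int[lam]_(s in `[0%R, t]) F (y, s))%E).
  apply: ae_ge0_le_integral => //.
  - by apply: measurableT_comp => //; exact: measurable_funTS.
  - by move=> y _; exact: integral_ge0.
  - apply: measurable_funTS.
    exact: (@measurable_ge0_int_in _ _ (measurableTypeR R * measurableTypeR R)%type (measurableTypeR R) R lam `[0, t]%classic F).
  - have := ae_leb2_shift z (inc t t0); apply: filterS => y hy yB.
    have [h1 h2] := hz y yB; move: hy; rewrite [y + z]addrC => hy.
    have := hy h1 h2; rewrite abse_EFin addrAC => /le_trans; apply.
    by rewrite le_eqVlt; apply/orP; left; apply/eqP; apply: eq_integral => s _.
rewrite (@ge0_fubini_in _ _ (measurableTypeR R * measurableTypeR R)%type (measurableTypeR R) R (leb2_sigma_finite R) lam (box sg h h) `[0, t]%classic F mB)//.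
apply: (@le_trans _ _ (\int[lam]_(s in `[0%R, t]) (N * (c * h ^+ 2 + c `^ (1 - p)))%:E)%E).
  apply: ge0_le_integral => //.
  - by move=> s _; exact: integral_ge0.
  - apply: measurable_funTS.
    apply: (@measurable_ge0_int_in _ _ (measurableTypeR R) (measurableTypeR R * measurableTypeR R)%type R (leb2_sigma_finite R) (box sg h h) (fun sy => F (sy.2, sy.1))) => //.
    have ms : measurable_fun setT (fun sy : measurableTypeR R * (measurableTypeR R * measurableTypeR R) => (sy.2, sy.1)).
      exact: measurable_swap.
    exact: (measurableT_comp mF ms).
  - move=> s _; rewrite expr2; apply: le_trans (integral_box_absorb (z + s *: e) mg pg Ng h0 hL h0 c0).
    rewrite le_eqVlt; apply/orP; left; apply/eqP; apply: eq_integral => y _.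
    by rewrite /F /= addrAC.
rewrite integral_cst//= lebesgue_measure_itv/= lte_fin t0 oppr0 adde0 -EFinM lee_fin mulrC //.
Qed.

(** Both horizontal edges of the largest box based at z are in the open channel, hence so is every
    smaller box. *)
Let inside (z : R * R) := (a < z.2 < b) && (a < z.2 + sg * H < b).

Let inside_le (z : R * R) t : inside z -> 0 <= t <= H -> a < z.2 + sg * t < b.
Proof.
rewrite /inside => /andP[/andP[z1 z2] /andP[z3 z4]] /andP[t0 tH].
by case: sgE z3 z4 => ->; rewrite ?mul1r ?mulN1r => z3 z4; apply/andP; split; lra.
Qed.

(* [c] is the threshold of [le_absorb_powR]; it replaces Hoelder's inequality. *)
Let S_double_le h c z : 0 < h -> h + h <= H -> 0 < c -> inside z ->
  `|S (h + h) (h + h) z - 4 * S h h z| <= 4 * (h * (N * (c * h ^+ 2 + c `^ (1 - p)))).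
Proof.
move=> h0 hH c0 zi; have hL : h + h <= L by exact: le_trans H_leL.
have hL1 : h <= L by rewrite (le_trans _ hL)// lerDl ltW.
rewrite S_double// ?(ltW h0)//.
have box2 y : box sg h h y -> y.2 = sg * (sg * y.2) /\ 0 <= sg * y.2 < h.
  by move=> [_ ?]; rewrite mulrA sg2 mul1r.
have X : `|S h h (z + h *: ex) - S h h z| <= h * (N * (c * h ^+ 2 + c `^ (1 - p))).
  apply: (S_shift_le incx) => //; first exact: ltW.
  move=> y /box2[y2 /andP[y0 yh]].
  have -> : (z + y + h *: ex).2 = (z + y).2 by rewrite /= [_ *: 0]mulr0 addr0.
  have : a < (z + y).2 < b by rewrite /= y2; apply: inside_le => //; apply/andP; split => //; lra.
  by [].
have Y v : v = 0 \/ v = h *: ex ->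
    `|S h h (z + v + (h * sg) *: ey) - S h h (z + v)| <= h * (N * (c * h ^+ 2 + c `^ (1 - p))).
  move=> hv; rewrite -scalerA; apply: (S_shift_le incy) => //; first exact: ltW.
  have v2 : v.2 = 0 by case: hv => -> //=; rewrite [_ *: 0]mulr0.
  move=> y /box2[y2 /andP[y0 yh]]; split.
    by rewrite /= v2 addr0 y2; apply: inside_le => //; apply/andP; split => //; lra.
  rewrite (_ : (_ + _).2 = z.2 + sg * (sg * y.2 + h)).
    by apply: inside_le => //; apply/andP; split; lra.
  rewrite /= v2 addr0 mulrDr -y2 -addrA; congr (_ + (_ + _)).
  by rewrite scalerA [_ *: 1]mulr1 mulrC.
have Y0 := Y 0 (or_introl erefl); rewrite !addr0 in Y0.
have Y1 := Y _ (or_intror erefl).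
move: X Y0 Y1; set E := h * _; move: (S h h z) (S h h _) (S h h _) (S h h _) => s1 s2 s3 s4.
rewrite !ler_norml => /andP[? ?] /andP[? ?] /andP[? ?]; apply/andP; split; lra.
Qed.

(* With [h = H / 2 ^ n] and [c = q ^ n] the two error terms [c * h] and
   [c `^ (1 - p) / h] are both of order [r ^ n]. *)
Let q : R := 2 `^ (2 / p).
Let r : R := q / 2.

Let p_gt0 : 0 < p. Proof. by rewrite (lt_trans _ p_gt2). Qed.
Let q_gt0 : 0 < q. Proof. exact: powR_gt0. Qed.
Let r_ge0 : 0 <= r. Proof. by rewrite divr_ge0// ltW. Qed.
Let r_lt1 : r < 1.
Proof.
rewrite ltr_pdivrMr// mul1r -[ltRHS]powRr1//.
rewrite /q !/powR; case: ifPn; rewrite ?pnatr_eq0// => _.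
by rewrite ltr_expR ltr_pM2r ?ln_gt0 ?ltr1n// ltr_pdivrMr// mul1r.
Qed.

Let q_pow n : 2 ^+ n * (q ^+ n) `^ (1 - p) = r ^+ n.
Proof.
have -> : (q ^+ n) `^ (1 - p) = (q `^ (1 - p)) ^+ n.
  by rewrite -[in LHS]powR_mulrn ?(ltW q_gt0)// powRAC powR_mulrn ?powR_ge0.
rewrite -exprMn; congr (_ ^+ _).
rewrite powRB ?(gt_eqF q_gt0) ?implybT// powRr1 ?(ltW q_gt0)//.
(* This value of q^p balances the two errors: 2 q^(1 - p) = 2 q / 4 = r. *)
have -> : q `^ p = 4.
  rewrite /q -powRrM divfK ?(gt_eqF p_gt0)// powR_mulrn// expr2; ring.
by rewrite /r; field.
Qed.

Let h_ n : R := H / 2 ^+ n.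

Let h_gt0 n : 0 < h_ n. Proof. by rewrite divr_gt0// exprn_gt0. Qed.
Let h_double n : h_ n = h_ n.+1 + h_ n.+1.
Proof. by rewrite /h_ exprS; field; rewrite expf_neq0. Qed.
Let h_le n : h_ n <= H.
Proof. by rewrite ler_pdivrMr ?exprn_gt0// ler_pMr// exprn_ege1// ler1n. Qed.

Let S_step n z : inside z -> `|S (h_ n.+1) (h_ n.+1) z| / h_ n.+1 ^+ 2 <=
  `|S (h_ n) (h_ n) z| / h_ n ^+ 2 + N * ((H / 2 + 2 / H) * r ^+ n).
Proof.
move=> zi; have hn := h_gt0 n.+1.
have := @S_double_le (h_ n.+1) (q ^+ n) z hn _ (exprn_gt0 n q_gt0) zi.
rewrite -h_double => /(_ (h_le n)).
set u := S (h_ n) _ z; set v := S _ _ z => D.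
have {D} : 4 * `|v| <= `|u| + 4 * (h_ n.+1 * (N * (q ^+ n * h_ n.+1 ^+ 2 + (q ^+ n) `^ (1 - p)))).
  rewrite -[4 * `|v|]ger0_norm ?mulr_ge0// normrM normr_id -normrM.
  apply: le_trans (lerD (lexx _) D); rewrite -[X in `|X| <= _](subrK u) addrC (le_trans (ler_normD _ _))//.
  by rewrite distrC.
set E := N * ((H / 2 + 2 / H) * r ^+ n).
have -> : 4 * (h_ n.+1 * (N * (q ^+ n * h_ n.+1 ^+ 2 + (q ^+ n) `^ (1 - p)))) = 4 * h_ n.+1 ^+ 2 * E.
  have h2 : h_ n.+1 = H / (2 * 2 ^+ n) by rewrite /h_ exprS.
  have Qn : (q ^+ n) `^ (1 - p) = r ^+ n / 2 ^+ n by rewrite -q_pow mulrAC divff ?mul1r// expf_neq0.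
  have qn : q ^+ n = 2 ^+ n * r ^+ n by rewrite /r expr_div_n mulrC divfK// expf_neq0.
  rewrite /E Qn qn h2; move: (r ^+ n) (2 ^+ n : R) (exprn_gt0 n (ltr0n R 2)) => rn tn tn0.
  by field; rewrite !gt_eqF.
rewrite (h_double n); move: (h_ n.+1) hn => h h0 D.
rewrite ler_pdivrMr ?exprn_gt0// mulrDl.
have -> : `|u| / (h + h) ^+ 2 * h ^+ 2 = `|u| / 4 by field; lra.
have := D; lra.
Qed.

Let K0 : R := 1 / H ^+ 2 + 1.
Let CK : R := H / 2 + 2 / H.

Let S_bound n z : inside z -> `|S (h_ n) (h_ n) z| / h_ n ^+ 2 <= N * (K0 + CK * \sum_(i < n) r ^+ i).
Proof.
move=> zi; elim: n => [|n ih]; last first.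
  apply: le_trans (S_step n zi) _; apply: le_trans (lerD ih (lexx _)) _.
  by rewrite big_ord_recr /= -mulrDr [CK * (_ + _)]mulrDr addrA.
rewrite big_ord0 mulr0 addr0 /h_ expr0 divr1 ler_pdivrMr ?exprn_gt0//.
have := @integral_box_absorb w z H H 1 mw pw Nw (ltW H_gt0) H_leL (ltW H_gt0) ltr01.
rewrite powR1 mul1r => B.
rewrite -lee_fin -abse_EFin SE//.
apply: le_trans (le_abse_integral _ _ _) _; first exact: measurable_box.
  by apply/measurable_funTS/measurable_EFinP; exact: mshift.
apply: le_trans B _; rewrite lee_fin /K0 -mulrA ler_pM2l//.
rewrite mulrDl divfK; last by rewrite expf_neq0 // gt_eqF.
by rewrite mul1r expr2 addrC.
Qed.

Let K : R := morrey_const p H.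

Let S_bounded n z : inside z -> `|S (h_ n) (h_ n) z| / h_ n ^+ 2 <= N * K.
Proof.
move=> zi; apply: le_trans (S_bound n zi) _; rewrite ler_pM2l// lerD2l.
have CK0 : 0 <= CK by rewrite addr_ge0// divr_ge0// ltW.
rewrite ler_wpM2l//.
have r1 : 0 < 1 - r by rewrite subr_gt0.
rewrite -[leRHS]mul1r ler_pdivlMr// mulrC -[1 - r]opprB mulNr -subrX1 opprB.
by rewrite gerBl exprn_ge0.
Qed.

Let tail : R := fine (\int[mu]_(z in cyl L) `|gx z|%:E) + fine (\int[mu]_(z in cyl L) `|gy z|%:E).

Let inside0 z : inside z -> a < z.2 < b.
Proof. by rewrite /inside => /andP[]. Qed.

Let pinside (z v : R * R) : v.2 = 0 -> inside (z + v) = inside z.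
Proof. by move=> v2; rewrite /inside /= v2 addr0. Qed.

Let minside : measurable_fun setT inside.
Proof.
rewrite /inside; apply: measurable_and; apply: measurable_and; apply: measurable_fun_ltr => //.
- by apply: measurable_funD.
- by apply: measurable_funD.
Qed.

Let osc (y z : R * R) : R := if inside z then `|w (z + y) - w z| else 0.

Let mosc : measurable_fun setT (fun yz : (R * R) * (R * R) => osc yz.1 yz.2).
Proof.
apply: measurable_fun_ifT => //.
- exact: (measurableT_comp minside).
- apply: measurableT_comp => //; apply: measurable_funB.
    have mD : measurable_fun setT (fun yz : (R * R) * (R * R) => yz.2 + yz.1).
      apply/measurable_fun_pairP; split; apply: measurable_funD;
        do 2 (apply: measurableT_comp => //).
    exact: (measurableT_comp mw mD).
  exact: (measurableT_comp mw).
Qed.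

Let mosc1 y : measurable_fun setT (osc y).
Proof.
apply: measurable_fun_ifT => //; apply: measurableT_comp => //; apply: measurable_funB => //.
exact: (measurableT_comp mw (measurable_shift2 _)).
Qed.

Let posc y : xper L (osc y).
Proof. by move=> z; rewrite /osc pinside// pw addrAC pw. Qed.

Let osc_ge0 y z : 0 <= osc y z.
Proof. by rewrite /osc; case: ifP. Qed.

(** An L^1 modulus of continuity. The case t = 0 is separate because [increments] concerns positive
    lengths. *)
Let osc_L1 e g t : increments e w g -> measurable_fun setT g -> xper L g ->
  (\int[mu]_(z in cyl L) `|g z|%:E < +oo)%E -> 0 <= t ->
  (forall z, inside z -> a < (z + t *: e).2 < b) ->
  (\int[mu]_(z in cyl L) (osc (t *: e) z)%:E <= (t * fine (\int[mu]_(z in cyl L) `|g z|%:E))%:E)%E.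
Proof.
move=> inc mg pg ig t0 Ds; have mc := measurable_cyl L.
have G0 : (0 <= \int[mu]_(z in cyl L) `|g z|%:E)%E by apply: integral_ge0 => z _; rewrite lee_fin.
move: t0; rewrite le_eqVlt => /orP[/eqP <-|t0].
  rewrite mul0r integral0_eq// => z _; rewrite /osc scale0r addr0 subrr normr0.
  by case: ifP.
rewrite EFinM fineK ?ge0_fin_numE//.
have mag : measurable_fun setT (fun z => `|g z|%:E).
  by apply/measurable_EFinP; exact: measurableT_comp.
rewrite -(@integral_cyl_lint _ _ L_gt0 e t (fun z => `|g z|%:E) (ltW t0) mag)//; last by move=> z; rewrite pg.
apply: ae_ge0_le_integral => //.
- by move=> z _; rewrite lee_fin.
- by apply/measurable_funTS/measurable_EFinP; exact: mosc1.
- by move=> z _; apply: integral_ge0 => s _; rewrite lee_fin.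
- apply: measurable_funTS.
  by apply: (@measurable_ge0_lint _ e t (fun z => `|g z|%:E)).
- apply: filterS (inc t t0) => z h _; rewrite /osc; case: ifPn => zi.
    by apply: h; [exact: inside0|exact: Ds].
  by apply: integral_ge0 => s _; rewrite lee_fin.
Qed.

Let osc_box n y : box sg (h_ n) (h_ n) y -> (\int[mu]_(z in cyl L) (osc y z)%:E <= (h_ n * tail)%:E)%E.
Proof.
move=> [y1 y2]; have mc := measurable_cyl L.
move: y1; rewrite /= in_itv/= => /andP[y10 y1h].
have /andP[y20 y2h] : 0 <= sg * y.2 < h_ n by [].
(* A displacement inside the box is a horizontal move followed by a vertical one, so that each is
   covered by one of the two increment hypotheses. *)
have yE : y = y.1 *: ex + (sg * y.2) *: (sg *: ey).
  case: (y) => u v; rewrite scalerA mulrAC sg2 mul1r; apply/pair_equal_spec; split.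
    by rewrite /= [_ *: 1]mulr1 [_ *: 0]mulr0 addr0.
  by rewrite /= [_ *: 1]mulr1 [_ *: 0]mulr0 add0r.
have ox : (\int[mu]_(z in cyl L) (osc (y.1 *: ex) z)%:E <= (y.1 * fine (\int[mu]_(z in cyl L) `|gx z|%:E))%:E)%E.
  apply: (osc_L1 incx) => // z zi; rewrite /= [_ *: 0]mulr0 addr0; exact: inside0.
have oy : (\int[mu]_(z in cyl L) (osc ((sg * y.2) *: (sg *: ey)) z)%:E <= ((sg * y.2) * fine (\int[mu]_(z in cyl L) `|gy z|%:E))%:E)%E.
  apply: (osc_L1 incy) => // z zi; rewrite (_ : (_ + _).2 = z.2 + sg * (sg * y.2)).
    by apply: inside_le => //; rewrite y20 (le_trans (ltW y2h)).
  by rewrite /= scalerA [_ *: 1]mulr1 mulrC.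
have gx0 : 0 <= fine (\int[mu]_(z in cyl L) `|gx z|%:E).
  by apply: fine_ge0; apply: integral_ge0 => z _; rewrite lee_fin.
have gy0 : 0 <= fine (\int[mu]_(z in cyl L) `|gy z|%:E).
  by apply: fine_ge0; apply: integral_ge0 => z _; rewrite lee_fin.
set v := (sg * y.2) *: (sg *: ey) in yE oy.
apply: (@le_trans _ _ (\int[mu]_(z in cyl L) ((osc v (z + y.1 *: ex)%R)%:E + (osc (y.1 *: ex) z)%:E))%E).
  apply: ge0_le_integral => //.
  - by move=> z _; rewrite lee_fin.
  - by apply/measurable_funTS/measurable_EFinP; exact: mosc1.
  - apply: measurable_funTS; apply: emeasurable_funD; apply/measurable_EFinP.
      exact: (measurableT_comp (mosc1 v) (measurable_shift2 _)).
    exact: mosc1.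
  - move=> z _; rewrite -EFinD lee_fin /osc pinside; last by rewrite /= [_ *: 0]mulr0.
    case: ifP => _; last by rewrite addr0.
    rewrite [in X in X <= _]yE addrA.
    by rewrite -[X in `|X| <= _](subrKA (w (z + y.1 *: ex))) ler_normD.
rewrite ge0_integralD//; last 4 first.
- by move=> z _; rewrite lee_fin.
- apply/measurable_funTS/measurable_EFinP; exact: (measurableT_comp (mosc1 v) (measurable_shift2 _)).
- by move=> z _; rewrite lee_fin.
- by apply/measurable_funTS/measurable_EFinP; exact: mosc1.
rewrite (@ge0_integral_cyl_shift _ _ L_gt0 (fun z => (osc v z)%:E))//; last 3 first.
- by apply/measurable_EFinP; exact: mosc1.
- by move=> z; rewrite lee_fin.
- by move=> z; rewrite posc.
apply: (le_trans (leeD oy ox)); rewrite -EFinD lee_fin /tail mulrDr addrC.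
by apply: lerD; apply: ler_wpM2r => //; exact: ltW.
Qed.

(** How far |w z| exceeds the uniform bound N K of the box means; the aim is to show that it
    vanishes almost everywhere. *)
Let excess (z : R * R) : R := if inside z then Num.max 0 (`|w z| - N * K) else 0.

Let excess_ge0 z : 0 <= excess z.
Proof. by rewrite /excess; case: ifP => // _; rewrite le_max lexx. Qed.

Let mexcess : measurable_fun setT excess.
Proof.
apply: measurable_fun_ifT => //; apply: measurable_maxr; first exact: measurable_cst.
by apply: measurable_funB => //; exact: measurableT_comp.
Qed.

(** The mean over the box is at most N K in modulus, so the excess is at most the distance from w z
    to the mean, hence at most the mean oscillation. *)
Let excess_le n z : ((h_ n ^+ 2 * excess z)%:E <= \int[mu]_(y in box sg (h_ n) (h_ n)) (osc y z)%:E)%E.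
Proof.
have h0 := h_gt0 n; have mB := measurable_box sg (h_ n) (h_ n).
have hL : h_ n <= L by rewrite (le_trans (h_le n)).
have I0 : (0 <= \int[mu]_(y in box sg (h_ n) (h_ n)) (osc y z)%:E)%E.
  by apply: integral_ge0 => y _; rewrite lee_fin.
rewrite /excess; case: ifPn => zi; last by rewrite mulr0.
have [wN|wN] := leP (`|w z| - N * K) 0; first by rewrite mulr0.
have mD : measurable_fun setT (fun y : R * R => (w (z + y)%R - w z)%:E).
  by apply/measurable_EFinP; apply: measurable_funB; [exact: mshift|exact: measurable_cst].
have -> : (\int[mu]_(y in box sg (h_ n) (h_ n)) (osc y z)%:E =
    \int[mu]_(y in box sg (h_ n) (h_ n)) `|(w (z + y)%R - w z)%:E|)%E.
  by apply: eq_integral => y _; rewrite /osc zi.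
apply: le_trans (le_abse_integral mu mB (measurable_funTS mD)).
have -> : (\int[mu]_(y in box sg (h_ n) (h_ n)) (w (z + y)%R - w z)%:E =
    (S (h_ n) (h_ n) z - w z * h_ n ^+ 2)%:E)%E.
  under eq_integral do rewrite EFinB.
  rewrite integralB//; last 2 first.
  - exact: iS.
  - apply/integrableP; split; first exact: measurable_cst.
    rewrite integral_cst//= leb2_box ?(ltW h0)// -EFinM; exact: ltry.
  rewrite EFinB SE// integral_cst//= leb2_box ?(ltW h0)// -EFinM expr2 //.
rewrite abse_EFin lee_fin; have := S_bounded n zi; rewrite ler_pdivrMr ?exprn_gt0//.
move=> hS; rewrite mulrBr.
have : `|w z * h_ n ^+ 2| <= `|S (h_ n) (h_ n) z - w z * h_ n ^+ 2| + `|S (h_ n) (h_ n) z|.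
  rewrite -[X in `|X| <= _](subKr (S (h_ n) (h_ n) z)) opprB addrC.
  by rewrite [in X in _ <= X]distrC ler_normD.
rewrite normrM (ger0_norm (sqr_ge0 _)); lra.
Qed.

(** Instead of Lebesgue points in the plane, [excess_le] is integrated over the cylinder: the
    integral of the excess is at most [h_ n * tail], which tends to 0. *)
Lemma morrey_half : {ae mu, forall z : R * R, a < z.2 < b -> a < z.2 + sg * H < b ->
  `|w z| <= N * morrey_const p H}.
Proof.
have mc := measurable_cyl L.
have ms : measurable_fun setT (fun zy : (measurableTypeR R * measurableTypeR R) * (measurableTypeR R * measurableTypeR R) => (zy.2, zy.1)).
  exact: measurable_swap.
have Jn n : (\int[mu]_(z in cyl L) (excess z)%:E <= (h_ n * tail)%:E)%E.
  have h0 := h_gt0 n; have mB := measurable_box sg (h_ n) (h_ n).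
  have h2 : 0 < h_ n ^+ 2 by rewrite exprn_gt0.
  rewrite -(@lee_pmul2l _ (h_ n ^+ 2)%:E)// ?lte_fin//.
  rewrite -ge0_integralZl//; last 3 first.
  - by apply/measurable_funTS/measurable_EFinP; exact: mexcess.
  - by move=> z _; rewrite lee_fin.
  - by rewrite lee_fin ltW.
  apply: (@le_trans _ _ (\int[mu]_(z in cyl L) \int[mu]_(y in box sg (h_ n) (h_ n)) (osc y z)%:E)%E).
    apply: ge0_le_integral => //.
    - by move=> z _; rewrite -EFinM lee_fin mulr_ge0// ltW.
    - apply: measurable_funTS; apply: emeasurable_funM; first exact: measurable_cst.
      exact/measurable_EFinP.
    - apply: measurable_funTS.
      apply: (@measurable_ge0_int_in _ _ (measurableTypeR R * measurableTypeR R)%type (measurableTypeR R * measurableTypeR R)%type R (leb2_sigma_finite R) (box sg (h_ n) (h_ n)) (fun zy => (osc zy.2 zy.1)%:E)) => //.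
      by apply/measurable_EFinP; exact: (measurableT_comp mosc ms).
      by move=> zy; rewrite lee_fin.
    - by move=> z _; rewrite -EFinM; exact: excess_le.
  rewrite (@ge0_fubini_in _ _ (measurableTypeR R * measurableTypeR R)%type (measurableTypeR R * measurableTypeR R)%type R (leb2_sigma_finite R) (leb2_sigma_finite R) (cyl L) (box sg (h_ n) (h_ n)) (fun zy => (osc zy.2 zy.1)%:E) mc)//; last 2 first.
  - by apply/measurable_EFinP; exact: (measurableT_comp mosc ms).
  - by move=> zy; rewrite lee_fin.
  apply: (@le_trans _ _ (\int[mu]_(y in box sg (h_ n) (h_ n)) (h_ n * tail)%:E)%E).
    apply: ge0_le_integral => //.
    - by move=> y _; apply: integral_ge0 => z _; rewrite lee_fin.
    - apply: measurable_funTS.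
      apply: (@measurable_ge0_int_in _ _ (measurableTypeR R * measurableTypeR R)%type (measurableTypeR R * measurableTypeR R)%type R (leb2_sigma_finite R) (cyl L) (fun yz => (osc yz.1 yz.2)%:E)) => //.
      by apply/measurable_EFinP.
      by move=> zy; rewrite lee_fin.
    - by move=> y; exact: osc_box.
  by rewrite integral_cst//= leb2_box ?(ltW h0)// -!EFinM lee_fin mulrC expr2.
have J0 : (0 <= \int[mu]_(z in cyl L) (excess z)%:E)%E by apply: integral_ge0 => z _; rewrite lee_fin.
have E0 : (\int[mu]_(z in cyl L) (excess z)%:E = 0)%E.
  have Jf : (\int[mu]_(z in cyl L) (excess z)%:E)%E \is a fin_num.
    by rewrite ge0_fin_numE// (le_lt_trans (Jn 0%N))// ltry.
  apply/eqP; rewrite eq_le J0 andbT -(fineK Jf) lee_fin leNgt; apply/negP => J1.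
  have : geometric (H * tail) (2^-1) @ \oo --> (0 : R).
    by apply: cvg_geometric; rewrite ger0_norm ?invr_ge0// invf_lt1// ltr1n.
  move=> /(cvgr_lt (0 : R))/(_ _ J1)[n _ /(_ n (leqnn n))]; rewrite /geometric /=.
  have := Jn n; rewrite -(fineK Jf) lee_fin /h_ -exprVn mulrAC => /le_lt_trans h1 /h1.
  by rewrite ltxx.
have pl : xper L (fun z : R * R => excess z = 0) by move=> z; rewrite /excess pinside// pw.
have : {ae mu, forall z, excess z = 0}.
  apply: (ae_xper L_gt0 pl).
  have /(ae_eq_integral_abs mu mc) : measurable_fun (cyl L) (fun z => (excess z)%:E).
    by apply/measurable_funTS/measurable_EFinP; exact: mexcess.
  move=> [X _]; have : ae_eq mu (cyl L) (fun z => (excess z)%:E) (cst 0%E).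
    apply: X; rewrite -[RHS]E0; apply: eq_integral => z _; by rewrite /= ger0_norm.
  by apply: filterS => z h zc; have [] := h zc.
apply: filterS => z h zi1 zi2; move: h; rewrite /excess /inside zi1 zi2.
by move=> /eqP; rewrite eq_le ge_max subr_le0 => /andP[/andP[]].
Qed.

End morrey.

(** * Functions on the channel and their extensions *)

Section profile.
Context {R : realType} (a b : R) (v : R -> R).
Hypothesis ab : a < b.

Lemma C1_itv_bounded : C1_itv a b v -> exists V, forall y, a < y < b -> `|v y| <= V.
Proof.
move=> [cv _ _].
have [c1 _ h1] := EVT_max (ltW ab) cv; have [c2 _ h2] := EVT_min (ltW ab) cv.
exists (`|v c1| + `|v c2|) => y /andP[y1 y2].
have yI : y \in `[a, b] by rewrite in_itv/= !ltW.
have := h1 y yI; have := h2 y yI; rewrite ler_norml => l1 l2.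
have := ler_norm (v c1); have := ler_norm (- v c2); rewrite normrN.
by have := normr_ge0 (v c1); have := normr_ge0 (v c2); move=> *; apply/andP; split; lra.
Qed.

Lemma C1_itv_lipschitz : C1_itv a b v -> exists2 K, 0 <= K &
  forall x y, a < x -> x <= y -> y < b -> `|v y - v x| <= K * (y - x).
Proof.
move=> [_ dv [dv' cdv' dvE]].
have [c1 _ h1] := EVT_max (ltW ab) cdv'; have [c2 _ h2] := EVT_min (ltW ab) cdv'.
exists (`|dv' c1| + `|dv' c2|) => [|x y ax xy yb]; first by rewrite addr_ge0.
have [//||c cI ->] := @MVT_segment R v v^`()%classic x y xy.
- move=> t; rewrite in_itv/= => /andP[xt ty].
  rewrite derive1E; apply/derivableP; apply: dv.
  by rewrite in_itv/= (lt_trans ax xt) (lt_trans ty yb).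
- apply: derivable_within_continuous => t; rewrite in_itv/= => /andP[xt ty].
  by apply: dv; rewrite in_itv/= (lt_le_trans ax xt) (le_lt_trans ty yb).
rewrite normrM (ger0_norm (_ : 0 <= y - x)) ?subr_ge0// ler_wpM2r ?subr_ge0//.
move: cI; rewrite in_itv/= => /andP[xc cy].
have cab : c \in `]a, b[ by rewrite in_itv/= (lt_le_trans ax xc) (le_lt_trans cy yb).
rewrite dvE//.
have yI : c \in `[a, b] by move: cab; rewrite !in_itv/= => /andP[? ?]; rewrite !ltW.
have := h1 c yI; have := h2 c yI; rewrite ler_norml => l1 l2.
have := ler_norm (dv' c1); have := ler_norm (- dv' c2); rewrite normrN.
by have := normr_ge0 (dv' c1); have := normr_ge0 (dv' c2); move=> *; apply/andP; split; lra.
Qed.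

Lemma inf_norm_le m y : inf [set `|v t| | t in `[a, b]] = m -> a < y < b -> m <= `|v y|.
Proof.
move=> <- /andP[ay yb]; apply: ge_inf.
- by exists 0 => _ [t _ <-].
- by exists y => //; rewrite /= in_itv/= !ltW.
Qed.

End profile.

Section extension.
Context {R : realType} (L a b : R).
Hypothesis L_gt0 : 0 < L.
Notation mu := (leb2 R).
Notation pe := (pext L a b).

(* Stated for abstract functions, so that no unification ever unfolds [weak_deriv]. *)
Lemma pext_advection (f g h k : R * R -> R) z :
  pe (fun z => - (f z * g z + h z * k z)) z = - (pe f z * pe g z + pe h z * pe k z).
Proof. by rewrite !(pextE L_gt0); case: ifP => _ //; rewrite !mulr0 addr0 oppr0. Qed.

Lemma pext_add_eq0 (f g : R * R -> R) (z : R * R) : a < z.2 < b ->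
  f (wrap L z.1, z.2) + g (wrap L z.1, z.2) = 0 -> pe f z + pe g z = 0.
Proof. by move=> zs; rewrite !(pextE L_gt0) zs. Qed.

Lemma pext_out f (z : R * R) : ~~ (a < z.2 < b) -> pe f z = 0.
Proof. by move=> zs; rewrite (pextE L_gt0) (negbTE zs). Qed.

Lemma ae_channel_strip (P : R * R -> Prop) :
  {ae mu, forall z, channel L a b z -> P z} ->
  {ae mu, forall z : R * R, a < z.2 < b -> P (wrap L z.1, z.2)}.
Proof.
move=> aP; apply: (ae_xper L_gt0).
  by move=> z; rewrite /= addr0 wrapD.
apply: filterS aP => -[x y] h [xL _] ys.
have xL' : x \in `[0, L[ by [].
by rewrite /= (wrap_id L_gt0 xL'); apply: h; split => //=; rewrite in_itv.
Qed.

(** Local integrability gives measurability only on inner strips; the extension from the whole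
    channel is the pointwise limit of those from the strips. *)
Lemma measurable_pext_loc f : loc_integrable L a b f -> measurable_fun setT (pe f).
Proof.
move=> lf.
apply: (@measurable_fun_cvg _ _ _ setT (fun n => pext L (a + n.+1%:R^-1) (b - n.+1%:R^-1) f)).
- move=> n; apply: (loc_integrable_pext L_gt0 lf _ _).1.
    by rewrite ltrDl invr_gt0.
  by rewrite ltrBlDr ltrDl invr_gt0.
- move=> z _; have [zs|zs] := boolP (a < z.2 < b); last first.
    rewrite pext_out//; rewrite (_ : (fun n => _) = fun=> 0); first exact: cvg_cst.
    apply/funext => n; rewrite (pextE L_gt0) ifF//; apply: contraNF zs => /andP[z1 z2].
    rewrite (lt_trans _ z1) ?ltrDl ?invr_gt0// (lt_trans z2)//.
    by rewrite ltrBlDr ltrDl invr_gt0.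
  have [az zb] := andP zs.
  have c0 : (fun n : nat => pe f z) @ \oo --> pe f z by exact: cvg_cst.
  apply: cvg_trans c0; apply: near_eq_cvg.
  have N1 : \forall n \near \oo, n.+1%:R^-1 < z.2 - a.
    by apply: near_harmonic_lt; rewrite subr_gt0.
  have N2 : \forall n \near \oo, n.+1%:R^-1 < b - z.2.
    by apply: near_harmonic_lt; rewrite subr_gt0.
  apply: filterS2 N1 N2 => n h1 h2; apply/esym; apply: (pext_sub L_gt0).
  - by rewrite lerDl invr_ge0.
  - by rewrite gerBl invr_ge0.
  - by rewrite -ltrBrDl h1/= ltrBrDr -ltrBrDl.
Qed.

(** Identifies any weak derivative almost everywhere as a limit of difference quotients. This allows
    the chosen representatives for u1 and for u1 - v to be compared. *)
Lemma weak_deriv_cvg e f g : e = ex \/ e = ey -> is_weak_deriv L a b e f g ->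
  {ae mu, forall z : R * R, a < z.2 < b ->
    (fun n : nat => n.+1%:R * (pe f (z + n.+1%:R^-1 *: e) - pe f z)) @ \oo --> pe g z}.
Proof.
move=> he wfg; have [lf lg _] := wfg.
have e20 : 0 <= e.2 <= 1 by case: he => -> /=; rewrite lexx ler01.
have hk k : a < a + k.+1%:R^-1 by rewrite ltrDl invr_gt0.
have hk' k : b - k.+1%:R^-1 < b by rewrite ltrBlDr ltrDl invr_gt0.
have : {ae mu, forall z : R * R, forall k : nat, a + k.+1%:R^-1 < z.2 < b - k.+1%:R^-1 ->
    (fun n : nat => n.+1%:R * (pext L (a + k.+1%:R^-1) (b - k.+1%:R^-1) f (z + n.+1%:R^-1 *: e) -
       pext L (a + k.+1%:R^-1) (b - k.+1%:R^-1) f z)) @ \oo --> pext L (a + k.+1%:R^-1) (b - k.+1%:R^-1) g z}.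
  apply/ae_foralln => k.
  have [mg ig] := loc_integrable_pext L_gt0 lg (hk k) (hk' k).
  have D : diffq (a + k.+1%:R^-1) (b - k.+1%:R^-1) e
      (pext L (a + k.+1%:R^-1) (b - k.+1%:R^-1) f) (pext L (a + k.+1%:R^-1) (b - k.+1%:R^-1) g).
    by move=> h h0; exact: (weak_deriv_difference L_gt0 he wfg (hk k) (hk' k) h0).
  by apply: filterS (diffq_cvg L_gt0 he mg (xper_pext L_gt0 _ _ _) ig D) => z h zs; case: (h zs).
apply: filterS => z hz /andP[az zb].
have [k [k1 k2]] : exists k : nat, a + k.+1%:R^-1 < z.2 /\ z.2 < b - k.+1%:R^-1.
  have N1 : \forall n \near \oo, n.+1%:R^-1 < z.2 - a.
    by apply: near_harmonic_lt; rewrite subr_gt0.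
  have N2 : \forall n \near \oo, n.+1%:R^-1 < b - z.2.
    by apply: near_harmonic_lt; rewrite subr_gt0.
  have [n _ /(_ n (leqnn n)) [h1 h2]] := filterI N1 N2.
  by exists n; rewrite -ltrBrDl h1 ltrBrDr -ltrBrDl.
have zk : a + k.+1%:R^-1 < z.2 < b - k.+1%:R^-1 by rewrite k1.
have := hz k zk.
rewrite (pext_sub L_gt0 g (ltW (hk k)) (ltW (hk' k)) zk); apply: cvg_trans; apply: near_eq_cvg.
have N1 : \forall n \near \oo, n.+1%:R^-1 < b - k.+1%:R^-1 - z.2.
  by apply: near_harmonic_lt; rewrite subr_gt0.
apply: filterS N1 => n hn.
rewrite !(pext_sub L_gt0 f (ltW (hk k)) (ltW (hk' k)))//.
rewrite (_ : (z + _).2 = z.2 + n.+1%:R^-1 * e.2)//.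
case/andP: e20 => e0 e1; rewrite (lt_le_trans k1) ?lerDl ?mulr_ge0 ?invr_ge0//=.
by rewrite -ltrBrDl; apply: le_lt_trans hn; rewrite ler_piMr ?invr_ge0.
Qed.

Lemma L12_le (f g h : R * R -> R) C : measurable_fun setT f -> xper L f ->
  L12 L g -> L12 L h -> {ae mu, forall z, `|f z| <= C * (`|g z| + `|h z|)} -> 0 <= C -> L12 L f.
Proof.
move=> mf pf [mg pg g1 g2] [mh ph h1 h2] fle C0; have mc := measurable_cyl L.
have M (k : R * R -> R) : measurable_fun setT k -> measurable_fun (cyl L) (fun z => `|k z|%:E).
  by move=> mk; apply/measurable_funTS/measurable_EFinP; exact: measurableT_comp.
have M2 (k : R * R -> R) : measurable_fun setT k -> measurable_fun (cyl L) (fun z => (k z ^+ 2)%:E).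
  by move=> mk; apply/measurable_funTS/measurable_EFinP; exact: measurable_funX.
split => //.
- apply: (@le_lt_trans _ _ (\int[mu]_(z in cyl L) (C%:E * (`|g z|%:E + `|h z|%:E)))%E).
    apply: ae_ge0_le_integral => //.
    + exact: M.
    + by move=> z _; rewrite -EFinD -EFinM lee_fin mulr_ge0// addr_ge0.
    + by apply: emeasurable_funM; [exact: measurable_cst|apply: emeasurable_funD; exact: M].
    + by apply: filterS fle => z h' _; rewrite -EFinD -EFinM lee_fin.
  rewrite ge0_integralZl//; last 2 first.
  + by first [by apply: emeasurable_funD; exact: M|by move=> z _; rewrite -EFinD lee_fin addr_ge0].
  + by first [by apply: emeasurable_funD; exact: M|by move=> z _; rewrite -EFinD lee_fin addr_ge0].
  rewrite ge0_integralD//; [|exact: M|exact: M].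
  by rewrite lte_mul_pinfty// lte_add_pinfty.
- apply: (@le_lt_trans _ _ (\int[mu]_(z in cyl L) ((2 * C ^+ 2)%:E * ((g z ^+ 2)%:E + (h z ^+ 2)%:E)))%E).
    apply: ae_ge0_le_integral => //.
    + by move=> z _; rewrite lee_fin sqr_ge0.
    + exact: M2.
    + by move=> z _; rewrite -EFinD -EFinM lee_fin mulr_ge0 ?addr_ge0 ?sqr_ge0// mulr_ge0 ?sqr_ge0.
    + by apply: emeasurable_funM; [exact: measurable_cst|apply: emeasurable_funD; exact: M2].
    + apply: filterS fle => z h' _; rewrite -EFinD -EFinM lee_fin.
      rewrite -(real_normK (num_real (f z))) -(real_normK (num_real (g z))) -(real_normK (num_real (h z))).
      apply: (@le_trans _ _ ((C * (`|g z| + `|h z|)) ^+ 2)); first by rewrite lerXn2r ?nnegrE ?mulr_ge0 ?addr_ge0.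
      rewrite exprMn [2 * _]mulrC -[leRHS]mulrA; apply: ler_wpM2l; first exact: sqr_ge0.
      by have := sqr_ge0 (`|g z| - `|h z|); rewrite sqrrB sqrrD; lra.
  rewrite ge0_integralZl//; last 3 first.
  + by apply: emeasurable_funD; exact: M2.
  + by move=> z _; rewrite -EFinD lee_fin addr_ge0 ?sqr_ge0.
  + by rewrite lee_fin mulr_ge0 ?sqr_ge0.
  rewrite ge0_integralD//; last 4 first.
  + by move=> z _; rewrite lee_fin sqr_ge0.
  + exact: M2.
  + by move=> z _; rewrite lee_fin sqr_ge0.
  + exact: M2.
  by rewrite lte_mul_pinfty ?lee_fin ?mulr_ge0 ?sqr_ge0// lte_add_pinfty.
Qed.

End extension.

Section lebesgue_space.
Context {R : realType} (L a b p : R).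
Hypotheses (L_gt0 : 0 < L) (p_gt2 : 2 < p).
Notation mu := (leb2 R).
Notation pe := (pext L a b).

Let p_gt0 : 0 < p. Proof. by rewrite (lt_trans _ p_gt2). Qed.

Lemma Lp_pext f (N : R) : 0 < N -> in_Lp L a b p f -> (Lp_norm L a b p f < N%:E)%E ->
  measurable_fun setT (pe f) /\ (\int[mu]_(z in cyl L) (`|pe f z| `^ p)%:E <= (N `^ p)%:E)%E.
Proof.
move=> N0 fp; rewrite /Lp_norm => fN; move: fp; rewrite /in_Lp inE => /andP[/[!inE]/= mf _].
have mch : measurable (channel L a b) := measurable_channel L a b.
have mf' : measurable_fun (channel L a b) f := (measurable_restrictT f mch).2 mf.
split; first exact: measurable_pext.
have -> : (\int[mu]_(z in cyl L) (`|pe f z| `^ p)%:E =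
    \int[mu]_z ((abse ((EFin \o f \_ (channel L a b)) z)) `^ p))%E.
  rewrite [LHS]integral_mkcond; apply: eq_integral => -[x y] _; rewrite patchE /=.
  rewrite patchE /cyl /channel !in_setX !mem_itv_set in_setT andbT (pextE L_gt0) /=.
  have -> : (y \in `]a, b[) = (a < (y : R) < b) by rewrite in_itv.
  have p0 : (point : R) = 0 by [].
  case: ifPn => xL /=; first by rewrite (wrap_id L_gt0 xL).
  by rewrite p0 normr0 powR0 ?gt_eqF.
rewrite -poweR_Lnorm ?gt_eqF// -poweR_EFin.
apply: gt0_ler_poweR => //; rewrite ?in_itv/= ?leey ?andbT ?Lnorm_ge0 ?lee_fin ?ltW//.
Qed.

Lemma L12_strip : L12 L (fun z : R * R => if a < z.2 < b then 1 else 0).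
Proof.
have m1 : measurable_fun setT (fun z : R * R => if a < z.2 < b then 1 else 0 : R).
  apply: measurable_fun_ifT => //; apply: measurable_and; exact: measurable_fun_ltr.
have h := strip_measure_lty L_gt0 a b; split => //.
- by move=> z; rewrite /= addr0.
- by under eq_integral do rewrite (fun_if (fun t : R => `|t|)) normr1 normr0.
- by under eq_integral do rewrite (fun_if (fun t : R => t ^+ 2)) expr1n expr0n.
Qed.

(** For p > 2 both t and t^2 are at most 1 + t^p, and the function vanishes outside a strip of
    finite measure. *)
Lemma L12_Lp f : measurable_fun setT (pe f) ->
  (\int[mu]_(z in cyl L) (`|pe f z| `^ p)%:E < +oo)%E -> L12 L (pe f).
Proof.
move=> mf ip; have mc := measurable_cyl L.
have [m1 _ _ i1] := L12_strip.
pose ind (z : R * R) : R := if a < z.2 < b then 1 else 0.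
have le1 (t : R) : 0 <= t -> t <= 1 + t `^ p.
  move=> t0; have := @le_absorb_powR R p 1 t; rewrite powR1 mul1r; apply => //.
  by rewrite (le_trans _ (ltW p_gt2))// ler1n.
have le2 (t : R) : 0 <= t -> t ^+ 2 <= 1 + t `^ p.
  move=> t0; have [t1|t1] := leP t 1.
    by rewrite (le_trans (exprn_ile1 2 t0 t1))// lerDl powR_ge0.
  rewrite -powR_mulrn// -[leLHS]add0r lerD//; apply: ler_powR; [exact: ltW|exact: ltW].
have mp : measurable_fun setT (fun z => `|pe f z| `^ p).
  by apply: (measurableT_comp (measurable_powR p)); exact: measurableT_comp.
have B : (\int[mu]_(z in cyl L) ((ind z)%:E + (`|pe f z| `^ p)%:E) < +oo)%E.
  have i0 z : (0 <= (ind z)%:E)%E by rewrite lee_fin /ind; case: ifP.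
  have q0 z : (0 <= (`|pe f z| `^ p)%:E)%E by rewrite lee_fin powR_ge0.
  rewrite ge0_integralD//; last 2 first.
  - exact/measurable_funTS/measurable_EFinP.
  - exact/measurable_funTS/measurable_EFinP.
  by rewrite lte_add_pinfty//; exact: strip_measure_lty.
have out (z : R * R) (F : R -> R) : F 0 = 0 -> (forall t, 0 <= t -> F t <= 1 + t `^ p) ->
    F `|pe f z| <= ind z + `|pe f z| `^ p.
  move=> F0 Fle; rewrite /ind; case: ifPn => zs; first exact: Fle.
  by rewrite (pext_out L_gt0)// normr0 F0 add0r powR_ge0.
split => //.
- exact: xper_pext.
- apply: le_lt_trans B; apply: ge0_le_integral => //.
  + by apply/measurable_funTS/measurable_EFinP; exact: measurableT_comp.
  + by apply: emeasurable_funD; exact/measurable_funTS/measurable_EFinP.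
  + by move=> z _; rewrite -EFinD lee_fin; apply: (out z id).
- apply: le_lt_trans B; apply: ge0_le_integral => //.
  + by move=> z _; rewrite lee_fin sqr_ge0.
  + by apply/measurable_funTS/measurable_EFinP; exact: measurable_funX.
  + by apply: emeasurable_funD; exact/measurable_funTS/measurable_EFinP.
  + move=> z _; rewrite -EFinD lee_fin -real_normK ?num_real//.
    by apply: (out z (fun t => t ^+ 2)); rewrite ?expr0n.
Qed.

Lemma abs_lint_le e t (g : R * R -> R) z : measurable_fun setT g ->
  (`|lint e t g z|%:E <= \int[@lebesgue_measure R]_(s in `[0%R, t]) `|g (z + s *: e)%R|%:E)%E.
Proof.
move=> mg; rewrite /lint /Rintegral -abse_EFin; apply: le_trans (le_abse_fine _) _.
apply: le_trans (le_abse_integral _ _ _) _ => //.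
by apply/measurable_funTS/measurable_EFinP; exact: (measurableT_comp mg (measurable_line e z)).
Qed.

Lemma diffq_increments e (f g : R * R -> R) : e = ex \/ e = ey -> measurable_fun setT g ->
  diffq a b e f g -> increments a b e f g /\ increments a b (- e) f g.
Proof.
move=> he mg dfg; split => t t0.
- apply: filterS (dfg t t0) => z h /andP[az zb] /andP[az' zb']; rewrite h//.
  exact: abs_lint_le.
- apply: filterS (diffq_backward mg dfg t0) => z h /andP[az zb] /andP[az' zb'].
  rewrite scalerN in az' zb' *.
  by rewrite distrC h//; exact: abs_lint_le.
Qed.

(** Squares going up are used where z.2 + H < b and squares going down elsewhere; the condition H +
    H < b - a leaves room for one of them at every height. *)
Lemma morrey_bound f gx gy (N H : R) : 0 < N -> 0 < H -> H <= L -> H + H < b - a ->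
  is_weak_deriv L a b ex f gx -> is_weak_deriv L a b ey f gy ->
  in_Lp L a b p f -> (Lp_norm L a b p f < N%:E)%E ->
  in_Lp L a b p gx -> (Lp_norm L a b p gx < N%:E)%E ->
  in_Lp L a b p gy -> (Lp_norm L a b p gy < N%:E)%E ->
  {ae mu, forall z : R * R, a < z.2 < b -> `|pe f z| <= N * morrey_const p H}.
Proof.
move=> N0 H0 HL Hab wx wy pf Nf px Nx py Ny.
have [mf If] := Lp_pext N0 pf Nf; have [mx Ix] := Lp_pext N0 px Nx; have [my Iy] := Lp_pext N0 py Ny.
have [_ pf' if1 _] := L12_Lp mf (le_lt_trans If (ltry _)).
have [_ px' ix1 _] := L12_Lp mx (le_lt_trans Ix (ltry _)).
have [_ py' iy1 _] := L12_Lp my (le_lt_trans Iy (ltry _)).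
have [incx _] := diffq_increments (or_introl erefl) mx (weak_deriv_diffq L_gt0 (or_introl erefl) wx).
have [incy incyN] := diffq_increments (or_intror erefl) my (weak_deriv_diffq L_gt0 (or_intror erefl) wy).
have incy1 : increments a b (1 *: ey) (pe f) (pe gy) by rewrite scale1r.
have incy2 : increments a b (-1 *: ey) (pe f) (pe gy) by rewrite scaleN1r.
have M1 := morrey_half L_gt0 p_gt2 N0 H0 HL (or_introl erefl) mf pf' mx px' my py' if1 ix1 iy1 If Ix Iy incx incy1.
have M2 := morrey_half L_gt0 p_gt2 N0 H0 HL (or_intror erefl) mf pf' mx px' my py' if1 ix1 iy1 If Ix Iy incx incy2.
apply: filterS2 M1 M2 => z h1 h2 zs; have [az zb] := andP zs.
have [zH|zH] := ltP (z.2 + H) b.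
  by apply: h1 => //; rewrite mul1r zH andbT (lt_trans az)// ltrDl.
by apply: h2 => //; rewrite mulN1r; apply/andP; split; lra.
Qed.

End lebesgue_space.

(** * Smallness near the walls from the boundary condition *)

Section trace.
Context {R : realType} (L a b : R).
Hypotheses (L_gt0 : 0 < L) (ab : a < b).
Notation mu := (leb2 R).

(** Continuity gives a distance eta at each point of the wall; compactness of [0, L], used as a
    near-covering property, makes it uniform. *)
Lemma small_near_side (g : R * R -> R) y0 del : {within [set: R] `*` `[a, b], continuous g} ->
  y0 \in `[a, b] -> (forall x, g (x, y0) = 0) -> 0 < del ->
  exists2 eta, 0 < eta & forall x y, x \in `[0, L] -> y \in `[a, b] -> `|y - y0| < eta ->
    `|g (x, y)| <= del.
Proof.
move=> cg y0I g0 del0.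
have := @segment_compact R 0 L => /compact_near_coveringP.
move=> /(_ R 0^'+ (fun eta x => forall y, y \in `[a, b] -> `|y - y0| < eta -> `|g (x, y)| <= del)) C.
have : \forall eta \near 0^'+, `[0, L]%classic `<=`
    [set x | forall y, y \in `[a, b] -> `|y - y0| < eta -> `|g (x, y)| <= del].
  apply: C => x xI.
  move/subspace_continuousP : cg => /(_ (x, y0)) cg.
  have : ([set: R] `*` `[a, b]) (x, y0) by [].
  move=> /cg /cvgr_dist_le /(_ _ del0); rewrite near_withinE.
  move=> /nbhs_ballP[e /= e0 He].
  exists (ball x e, [set eta | eta < e]) => /=.
    by split; [exact: nbhsx_ballx|exact: nbhs_right_lt].
  move=> [x' eta] /= [xx' etae] y yI yeta.
  have := He (x', y); rewrite /from_subspace g0 sub0r normrN; apply; last by [].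
  by split => //=; rewrite /ball /= distrC; exact: lt_trans etae.
move=> H; have [eta [h eta0]] := filter_ex (filterI H (nbhs_right_gt (0 : R))).
by exists eta => // x y xI; exact: h.
Qed.

Lemma zero_trace_small f : zero_trace L a b f -> forall del, 0 < del ->
  exists2 eta, 0 < eta & {ae mu, forall z : R * R, channel L a b z ->
    ~~ (a + eta <= z.2 <= b - eta) -> `|f z| <= del}.
Proof.
move=> [g [cg _ fg g0]] del del0.
have aI : a \in `[a, b] by rewrite in_itv/= lexx ltW.
have bI : b \in `[a, b] by rewrite in_itv/= lexx ltW.
have [e1 e10 h1] := small_near_side cg aI (fun x => (g0 x).1) del0.
have [e2 e20 h2] := small_near_side cg bI (fun x => (g0 x).2) del0.
exists (Num.min e1 e2); first by rewrite lt_min e10.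
apply: filterS fg => -[x y] h zc; rewrite (h zc); case: zc => /=; rewrite !in_itv/= => /andP[x0 xL] /andP[ay yb].
have xI : x \in `[0, L] by rewrite in_itv/= x0 ltW.
have yI : y \in `[a, b] by rewrite in_itv/= !ltW.
rewrite negb_and -!ltNge => /orP[h3|h3].
  apply: h1 => //; rewrite ger0_norm ?subr_ge0 ?ltW// ltrBlDl (lt_le_trans h3)// lerD2l.
  by rewrite ge_min lexx.
apply: h2 => //; rewrite distrC ger0_norm ?subr_ge0 ?ltW// ltrBlDl -ltrBlDr (le_lt_trans _ h3)// lerB//.
by rewrite ge_min lexx orbT.
Qed.

End trace.

Lemma perturbed_profile_bounds (R : realFieldType) (w v m V : R) : `|w| <= m / 2 -> m <= `|v| ->
  `|v| <= V -> m / 2 <= `|w + v| <= V + m.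
Proof.
move=> wm mv vV; have w0 := normr_ge0 w; have := ler_normD w v.
have := ler_normB (w + v) w; rewrite [w + v]addrC addrK => h1 h2.
by apply/andP; split; lra.
Qed.

Lemma norm_le_near (R : realFieldType) (x y K : R) : 0 <= K -> `|x - y| <= K ->
  `|x| <= (1 + K) * (`|y| + 1).
Proof.
move=> K0 h; have := ler_normD (x - y) y; rewrite subrK => /le_trans; apply.
by have := mulr_ge0 K0 (normr_ge0 y); lra.
Qed.

(** * Comparison of u1 with u1 - v *)

Section perturbation.
Context {R : realType} (L a b p : R).
Hypotheses (L_gt0 : 0 < L) (ab : a < b) (p_gt2 : 2 < p).
Notation mu := (leb2 R).
Notation pe := (pext L a b).

Lemma W1p_norm_lt f (N : \bar R) : (W1p_norm L a b p f < N)%E ->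
  [/\ Lp_norm L a b p f < N, Lp_norm L a b p (weak_deriv L a b ex f) < N &
      Lp_norm L a b p (weak_deriv L a b ey f) < N]%E.
Proof.
rewrite /W1p_norm; have n0 g : (0 <= Lp_norm L a b p g)%E by exact: Lnorm_ge0.
move=> h; split; apply: le_lt_trans h.
- by rewrite -addeA leeDl// adde_ge0.
- by rewrite addeAC leeDr// adde_ge0.
- by rewrite leeDr// adde_ge0.
Qed.

Lemma W1p_norm_field_lt u (N : \bar R) : (W1p_norm_field L a b p u < N)%E ->
  (W1p_norm L a b p (fst \o u) < N)%E /\ (W1p_norm L a b p (snd \o u) < N)%E.
Proof.
rewrite /W1p_norm_field; have n0 g : (0 <= W1p_norm L a b p g)%E by rewrite !adde_ge0 ?Lnorm_ge0.
by move=> h; split; apply: le_lt_trans h; [rewrite leeDl|rewrite leeDr].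
Qed.

Lemma weak_derivP e f : weakly_derivable L a b e f -> is_weak_deriv L a b e f (weak_deriv L a b e f).
Proof. by move=> /(xgetPex (cst 0)). Qed.

(** Changes on a null set do not affect [diffq]; this lets the velocity be replaced by a version
    bounded everywhere. *)
Lemma diffq_ae e (f f' g : R * R -> R) : 0 <= e.2 -> {ae mu, forall z : R * R, a < z.2 < b -> f' z = f z} ->
  diffq a b e f g -> diffq a b e f' g.
Proof.
move=> e0 ff df h h0.
apply: filterS3 (df h h0) ff (ae_leb2_shift (h *: e) ff) => z h1 h2 h3 az zb.
have he : 0 <= h * e.2 by rewrite mulr_ge0// ltW.
rewrite h2 ?h3 ?h1//.
- by rewrite (_ : (z + _).2 = z.2 + h * e.2)// zb andbT (lt_le_trans az)// lerDl.
- by rewrite az (le_lt_trans _ zb)// lerDl.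
Qed.

Lemma pext_sub_profile (v : R -> R) (f g : R * R -> R) (z : R * R) : (forall z, g z = f z - v z.2) ->
  a < z.2 < b -> pe f z = pe g z + v z.2.
Proof. by move=> gE zs; rewrite !(pextE L_gt0) zs gE subrK. Qed.

(** The profile depends on y alone, so both functions have the same horizontal difference
    quotients. *)
Lemma weak_deriv_profile_ex (v : R -> R) (f g f' g' : R * R -> R) : (forall z, g z = f z - v z.2) ->
  is_weak_deriv L a b ex f f' -> is_weak_deriv L a b ex g g' ->
  {ae mu, forall z : R * R, a < z.2 < b -> pe f' z = pe g' z}.
Proof.
move=> gE wf wg.
apply: filterS2 (weak_deriv_cvg L_gt0 (or_introl erefl) wf) (weak_deriv_cvg L_gt0 (or_introl erefl) wg).
move=> z h1 h2 zs; apply: cvg_unique (h1 zs) _ => //.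
rewrite (_ : (fun n => _) = (fun n : nat => n.+1%:R * (pe g (z + n.+1%:R^-1 *: ex) - pe g z))); first exact: h2.
apply/funext => n; have z2 : (z + n.+1%:R^-1 *: ex).2 = z.2 by rewrite /= [_ *: 0]mulr0 addr0.
by rewrite !(pext_sub_profile gE) ?z2//; congr (_ * _); ring.
Qed.

(** The vertical quotients differ by those of v, bounded by its Lipschitz constant; the bound passes
    to the limit. *)
Lemma weak_deriv_profile_ey (v : R -> R) (K : R) (f g f' g' : R * R -> R) : (forall z, g z = f z - v z.2) ->
  (forall x y, a < x -> x <= y -> y < b -> `|v y - v x| <= K * (y - x)) ->
  is_weak_deriv L a b ey f f' -> is_weak_deriv L a b ey g g' ->
  {ae mu, forall z : R * R, a < z.2 < b -> `|pe f' z - pe g' z| <= K}.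
Proof.
move=> gE vK wf wg.
apply: filterS2 (weak_deriv_cvg L_gt0 (or_intror erefl) wf) (weak_deriv_cvg L_gt0 (or_intror erefl) wg).
move=> z h1 h2 zs; have [az zb] := andP zs.
have c1 : (fun n : nat => `|n.+1%:R * (pe f (z + n.+1%:R^-1 *: ey) - pe f z) -
    n.+1%:R * (pe g (z + n.+1%:R^-1 *: ey) - pe g z)|) @ \oo --> `|pe f' z - pe g' z|.
  by apply: cvg_norm; apply: cvgB; [exact: h1|exact: h2].
apply: (ler_cvg_to c1 (@cvg_cst _ K nat \oo _)).
have N1 : \forall n \near \oo, n.+1%:R^-1 < b - z.2.
  by apply: near_harmonic_lt; rewrite subr_gt0.
apply: filterS N1 => n hn /=.
have z2 : (z + n.+1%:R^-1 *: ey).2 = z.2 + n.+1%:R^-1 by rewrite /= [_ *: 1]mulr1.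
have n0 : 0 < n.+1%:R^-1 :> R by rewrite invr_gt0.
have zb' : z.2 + n.+1%:R^-1 < b by rewrite -ltrBrDl.
have zs' : a < (z + n.+1%:R^-1 *: ey).2 < b by rewrite z2 zb' andbT (lt_trans az)// ltrDl.
rewrite (pext_sub_profile gE zs') (pext_sub_profile gE zs) z2.
rewrite (_ : _ - _ = n.+1%:R * (v (z.2 + n.+1%:R^-1) - v z.2)); last by ring.
have zz : z.2 <= z.2 + n.+1%:R^-1 by rewrite lerDl ltW.
have := vK z.2 (z.2 + n.+1%:R^-1) az zz zb'.
by rewrite [z.2 + _]addrC addrK ler_pdivlMr// normrM ger0_norm// mulrC.
Qed.

End perturbation.

Theorem theorem7p1 (R : realType) (L a b p m M : R)
  (L_gt0 : 0 < L) (a_lt_b : a < b) (p_gt2 : 2 < p) (m_gt0 : 0 < m) :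
  exists eps : R, 0 < eps /\
    forall v : R -> R,
      C1_itv a b v ->
      inf [set `|v y| | y in `[a, b]] = m ->
      C1_norm a b v = M ->
      forall u : R * R -> R * R,
        stationary_euler L a b u ->
        in_W1p_field L a b p (u \- shear v) ->
        (W1p_norm_field L a b p (u \- shear v)%R < eps%:E)%E ->
        is_shear_flow L a b u.
Proof.
(* The squares must fit in one period, and twice their side in the height of the channel. *)
pose H := Num.min L ((b - a) / 4); pose Kc := morrey_const p H.
have ba : 0 < b - a by rewrite subr_gt0.
have H0 : 0 < H by rewrite lt_min L_gt0 divr_gt0.
have HL : H <= L by rewrite ge_min lexx.
have Hab : H + H < b - a.
  have : H <= (b - a) / 4 by rewrite ge_min lexx orbT.
  lra.
have Kc0 : 0 < `|Kc| + 1 by rewrite ltr_wpDl.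
(* Morrey's bound eps Kc on u1 - v is then at most m / 2, so |u1| >= m / 2; adding 1 keeps the
   denominator positive. *)
exists (m / 2 / (`|Kc| + 1)); set eps := m / 2 / (`|Kc| + 1).
have eps0 : 0 < eps by rewrite !divr_gt0.
have epsK : eps * Kc <= m / 2.
  rewrite /eps mulrAC ler_pdivrMr// ler_pM2l ?divr_gt0//.
  by rewrite (le_trans (ler_norm _))// lerDl.
split => // v Cv infv _ u [[d1x d1y d2x d2y] [q [qx qy]] div tr] [W1 W2] /W1p_norm_field_lt[N1 N2].
pose u1 := fst \o u; pose u2 := snd \o u; pose w1 := fst \o (u \- shear v).
have E2 : snd \o (u \- shear v) = u2 by apply/funext => z; rewrite /u2 /= subr0.
rewrite E2 in W2 N2.
have E1 z : w1 z = u1 z - v z.2 by [].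
have [W1p W1dx W1dy W1px W1py] := W1; have [W2p W2dx W2dy W2px W2py] := W2.
have [N1f N1x N1y] := W1p_norm_lt N1; have [N2f N2x N2y] := W1p_norm_lt N2.
have k1x := weak_derivP d1x; have k1y := weak_derivP d1y.
have k2x := weak_derivP d2x; have k2y := weak_derivP d2y.
have j1x := weak_derivP W1dx; have j1y := weak_derivP W1dy.
have B1 := morrey_bound L_gt0 p_gt2 eps0 H0 HL Hab j1x j1y W1p N1f W1px N1x W1py N1y.
have B2 := morrey_bound L_gt0 p_gt2 eps0 H0 HL Hab k2x k2y W2p N2f W2px N2x W2py N2y.
have [V hV] := C1_itv_bounded a_lt_b Cv.
have [Lam Lam0 hLam] := C1_itv_lipschitz a_lt_b Cv.
pose pe := pext L a b; pose k := m / 2; pose K := V + m.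
have k0 : 0 < k by rewrite divr_gt0.
have mv y : a < y < b -> m <= `|v y| := inf_norm_le infv.
have V0 : m <= V.
  have mid : a < (a + b) / 2 < b by rewrite !midf_lt.
  exact: le_trans (mv _ mid) (hV _ mid).
have kK : k <= K by rewrite /k /K; lra.
have K0 : 0 <= K by exact: le_trans (ltW k0) kK.
have mK : m / 2 <= K by [].
(* The energy argument asks for bounds at every point, Morrey's inequality gives them almost
   everywhere in the strip. Elsewhere the values k and 0 are admissible defaults. *)
pose U1 z := if k <= `|pe u1 z| <= K then pe u1 z else k.
pose U2 z := if `|pe u2 z| <= K then pe u2 z else 0.
have Uae : {ae leb2 R, forall z : R * R, a < z.2 < b -> U1 z = pe u1 z /\ U2 z = pe u2 z}.
  apply: filterS2 B1 B2 => z h1 h2 zs.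
  have {}h1 : `|pe w1 z| <= m / 2 := le_trans (h1 zs) epsK.
  have {}h2 : `|pe u2 z| <= m / 2 := le_trans (h2 zs) epsK.
  have eU : pe u1 z = pe w1 z + v z.2 := pext_sub_profile L_gt0 E1 zs.
  rewrite /U1 /U2 eU.
  have bd := perturbed_profile_bounds h1 (mv _ zs) (hV _ zs).
  by split; rewrite ifT//; exact: le_trans h2 mK.
have Uae1 : {ae leb2 R, forall z : R * R, a < z.2 < b -> U1 z = pe u1 z}.
  by apply: filterS Uae => z h zs; case: (h zs).
have Uae2 : {ae leb2 R, forall z : R * R, a < z.2 < b -> U2 z = pe u2 z}.
  by apply: filterS Uae => z h zs; case: (h zs).
have mu1 : measurable_fun setT (pe u1) by case: k1x => l _ _; exact: measurable_pext_loc.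
have mu2 : measurable_fun setT (pe u2) by case: k2x => l _ _; exact: measurable_pext_loc.
have mU1 : measurable_fun setT U1.
  apply: measurable_fun_ifT => //; first apply: measurable_and.
  - by apply: measurable_fun_ler => //; exact: measurableT_comp.
  - by apply: measurable_fun_ler => //; exact: measurableT_comp.
have mU2 : measurable_fun setT U2.
  by apply: measurable_fun_ifT => //; apply: measurable_fun_ler => //; exact: measurableT_comp.
have pU1 : xper L U1 by move=> z; rewrite /U1 /pe (xper_pext L_gt0).
have pU2 : xper L U2 by move=> z; rewrite /U2 /pe (xper_pext L_gt0).
have U1b z : k <= `|U1 z| <= K.
  by rewrite /U1; case: ifP => // _; rewrite (ger0_norm (ltW k0)) lexx.
have U2b z : `|U2 z| <= K by rewrite /U2; case: ifP => // _; rewrite normr0.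
have ey2 : 0 <= (@ey R).2 by rewrite ler01.
have ex2 : 0 <= (@ex R).2 by rewrite lexx.
have D1x := diffq_ae ex2 Uae1 (weak_deriv_diffq L_gt0 (or_introl erefl) k1x).
have D1y := diffq_ae ey2 Uae1 (weak_deriv_diffq L_gt0 (or_intror erefl) k1y).
have D2x := diffq_ae ex2 Uae2 (weak_deriv_diffq L_gt0 (or_introl erefl) k2x).
have D2y := diffq_ae ey2 Uae2 (weak_deriv_diffq L_gt0 (or_intror erefl) k2y).
have DQx := weak_deriv_diffq L_gt0 (or_introl erefl) qx.
have DQy := weak_deriv_diffq L_gt0 (or_intror erefl) qy.
set U1x := pext _ _ _ _ in D1x; set U1y := pext _ _ _ _ in D1y.
set U2x := pext _ _ _ _ in D2x; set U2y := pext _ _ _ _ in D2y.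
set G1 := (X in diffq _ _ _ _ X) in DQx; set G2 := (X in diffq _ _ _ _ X) in DQy.
have L12p f N : 0 < N -> in_Lp L a b p f -> (Lp_norm L a b p f < N%:E)%E -> L12 L (pe f).
  by move=> N0 fp fN; have [mf If] := Lp_pext L_gt0 p_gt2 N0 fp fN; apply: L12_Lp mf (le_lt_trans If (ltry _)).
have L2x : L12 L U2x by exact: L12p N2x.
have L2y : L12 L U2y by exact: L12p N2y.
have LW1x := L12p _ _ eps0 W1px N1x; have LW1y := L12p _ _ eps0 W1py N1y.
have LI := L12_strip a b L_gt0.
(* The derivatives of u1 differ from those of u1 - v by 0 and by at most [Lam], so [L12_le] applies
   with this constant and the indicator of the strip as second majorant. *)
have C0 : 0 <= 1 + Lam by rewrite addr_ge0.
have out f (z : R * R) : ~~ (a < z.2 < b) -> pe f z = 0 by exact: pext_out.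
have L1x : L12 L U1x.
  apply: (L12_le _ _ LW1x LI _ C0).
  - by case: k1x => _ l _; exact: measurable_pext_loc.
  - exact: xper_pext.
  - apply: filterS (weak_deriv_profile_ex L_gt0 E1 k1x j1x) => z h.
    have [zs|zs] := boolP (a < z.2 < b); last first.
      by have -> : U1x z = 0 := out _ _ zs; rewrite normr0 mulr_ge0// addr_ge0.
    by rewrite normr1 /U1x (h zs) mulrDl mul1r -addrA lerDl addr_ge0// mulr_ge0// addr_ge0.
have L1y : L12 L U1y.
  apply: (L12_le _ _ LW1y LI _ C0).
  - by case: k1y => _ l _; exact: measurable_pext_loc.
  - exact: xper_pext.
  - apply: filterS (weak_deriv_profile_ey L_gt0 E1 hLam k1y j1y) => z h.
    have [zs|zs] := boolP (a < z.2 < b); last first.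
      by have -> : U1y z = 0 := out _ _ zs; rewrite normr0 mulr_ge0// addr_ge0.
    by rewrite normr1; exact: norm_le_near (h zs).
have G1E z : G1 z = - (pe u1 z * U1x z + pe u2 z * U1y z).
  exact: (@pext_advection R L a b L_gt0 u1 (weak_deriv L a b ex u1) u2 (weak_deriv L a b ey u1) z).
have G2E z : G2 z = - (pe u1 z * U2x z + pe u2 z * U2y z).
  exact: (@pext_advection R L a b L_gt0 u1 (weak_deriv L a b ex u2) u2 (weak_deriv L a b ey u2) z).
have prod_le (s t x y : R) : `|s| <= K -> `|t| <= K -> `|- (s * x + t * y)| <= K * (`|x| + `|y|).
  move=> sK tK; rewrite normrN (le_trans (ler_normD _ _))// !normrM mulrDr.
  by rewrite lerD// ler_wpM2r.
have LG1 : L12 L G1.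
  apply: (L12_le _ _ L1x L1y _ K0).
  - by case: qx => _ l _; exact: measurable_pext_loc.
  - exact: xper_pext.
  - apply: filterS Uae => z h; have [zs|zs] := boolP (a < z.2 < b); last first.
      by have -> : G1 z = 0 := out _ _ zs; rewrite normr0 mulr_ge0// addr_ge0.
    by rewrite G1E; have [<- <-] := h zs; apply: prod_le => //; case/andP: (U1b z).
have LG2 : L12 L G2.
  apply: (L12_le _ _ L2x L2y _ K0).
  - by case: qy => _ l _; exact: measurable_pext_loc.
  - exact: xper_pext.
  - apply: filterS Uae => z h; have [zs|zs] := boolP (a < z.2 < b); last first.
      by have -> : G2 z = 0 := out _ _ zs; rewrite normr0 mulr_ge0// addr_ge0.
    by rewrite G2E; have [<- <-] := h zs; apply: prod_le => //; case/andP: (U1b z).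
have divU : {ae leb2 R, forall z : R * R, a < z.2 < b -> U1x z + U2y z = 0}.
  apply: filterS (ae_channel_strip L_gt0 div) => z h zs.
  exact: (pext_add_eq0 L_gt0) zs (h zs).
have mom : {ae leb2 R, forall z : R * R, a < z.2 < b ->
    [/\ G1 z = - (U1 z * U1x z + U2 z * U1y z), G2 z = - (U1 z * U2x z + U2 z * U2y z) &
        U1x z + U2y z = 0]}.
  apply: filterS2 Uae divU => z h1 h2 zs; have [e1 e2] := h1 zs.
  by split; [rewrite e1 e2 G1E|rewrite e1 e2 G2E|exact: h2].
have lq : loc_integrable L a b q by case: qx.
have iQ c d : a < c -> d < b ->
    (\int[leb2 R]_(z in cyl L) `|if (c < z.2 < d)%R then pe q z else 0%R|%:E < +oo)%E.
  move=> ac db; have [_ iq] := loc_integrable_pext L_gt0 lq ac db.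
  apply: le_lt_trans iq; rewrite le_eqVlt; apply/orP; left; apply/eqP; apply: eq_integral => z _.
  case: ifPn => zs; first by rewrite (pext_sub L_gt0 q (ltW ac) (ltW db) zs).
  by rewrite (pext_out L_gt0 q zs).
have bdry del : 0 < del -> exists2 eta, 0 < eta & {ae leb2 R, forall z : R * R, a < z.2 < b ->
    ~~ (a + eta <= z.2 <= b - eta) -> `|U2 z| <= del}.
  move=> del0; have [eta eta0 h] := zero_trace_small a_lt_b tr del0; exists eta => //.
  apply: filterS2 Uae2 (ae_channel_strip L_gt0 h) => z h1 h2 zs zo.
  by rewrite (h1 zs) /pe (pextE L_gt0) zs; exact: h2.
have U20 := cross_velocity_vanishes L_gt0 k0 (measurable_pext_loc L_gt0 lq) (xper_pext L_gt0 a b q)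
  mU1 pU1 mU2 pU2 iQ U1b U2b LG1 LG2 L1x L1y L2x L2y DQx DQy D1x D1y D2x D2y mom bdry.
have [mU2y pU2y iU2y _] := L2y; have [mU1x pU1x iU1x _] := L1x.
have U2y0 := diffq_zero_deriv L_gt0 (or_intror erefl) mU2y pU2y iU2y D2y U20.
have U1x0 : {ae leb2 R, forall z, U1x z = 0}.
  apply: filterS2 divU U2y0 => z h1 h2; have [zs|zs] := boolP (a < z.2 < b); last exact: out.
  by have := h1 zs; rewrite (h2 zs) addr0.
have avg := ae_average (a := a) (b := b) L_gt0 mU1 (diffq_ex_const L_gt0 mU1x pU1x D1x U1x0).
(* The profile is the mean of the first component over the circle at height y. *)
exists (fun y => L^-1 * \int[lebesgue_measure]_(t in `[0, L]) U1 (t, y)).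
apply: filterS3 avg Uae U20 => z h1 h2 h3 zc.
have zs : a < z.2 < b by case: zc => _; rewrite /= in_itv.
have zcyl : cyl L z by case: zc.
have [e1 e2] := h2 zs.
rewrite /shear -h1// e1 -(h3 zs) e2 /pe !(pext_channel L_gt0)//.
exact: surjective_pairing.
Qed.
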